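(* Let $f(x)$ be an entire function of exponential type $\tau>0$ satisfying $f(-x)=f(x)$. For every positive integer $m$ and $\lambda>\tau/2$, $$\int_{0}^{\infty}\frac{f(x)\,\sin^{2m}(\lambda x)}{x^{2m}}\,dx=\frac{(2m)!}{2^{2m}(m!)^2}\;\mathrm{f.p.}\!\int_{0}^{\infty}\frac{f(x)}{x^{2m}}\,dx-\frac{\pi(-1)^m(2m)!}{2^{2m}}\sum_{l=0}^{m-1}C_{l,m}\,\lambda^{2l+1},$$ where $\mathrm{f.p.}\!\int_{0}^{\infty}\frac{f(x)}{x^{2m}}\,dx$ is the (Hadamard) finite part of the divergent integral $\int_{0}^{\infty}\frac{f(x)}{x^{2m}}\,dx$, and $$C_{l,m}=\frac{(-1)^l\,2^{2l+1}\,f^{(2m-2l-2)}(0)}{(2l+1)!\,(2m-2l-2)!}\sum_{k=0}^{m-1}\frac{(-1)^k(m-k)^{2l+1}}{k!\,(2m-k)!}.$$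
   Context: An entire function $f$ is of exponential type $\tau$ if for every arbitrarily small $\epsilon>0$ the inequality $|f(z)|\le e^{(\tau+\epsilon)|z|}$ holds for all complex $z$ with $|z|$ sufficiently large. Hadamard finite part: for $\epsilon>0$ write $\int_{\epsilon}^{\infty}\frac{f(x)}{x^{2m}}\,dx=D_\epsilon+C_\epsilon$, where $D_\epsilon$ consists of the terms (algebraic powers of $\epsilon$ and $\ln\epsilon$) that diverge as $\epsilon\to0$, and $C_\epsilon$ consists of the terms that converge as $\epsilon\to 0$. The finite part is $\mathrm{f.p.}\!\int_{0}^{\infty}\frac{f(x)}{x^{2m}}\,dx:=\lim_{\epsilon\to0}C_\epsilon$. $f^{(j)}(0)$ denotes the $j$-th derivative of $f$ at $0$, with $f^{(0)}=f$.
   Formalization: The formal theorem adds the assumption that the integral of f(x)/x^{2m} over [ε,∞) converges (possibly conditionally) for every ε>0; without it, e.g. for f = cosh, the finite part is undefined and the left-hand integral diverges. *)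

(* Defs.v *)
From Stdlib Require Export Reals Factorial List.
From Coquelicot Require Export Coquelicot.
Open Scope R_scope.

Definition entire (f : C -> C) : Prop :=
  forall z : C, ex_derive (K := C_AbsRing) (V := C_NormedModule) f z.

Definition exponential_type (f : C -> C) (tau : R) : Prop :=
  forall eps : R, 0 < eps ->
    exists r : R, forall z : C, r <= Cmod z ->
      Cmod (f z) <= exp ((tau + eps) * Cmod z).

(* [C_derive] is total; on entire functions its iterates are the true
   derivatives. *)
Definition C_derive_n (f : C -> C) (n : nat) : C -> C :=
  Nat.iter n C_derive f.

(* The term [coef * eps ^ (- expo) * (ln eps) ^ logp]. *)
Record asym_term : Type :=
  AsymTerm { coef : C; expo : R; logp : nat }.

Definition term_val (t : asym_term) (eps : R) : C :=
  (coef t * RtoC (Rpower eps (- expo t) * ln eps ^ logp t))%C.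

(* Exactly the exponents for which the (monomial) term diverges as
   [eps] tends to [0+]. *)
Definition divergent_term (t : asym_term) : Prop :=
  0 < expo t \/ (expo t = 0 /\ (0 < logp t)%nat).

Definition terms_val (ts : list asym_term) (eps : R) : C :=
  fold_right (fun t s => (term_val t eps + s)%C) (RtoC 0) ts.

(* The integral over [[eps, +oo)] is an improper Riemann integral with value
   [v]; convergence may be conditional. *)
Definition is_tail_integral (g : R -> C) (eps : R) (v : C) : Prop :=
  is_RInt_gen (V := C_R_NormedModule) g
    (at_point eps) (Rbar_locally p_infty) v.

(* [v] is the Hadamard finite part of the integral of [g] over [(0, +oo)]:
   [D eps] is [terms_val ts eps], [C eps] is [Ce eps]. *)
Definition is_finite_part (g : R -> C) (v : C) : Prop :=
  exists (ts : list asym_term) (Ce : R -> C),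
    List.Forall divergent_term ts /\
    (forall eps : R, 0 < eps ->
       is_tail_integral g eps (terms_val ts eps + Ce eps)%C) /\
    filterlim Ce (at_right 0) (locally (T := C_UniformSpace) v).

(* Improper at both ends, so the value of [g] at [0] is irrelevant. *)
Definition is_integral_0_infty (g : R -> C) (v : C) : Prop :=
  is_RInt_gen (V := C_R_NormedModule) g
    (at_right 0) (Rbar_locally p_infty) v.

Definition Clm (f : C -> C) (l m : nat) : C :=
  (RtoC ((-1) ^ l * 2 ^ (2 * l + 1)
         / (INR (fact (2 * l + 1)) * INR (fact (2 * m - 2 * l - 2))))
   * C_derive_n f (2 * m - 2 * l - 2) (RtoC 0)
   * RtoC (sum_n (fun k => ((-1) ^ k * INR (m - k) ^ (2 * l + 1)
                            / (INR (fact k) * INR (fact (2 * m - k))))%R)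
                 (m - 1)))%C.

(* Main.v *)
(* Write the even Taylor expansion [f z = sum_(j < m) a_j z^(2j) + z^(2m) g z] with
   [g] entire, even and of exponential type [tau]. The polynomial part contributes
   only divergent powers of [eps] to the tail integral of [f x / x^(2m)], so the
   finite part is [L], the integral of [g] over the half line.

   Since [sin^(2m) (lambda x)] is a combination of [cos (2 (m - k) lambda x)], the
   contribution of [g] is [binom(2m, m) / 2^(2m) L] once the integral of
   [g x cos (w x)] is shown to vanish for every [w > tau]. Let [G] be the primitive
   of [g] vanishing at [0], so that [G] is odd and tends to [L] at [+oo]. The
   Phragmen-Lindelof principle in the quadrants bounds [G - L] by [C e^(s |y|)] for
   [s > tau], and [G - L] even is [o(e^(s |y|))] uniformly as [x] tends to [+oo];
   moving the integral of [g e^(iwx)] over [-X, X] up to height [Y], then letting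
   [Y] and [X] tend to infinity, gives [0]. The hypothesis on the tail integral
   gives only conditional convergence, which is why the estimates bear on [G]
   rather than on [g].

   The terms [a_j x^(2j)] reduce to the integrals of [sin^(2m) (lambda x) / x^(2p)],
   [p <= m]. As the polynomials of degree less than [2m] are killed by the central
   difference of order [2m], each cosine may be replaced by its Taylor remainder,
   and integrations by parts lead to the Dirichlet integral. *)

From Stdlib Require Import Lra Lia ClassicalEpsilon Classical FunctionalExtensionality.
Require Import Defs.

(** The complex analysis rests on integrals over rectangles. In Cauchy's formula the integral of
    [1 / (w - z)] is only shown to be nonzero: a holomorphic function is then a quotient of two
    Cauchy integrals, which is enough for its derivatives and for the maximum principle. Each
    improper integral is carried by a primitive with known limits at 0 and at infinity.
    Conditionally convergent integrals can then be added and scaled without any estimate on the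
    integrands. The condition [tau / 2 < lambda] leaves room for a rate [s] strictly between [tau]
    and [2 lambda]. The frequencies in the expansion of the sine power are even multiples of
    [lambda], so the nonzero ones exceed [s], and only the zero frequency sees [L]. A finite part is
    a mere existence statement about some list of divergent terms, with repetitions and logarithms
    allowed. Its value is therefore compared with [L] through the fact that divergent monomials
    cannot add up to a function with a nonzero finite limit. *)

(** * Continuity and differentiability of functions of a complex variable *)

Definition ccont (f : C -> C) (z : C) : Prop :=
  forall eps, 0 < eps -> exists del, 0 < del /\
    forall w, Cmod (w - z) < del -> Cmod (f w - f z) < eps.

(* Caratheodory's form of complex differentiability: products, compositions
   and inverses then reduce to continuity and algebra. *)
Definition cderiv (f : C -> C) (z l : C) : Prop :=
  exists (phi : C -> C) (r : R), 0 < r /\ ccont phi z /\ phi z = l /\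
    forall w, Cmod (w - z) < r -> f w = (f z + phi w * (w - z))%C.

Definition holo (f : C -> C) (z : C) : Prop := exists l, cderiv f z l.

Lemma C_ext (z w : C) : fst z = fst w -> snd z = snd w -> z = w.
Proof. destruct z, w; simpl; intros; subst; reflexivity. Qed.

Lemma Cmod_sub_ge (a b : C) : Cmod a - Cmod b <= Cmod (a - b).
Proof.
  pose proof (Cmod_triangle (a - b) b) as H.
  replace (a - b + b)%C with a in H by ring. lra.
Qed.

Lemma Cmod_sub_sym (a b : C) : Cmod (a - b) = Cmod (b - a).
Proof. rewrite <- Cmod_opp. f_equal. ring. Qed.

Lemma fst_le_Cmod (z : C) : Rabs (fst z) <= Cmod z.
Proof. exact (re_le_Cmod z). Qed.

Lemma Cmod_rotate (z : C) : Cmod (Ci * z) = Cmod z.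
Proof. rewrite Cmod_mult, Cmod_Ci. ring. Qed.

Lemma snd_le_Cmod (z : C) : Rabs (snd z) <= Cmod z.
Proof.
  pose proof (fst_le_Cmod (Ci * z)) as H. rewrite Cmod_rotate in H.
  replace (fst (Ci * z)%C) with (- snd z) in H by (simpl; ring).
  rewrite Rabs_Ropp in H. exact H.
Qed.

Lemma Cmod_le_abs (z : C) : Cmod z <= Rabs (fst z) + Rabs (snd z).
Proof.
  destruct z as [x y]. simpl.
  replace ((x, y) : C) with (RtoC x + Ci * RtoC y)%C
    by (apply C_ext; simpl; ring).
  eapply Rle_trans; [apply Cmod_triangle|].
  rewrite Cmod_rotate, !Cmod_R. lra.
Qed.

Lemma Cmod_pair_sub (x y x' y' : R) :
  Cmod ((x, y) - (x', y')) <= Rabs (x - x') + Rabs (y - y').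
Proof. exact (Cmod_le_abs ((x, y) - (x', y'))%C). Qed.

Lemma ccont_const (c z : C) : ccont (fun _ => c) z.
Proof.
  intros eps He. exists 1. split; [lra|]. intros w _.
  replace (c - c)%C with (RtoC 0) by ring. rewrite Cmod_0. exact He.
Qed.

Lemma ccont_id (z : C) : ccont (fun w => w) z.
Proof. intros eps He. exists eps. auto. Qed.

Lemma ccont_plus (f g : C -> C) (z : C) :
  ccont f z -> ccont g z -> ccont (fun w => f w + g w)%C z.
Proof.
  intros Hf Hg eps He.
  destruct (Hf (eps / 2)) as [d1 [Hd1 H1]]; [lra|].
  destruct (Hg (eps / 2)) as [d2 [Hd2 H2]]; [lra|].
  exists (Rmin d1 d2). split; [now apply Rmin_glb_lt|].
  intros w Hw.
  specialize (H1 w (Rlt_le_trans _ _ _ Hw (Rmin_l _ _))).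
  specialize (H2 w (Rlt_le_trans _ _ _ Hw (Rmin_r _ _))).
  replace (f w + g w - (f z + g z))%C with ((f w - f z) + (g w - g z))%C by ring.
  eapply Rle_lt_trans; [apply Cmod_triangle|]. lra.
Qed.

Lemma ccont_bounded (f : C -> C) (z : C) :
  ccont f z -> exists d, 0 < d /\ forall w, Cmod (w - z) < d -> Cmod (f w) <= Cmod (f z) + 1.
Proof.
  intros Hf. destruct (Hf 1) as [d [Hd H]]; [lra|].
  exists d. split; auto. intros w Hw. specialize (H w Hw).
  pose proof (Cmod_sub_ge (f w) (f z)). lra.
Qed.

Lemma ccont_mult (f g : C -> C) (z : C) :
  ccont f z -> ccont g z -> ccont (fun w => f w * g w)%C z.
Proof.
  intros Hf Hg eps He.
  destruct (ccont_bounded f z Hf) as [d0 [Hd0 H0]].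
  pose proof (Cmod_ge_0 (f z)) as Pf. pose proof (Cmod_ge_0 (g z)) as Pg.
  set (K := Cmod (f z) + 1 + Cmod (g z)) in *.
  assert (HK : 0 < K) by (unfold K; lra).
  destruct (Hf (eps / (2 * K))) as [d1 [Hd1 H1]]; [apply Rdiv_lt_0_compat; lra|].
  destruct (Hg (eps / (2 * K))) as [d2 [Hd2 H2]]; [apply Rdiv_lt_0_compat; lra|].
  exists (Rmin d0 (Rmin d1 d2)). split; [repeat apply Rmin_glb_lt; auto|].
  intros w Hw.
  assert (Hw0 : Cmod (w - z) < d0) by (eapply Rlt_le_trans; [exact Hw|apply Rmin_l]).
  assert (Hw' : Cmod (w - z) < Rmin d1 d2) by (eapply Rlt_le_trans; [exact Hw|apply Rmin_r]).
  specialize (H0 w Hw0).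
  specialize (H1 w (Rlt_le_trans _ _ _ Hw' (Rmin_l _ _))).
  specialize (H2 w (Rlt_le_trans _ _ _ Hw' (Rmin_r _ _))).
  replace (f w * g w - f z * g z)%C with (f w * (g w - g z) + (f w - f z) * g z)%C by ring.
  eapply Rle_lt_trans; [apply Cmod_triangle|]. rewrite !Cmod_mult.
  assert (E : eps = K * (eps / (2 * K)) + (eps / (2 * K)) * K) by (field; lra).
  set (e := eps / (2 * K)) in *.
  pose proof (Cmod_ge_0 (g w - g z)). pose proof (Cmod_ge_0 (f w - f z)).
  assert (Cmod (f w) * Cmod (g w - g z) <= K * Cmod (g w - g z))
    by (apply Rmult_le_compat_r; unfold K; lra).
  assert (Cmod (f w - f z) * Cmod (g z) <= Cmod (f w - f z) * K)
    by (apply Rmult_le_compat_l; unfold K; lra).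
  assert (K * Cmod (g w - g z) < K * e) by (apply Rmult_lt_compat_l; lra).
  assert (Cmod (f w - f z) * K < e * K) by (apply Rmult_lt_compat_r; lra).
  lra.
Qed.

Lemma ccont_comp (f g : C -> C) (z : C) :
  ccont f z -> ccont g (f z) -> ccont (fun w => g (f w)) z.
Proof.
  intros Hf Hg eps He. destruct (Hg eps He) as [d [Hd H]].
  destruct (Hf d Hd) as [d' [Hd' H']]. exists d'. split; auto.
Qed.

Lemma Cmult_nz (a b : C) : a <> 0%C -> b <> 0%C -> (a * b)%C <> 0%C.
Proof.
  intros Ha Hb. apply Cmod_gt_0. rewrite Cmod_mult.
  apply Rmult_lt_0_compat; now apply Cmod_gt_0.
Qed.

Lemma ccont_Cinv (z : C) : z <> 0%C -> ccont Cinv z.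
Proof.
  intros Hz eps He.
  assert (Pz : 0 < Cmod z) by (now apply Cmod_gt_0).
  assert (Q : 0 < eps * (Cmod z * Cmod z) / 2)
    by (apply Rdiv_lt_0_compat; [apply Rmult_lt_0_compat; [lra|apply Rmult_lt_0_compat; lra]|lra]).
  exists (Rmin (Cmod z / 2) (eps * (Cmod z * Cmod z) / 2)).
  split; [apply Rmin_glb_lt; lra|].
  intros w Hw.
  assert (H1 : Cmod (w - z) < Cmod z / 2) by (eapply Rlt_le_trans; [exact Hw|apply Rmin_l]).
  assert (H2 : Cmod (w - z) < eps * (Cmod z * Cmod z) / 2) by (eapply Rlt_le_trans; [exact Hw|apply Rmin_r]).
  assert (Pw : Cmod z / 2 < Cmod w).
  { pose proof (Cmod_sub_ge z w). rewrite Cmod_sub_sym in H. lra. }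
  assert (Hw0 : w <> 0%C) by (apply Cmod_gt_0; lra).
  replace (/ w - / z)%C with (- (w - z) * / (w * z))%C by (field; auto).
  rewrite Cmod_mult, Cmod_opp, Cmod_inv, Cmod_mult
    by (apply Cmult_nz; auto).
  apply Rmult_lt_reg_r with (Cmod w * Cmod z); [apply Rmult_lt_0_compat; lra|].
  rewrite Rmult_assoc, Rinv_l by (apply Rgt_not_eq, Rmult_lt_0_compat; lra).
  rewrite Rmult_1_r. eapply Rlt_trans; [exact H2|].
  assert (Cmod z / 2 * Cmod z < Cmod w * Cmod z) by (apply Rmult_lt_compat_r; lra).
  assert (eps * (Cmod z / 2 * Cmod z) < eps * (Cmod w * Cmod z)) by (apply Rmult_lt_compat_l; lra).
  lra.
Qed.

Lemma ccont_ext_loc (f g : C -> C) (z : C) (r : R) :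
  0 < r -> (forall w, Cmod (w - z) < r -> f w = g w) -> ccont f z -> ccont g z.
Proof.
  intros Hr E Hf eps He. destruct (Hf eps He) as [d [Hd H]].
  exists (Rmin d r). split; [now apply Rmin_glb_lt|]. intros w Hw.
  rewrite <- !E.
  - apply H. eapply Rlt_le_trans; [exact Hw|apply Rmin_l].
  - replace (z - z)%C with (RtoC 0) by ring. now rewrite Cmod_0.
  - eapply Rlt_le_trans; [exact Hw|apply Rmin_r].
Qed.

Lemma cderiv_ccont (f : C -> C) (z l : C) : cderiv f z l -> ccont f z.
Proof.
  intros (phi & r & Hr & Hc & _ & E).
  apply (ccont_ext_loc (fun w => f z + phi w * (w - z))%C f z r Hr).
  - intros w Hw. symmetry. now apply E.
  - apply ccont_plus; [apply ccont_const|]. apply ccont_mult; auto.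
    apply ccont_plus; [apply ccont_id|apply ccont_const].
Qed.

Lemma holo_ccont (f : C -> C) (z : C) : holo f z -> ccont f z.
Proof. intros [l H]. now apply cderiv_ccont in H. Qed.

Lemma cderiv_ext_loc (f g : C -> C) (z l : C) (r : R) :
  0 < r -> (forall w, Cmod (w - z) < r -> f w = g w) -> cderiv f z l -> cderiv g z l.
Proof.
  intros Hr E (phi & r' & Hr' & Hc & Hl & E').
  exists phi, (Rmin r r'). split; [now apply Rmin_glb_lt|]. split; auto. split; auto.
  intros w Hw. rewrite <- !E.
  - apply E'. eapply Rlt_le_trans; [exact Hw|apply Rmin_r].
  - replace (z - z)%C with (RtoC 0) by ring. now rewrite Cmod_0.
  - eapply Rlt_le_trans; [exact Hw|apply Rmin_l].
Qed.

Lemma cderiv_ext (f g : C -> C) (z l : C) :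
  (forall w, f w = g w) -> cderiv f z l -> cderiv g z l.
Proof. intros E. apply cderiv_ext_loc with 1; [lra|auto]. Qed.

Lemma cderiv_eq (f : C -> C) (z l l' : C) : cderiv f z l -> l = l' -> cderiv f z l'.
Proof. intros H <-. exact H. Qed.

(** The slope required by [cderiv] is the difference quotient, completed by the value [l] at [z];
    the hypothesis is its continuity there. *)
Lemma cderiv_intro (f : C -> C) (z l : C) :
  (forall eps, 0 < eps -> exists del, 0 < del /\ forall w, Cmod (w - z) < del ->
     Cmod (f w - f z - l * (w - z)) <= eps * Cmod (w - z)) -> cderiv f z l.
Proof.
  intros H.
  exists (fun w => if Ceq_dec w z then l else (f w - f z) / (w - z))%C, 1.
  split; [lra|]. split; [|split].
  - intros eps He. destruct (H (eps / 2)) as [d [Hd Hw]]; [lra|].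
    exists d. split; auto. intros w Hwd. destruct (Ceq_dec z z) as [_|]; [|easy].
    destruct (Ceq_dec w z) as [->|N].
    + replace (l - l)%C with (RtoC 0) by ring. now rewrite Cmod_0.
    + assert (N' : (w - z)%C <> 0%C) by (intro E; apply N; replace w with (w - z + z)%C by ring; rewrite E; ring).
      specialize (Hw w Hwd).
      replace ((f w - f z) / (w - z) - l)%C with ((f w - f z - l * (w - z)) / (w - z))%C by (field; auto).
      rewrite Cmod_div by auto. apply Cmod_gt_0 in N'.
      apply Rmult_lt_reg_r with (Cmod (w - z)); auto. unfold Rdiv.
      rewrite Rmult_assoc, Rinv_l by lra. 
      assert (0 < eps * Cmod (w - z)) by (apply Rmult_lt_0_compat; lra). lra.
  - destruct (Ceq_dec z z); easy.
  - intros w _. destruct (Ceq_dec w z) as [->|N]; [ring|].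
    field. intro E; apply N; replace w with (w - z + z)%C by ring; rewrite E; ring.
Qed.

Lemma cderiv_elim (f : C -> C) (z l : C) :
  cderiv f z l -> forall eps, 0 < eps -> exists del, 0 < del /\ forall w, Cmod (w - z) < del ->
     Cmod (f w - f z - l * (w - z)) <= eps * Cmod (w - z).
Proof.
  intros (phi & r & Hr & Hc & Hl & E) eps He.
  destruct (Hc eps He) as [d [Hd H]].
  exists (Rmin d r). split; [now apply Rmin_glb_lt|]. intros w Hw.
  rewrite (E w) by (eapply Rlt_le_trans; [exact Hw|apply Rmin_r]).
  replace (f z + phi w * (w - z) - f z - l * (w - z))%C with ((phi w - phi z) * (w - z))%C by (rewrite Hl; ring).
  rewrite Cmod_mult. apply Rmult_le_compat_r; [apply Cmod_ge_0|].
  left. apply H. eapply Rlt_le_trans; [exact Hw|apply Rmin_l].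
Qed.

Lemma cderiv_const (c z : C) : cderiv (fun _ => c) z 0.
Proof.
  exists (fun _ => RtoC 0), 1. repeat split; try lra; [apply ccont_const|intros; ring].
Qed.

Lemma cderiv_id (z : C) : cderiv (fun w => w) z 1.
Proof.
  exists (fun _ => RtoC 1), 1. repeat split; try lra; [apply ccont_const|intros; ring].
Qed.

Lemma cderiv_plus (f g : C -> C) (z l k : C) :
  cderiv f z l -> cderiv g z k -> cderiv (fun w => f w + g w)%C z (l + k).
Proof.
  intros (p & r & Hr & Hc & Hl & E) (q & s & Hs & Hd & Hk & F).
  exists (fun w => p w + q w)%C, (Rmin r s).
  split; [now apply Rmin_glb_lt|]. split; [now apply ccont_plus|]. split; [now rewrite Hl, Hk|].
  intros w Hw. rewrite (E w), (F w); [ring| |].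
  - eapply Rlt_le_trans; [exact Hw|apply Rmin_r].
  - eapply Rlt_le_trans; [exact Hw|apply Rmin_l].
Qed.

Lemma cderiv_mult (f g : C -> C) (z l k : C) :
  cderiv f z l -> cderiv g z k -> cderiv (fun w => f w * g w)%C z (l * g z + f z * k).
Proof.
  intros Hf Hg. pose proof (cderiv_ccont _ _ _ Hg) as Cg. revert Hf Hg.
  intros (p & r & Hr & Hc & Hl & E) (q & s & Hs & Hd & Hk & F).
  exists (fun w => p w * g w + f z * q w)%C, (Rmin r s).
  split; [now apply Rmin_glb_lt|]. split.
  { apply ccont_plus; apply ccont_mult; auto. apply ccont_const. }
  split; [now rewrite Hl, Hk|].
  intros w Hw. rewrite (E w).
  - rewrite (F w); [ring|]. eapply Rlt_le_trans; [exact Hw|apply Rmin_r].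
  - eapply Rlt_le_trans; [exact Hw|apply Rmin_l].
Qed.

Lemma cderiv_comp (f g : C -> C) (z l k : C) :
  cderiv f z l -> cderiv g (f z) k -> cderiv (fun w => g (f w)) z (k * l).
Proof.
  intros Hf Hg. pose proof (cderiv_ccont _ _ _ Hf) as Cf. revert Hf Hg.
  intros (p & r & Hr & Hc & Hl & E) (q & s & Hs & Hd & Hk & F).
  destruct (Cf s Hs) as [d [Hd' Hds]].
  exists (fun w => q (f w) * p w)%C, (Rmin r d).
  split; [now apply Rmin_glb_lt|]. split.
  { apply ccont_mult; auto. now apply ccont_comp. }
  split; [now rewrite Hl, Hk|].
  intros w Hw. rewrite (F (f w)).
  - rewrite (E w) at 2; [ring|]. eapply Rlt_le_trans; [exact Hw|apply Rmin_l].
  - apply Hds. eapply Rlt_le_trans; [exact Hw|apply Rmin_r].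
Qed.

Lemma cderiv_Cinv (z : C) : z <> 0%C -> cderiv Cinv z (- / (z * z)).
Proof.
  intros Hz. exists (fun w => - (/ w * / z))%C, (Cmod z).
  split; [now apply Cmod_gt_0|]. split; [|split].
  - apply (ccont_ext_loc (fun w => (- / z) * / w)%C _ z 1); [lra|intros; ring|].
    apply ccont_mult; [apply ccont_const|now apply ccont_Cinv].
  - field; auto.
  - intros w Hw. assert (w <> 0%C).
    { intros ->. replace (0 - z)%C with (- z)%C in Hw by ring. rewrite Cmod_opp in Hw. lra. }
    field; auto.
Qed.

Lemma cderiv_opp (f : C -> C) (z l : C) : cderiv f z l -> cderiv (fun w => - f w)%C z (- l).
Proof.
  intros (p & r & Hr & Hc & Hl & E).
  exists (fun w => RtoC (-1) * p w)%C, r. split; auto. split.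
  { apply ccont_mult; auto. apply ccont_const. }
  split; [rewrite Hl; apply C_ext; simpl; ring|].
  intros w Hw. rewrite (E w Hw). apply C_ext; simpl; ring.
Qed.

Lemma cderiv_minus (f g : C -> C) (z l k : C) :
  cderiv f z l -> cderiv g z k -> cderiv (fun w => f w - g w)%C z (l - k).
Proof. intros Hf Hg. apply cderiv_plus; auto. now apply cderiv_opp. Qed.

Lemma cderiv_scal (c : C) (f : C -> C) (z l : C) :
  cderiv f z l -> cderiv (fun w => c * f w)%C z (c * l).
Proof.
  intros H. eapply cderiv_eq; [apply cderiv_mult; [apply cderiv_const|exact H]|]. cbv beta; ring.
Qed.

Lemma cderiv_pow (f : C -> C) (n : nat) (z l : C) :
  cderiv f z l -> cderiv (fun w => f w ^ n)%C z (RtoC (INR n) * f z ^ pred n * l).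
Proof.
  intros H. induction n as [|n IH].
  - eapply cderiv_eq; [apply (cderiv_const 1)|]. simpl. ring.
  - eapply cderiv_eq; [apply (cderiv_mult f (fun w => f w ^ n)%C); [exact H|exact IH]|].
    rewrite S_INR, RtoC_plus. destruct n as [|n]; [simpl; ring|].
    generalize (INR (S n)). intro; simpl; ring.
Qed.

(** The bridge to the derivative of Coquelicot, in which [entire] and [C_derive] are stated; complex
    derivatives are computed with [cderiv]. *)
Lemma is_derive_cderiv (f : C -> C) (z l : C) :
  is_derive (K := C_AbsRing) (V := C_NormedModule) f z l <-> cderiv f z l.
Proof.
  split.
  - intros [_ H]. apply cderiv_intro. intros eps He.
    destruct (H z (fun P HP => HP) (mkposreal eps He)) as [d Hd].
    exists d. split; [apply cond_pos|]. intros w Hw. specialize (Hd w Hw).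
    simpl in Hd. 
    replace (l * (w - z))%C with ((w - z) * l)%C by ring. exact Hd.
  - intros H. split; [apply is_linear_scal_l|].
    intros x Hx. apply (is_filter_lim_locally_unique (V := AbsRing_NormedModule C_AbsRing)) in Hx. subst x.
    intros [eps He]. destruct (cderiv_elim _ _ _ H eps He) as [d [Hd Hw]].
    exists (mkposreal d Hd). intros w Hwd. specialize (Hw w Hwd). simpl.
    replace (l * (w - z))%C with ((w - z) * l)%C in Hw by ring. exact Hw.
Qed.

Lemma cderiv_C_derive (f : C -> C) (z l : C) : cderiv f z l -> C_derive f z = l.
Proof. intros H. apply is_C_derive_unique. now apply is_derive_cderiv. Qed.

Lemma entire_holo (f : C -> C) : entire f <-> forall z, holo f z.
Proof.
  split; intros H z; destruct (H z) as [l Hl]; exists l; now apply is_derive_cderiv.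
Qed.

Lemma holo_C_derive (f : C -> C) (z : C) : holo f z -> cderiv f z (C_derive f z).
Proof. intros [l H]. now rewrite (cderiv_C_derive _ _ _ H). Qed.

Lemma holo_const (c z : C) : holo (fun _ => c) z.
Proof. eexists; apply cderiv_const. Qed.
Lemma holo_id (z : C) : holo (fun w => w) z.
Proof. eexists; apply cderiv_id. Qed.
Lemma holo_plus (f g : C -> C) (z : C) : holo f z -> holo g z -> holo (fun w => f w + g w)%C z.
Proof. intros [l H] [k K]. eexists; apply cderiv_plus; eauto. Qed.
Lemma holo_minus (f g : C -> C) (z : C) : holo f z -> holo g z -> holo (fun w => f w - g w)%C z.
Proof. intros [l H] [k K]. eexists; apply cderiv_minus; eauto. Qed.
Lemma holo_mult (f g : C -> C) (z : C) : holo f z -> holo g z -> holo (fun w => f w * g w)%C z.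
Proof. intros [l H] [k K]. eexists; apply cderiv_mult; eauto. Qed.
Lemma holo_comp (f g : C -> C) (z : C) : holo f z -> holo g (f z) -> holo (fun w => g (f w)) z.
Proof. intros [l H] [k K]. eexists; apply cderiv_comp; eauto. Qed.
Lemma holo_inv (f : C -> C) (z : C) : f z <> 0%C -> holo f z -> holo (fun w => / f w)%C z.
Proof. intros N H. apply (holo_comp f Cinv); auto. eexists; now apply cderiv_Cinv. Qed.
Lemma holo_pow (f : C -> C) (n : nat) (z : C) : holo f z -> holo (fun w => f w ^ n)%C z.
Proof. intros [l H]. eexists; apply cderiv_pow; eauto. Qed.
Lemma holo_ext (f g : C -> C) (z : C) : (forall w, f w = g w) -> holo f z -> holo g z.
Proof. intros E [l H]. exists l. now apply (cderiv_ext f). Qed.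
Lemma holo_ext_loc (f g : C -> C) (z : C) (r : R) :
  0 < r -> (forall w, Cmod (w - z) < r -> f w = g w) -> holo f z -> holo g z.
Proof. intros Hr E [l H]. exists l. now apply (cderiv_ext_loc f g z l r). Qed.

(** * Integrals of complex-valued functions of a real variable *)

Definition rcont (f : R -> C) (t : R) : Prop :=
  continuous (U := C_R_NormedModule) f t.

Definition CI (f : R -> C) (a b : R) : C :=
  RInt (V := C_R_CompleteNormedModule) f a b.

Lemma rcont_intro (f : R -> C) (t : R) :
  (forall eps, 0 < eps -> exists del, 0 < del /\
     forall s, Rabs (s - t) < del -> Cmod (f s - f t) < eps) -> rcont f t.
Proof.
  intros H P [eps HP]. destruct (H eps (cond_pos eps)) as [d [Hd Hs]].
  exists (mkposreal d Hd). intros s Hst. apply HP. specialize (Hs s Hst).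
  split.
  - eapply Rle_lt_trans; [apply (fst_le_Cmod (f s - f t)%C)|exact Hs].
  - eapply Rle_lt_trans; [apply (snd_le_Cmod (f s - f t)%C)|exact Hs].
Qed.

(** The balls of [C_R_NormedModule] are squares; the one of radius [eps / 2] lies in the disc of
    radius [eps]. *)
Lemma rcont_elim (f : R -> C) (t : R) : rcont f t ->
  forall eps, 0 < eps -> exists del, 0 < del /\
     forall s, Rabs (s - t) < del -> Cmod (f s - f t) < eps.
Proof.
  intros H eps He.
  assert (He' : 0 < eps / 2) by lra.
  destruct (H (ball (f t : C_R_NormedModule) (mkposreal _ He'))) as [d Hd].
  { now exists (mkposreal _ He'). }
  exists d. split; [apply cond_pos|]. intros s Hs. destruct (Hd s Hs) as [H1 H2].
  eapply Rle_lt_trans; [apply Cmod_le_abs|].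
  change (Rabs (fst (f s) - fst (f t)) < eps / 2) in H1.
  change (Rabs (snd (f s) - snd (f t)) < eps / 2) in H2.
  change (Rabs (fst (f s) - fst (f t)) + Rabs (snd (f s) - snd (f t)) < eps). lra.
Qed.

Lemma rcont_ccont (f : C -> C) (g : R -> C) (t : R) :
  rcont g t -> ccont f (g t) -> rcont (fun s => f (g s)) t.
Proof.
  intros Hg Hf. apply rcont_intro. intros eps He.
  destruct (Hf eps He) as [d [Hd H]].
  destruct (rcont_elim g t Hg d Hd) as [d' [Hd' H']].
  exists d'. split; auto.
Qed.

Lemma rcont_horizontal (y t : R) : rcont (fun s => (s, y)) t.
Proof.
  apply rcont_intro. intros eps He. exists eps. split; auto. intros s Hs.
  eapply Rle_lt_trans; [apply Cmod_pair_sub|].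
  rewrite Rminus_diag, Rabs_R0. lra.
Qed.

Lemma rcont_vertical (x t : R) : rcont (fun s => (x, s)) t.
Proof.
  apply rcont_intro. intros eps He. exists eps. split; auto. intros s Hs.
  eapply Rle_lt_trans; [apply Cmod_pair_sub|].
  rewrite Rminus_diag, Rabs_R0. lra.
Qed.

Lemma rcont_mult (f g : R -> C) (t : R) :
  rcont f t -> rcont g t -> rcont (fun s => f s * g s)%C t.
Proof.
  intros Hf Hg. apply rcont_intro. intros eps He.
  assert (Pf := Cmod_ge_0 (f t)). assert (Pg := Cmod_ge_0 (g t)).
  set (K := Cmod (f t) + Cmod (g t) + 1).
  assert (HK : 0 < K) by (unfold K; lra).
  assert (He' : 0 < Rmin 1 (eps / (2 * K)))
    by (apply Rmin_glb_lt; [lra|apply Rdiv_lt_0_compat; lra]).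
  destruct (rcont_elim f t Hf _ He') as [d1 [Hd1 H1]].
  destruct (rcont_elim g t Hg _ He') as [d2 [Hd2 H2]].
  exists (Rmin d1 d2). split; [now apply Rmin_glb_lt|]. intros s Hs.
  specialize (H1 s (Rlt_le_trans _ _ _ Hs (Rmin_l _ _))).
  specialize (H2 s (Rlt_le_trans _ _ _ Hs (Rmin_r _ _))).
  assert (L1 := Rmin_l 1 (eps / (2 * K))). assert (L2 := Rmin_r 1 (eps / (2 * K))).
  set (e := Rmin 1 (eps / (2 * K))) in *.
  assert (E : eps = 2 * K * (eps / (2 * K))) by (field; lra).
  assert (Fs : Cmod (f s) <= Cmod (f t) + 1).
  { pose proof (Cmod_sub_ge (f s) (f t)). lra. }
  replace (f s * g s - f t * g t)%C with (f s * (g s - g t) + (f s - f t) * g t)%C by ring.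
  eapply Rle_lt_trans; [apply Cmod_triangle|]. rewrite !Cmod_mult.
  assert (A1 := Cmod_ge_0 (g s - g t)). assert (A2 := Cmod_ge_0 (f s - f t)).
  assert (Cmod (f s) * Cmod (g s - g t) <= K * Cmod (g s - g t))
    by (apply Rmult_le_compat_r; unfold K; lra).
  assert (Cmod (f s - f t) * Cmod (g t) <= Cmod (f s - f t) * K)
    by (apply Rmult_le_compat_l; unfold K; lra).
  assert (K * Cmod (g s - g t) < K * (eps / (2 * K))) by (apply Rmult_lt_compat_l; lra).
  assert (Cmod (f s - f t) * K < (eps / (2 * K)) * K) by (apply Rmult_lt_compat_r; lra).
  lra.
Qed.

Lemma rcont_RtoC (g : R -> R) (t : R) : continuous g t -> rcont (fun s => RtoC (g s)) t.
Proof.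
  intros H. apply rcont_intro. intros eps He.
  destruct (H (ball (g t) (mkposreal eps He))) as [d Hd]; [now exists (mkposreal eps He)|].
  exists d. split; [apply cond_pos|]. intros s Hs.
  rewrite <- RtoC_minus, Cmod_R. exact (Hd s Hs).
Qed.

Lemma rcont_const (c : C) (t : R) : rcont (fun _ => c) t.
Proof. apply continuous_const. Qed.

Lemma rcont_plus (f g : R -> C) (t : R) :
  rcont f t -> rcont g t -> rcont (fun s => f s + g s)%C t.
Proof. intros Hf Hg. exact (continuous_plus (V := C_R_NormedModule) f g t Hf Hg). Qed.

Definition icont (f : R -> C) (a b : R) : Prop :=
  forall t, Rmin a b <= t <= Rmax a b -> rcont f t.

Lemma is_RInt_CI (f : R -> C) (a b : R) : icont f a b ->
  is_RInt (V := C_R_NormedModule) f a b (CI f a b).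
Proof.
  intros H. apply (RInt_correct (V := C_R_CompleteNormedModule)).
  apply (ex_RInt_continuous (V := C_R_CompleteNormedModule)). exact H.
Qed.

Lemma CI_unique (f : R -> C) (a b : R) (l : C) :
  is_RInt (V := C_R_NormedModule) f a b l -> CI f a b = l.
Proof. exact (is_RInt_unique (V := C_R_CompleteNormedModule) f a b l). Qed.

(** The scalars of [C_R_NormedModule] are real, so a complex factor is treated on the real and
    imaginary parts. *)
Lemma is_RInt_Cmult (c : C) (f : R -> C) (a b : R) (l : C) :
  is_RInt (V := C_R_NormedModule) f a b l ->
  is_RInt (V := C_R_NormedModule) (fun t => c * f t)%C a b (c * l)%C.
Proof.
  intros H.
  assert (H1 := is_RInt_fct_extend_fst f a b l H).
  assert (H2 := is_RInt_fct_extend_snd f a b l H).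
  apply (is_RInt_fct_extend_pair (U := R_NormedModule) (V := R_NormedModule)
           (fun t => c * f t)%C a b (fst (c * l)%C) (snd (c * l)%C)).
  - apply (is_RInt_minus (V := R_NormedModule)); apply (is_RInt_scal (V := R_NormedModule)); assumption.
  - apply (is_RInt_plus (V := R_NormedModule)); apply (is_RInt_scal (V := R_NormedModule)); assumption.
Qed.

Lemma CI_scal (c : C) (f : R -> C) (a b : R) : icont f a b ->
  CI (fun t => c * f t)%C a b = (c * CI f a b)%C.
Proof. intros H. apply CI_unique, is_RInt_Cmult, is_RInt_CI, H. Qed.

Lemma CI_plus (f g : R -> C) (a b : R) : icont f a b -> icont g a b ->
  CI (fun t => f t + g t)%C a b = (CI f a b + CI g a b)%C.
Proof.
  intros Hf Hg. apply CI_unique.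
  exact (is_RInt_plus (V := C_R_NormedModule) f g a b _ _ (is_RInt_CI f a b Hf) (is_RInt_CI g a b Hg)).
Qed.

Lemma CI_ext (f g : R -> C) (a b : R) :
  (forall t, Rmin a b < t < Rmax a b -> f t = g t) -> CI f a b = CI g a b.
Proof. exact (RInt_ext (V := C_R_CompleteNormedModule) f g a b). Qed.

Lemma CI_minus (f g : R -> C) (a b : R) : icont f a b -> icont g a b ->
  CI (fun t => f t - g t)%C a b = (CI f a b - CI g a b)%C.
Proof.
  intros Hf Hg. apply CI_unique.
  exact (is_RInt_minus (V := C_R_NormedModule) f g a b _ _ (is_RInt_CI f a b Hf) (is_RInt_CI g a b Hg)).
Qed.

Lemma CI_Chasles (f : R -> C) (a b c : R) : (forall t, rcont f t) ->
  CI f a c = (CI f a b + CI f b c)%C.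
Proof.
  intros H. apply CI_unique.
  apply (is_RInt_Chasles (V := C_R_NormedModule) f a b c); apply is_RInt_CI; intros t _; apply H.
Qed.

Lemma CI_swap (f : R -> C) (a b : R) : (forall t, rcont f t) -> CI f b a = (- CI f a b)%C.
Proof.
  intros H. apply CI_unique.
  apply (is_RInt_swap (V := C_R_NormedModule) f b a); apply is_RInt_CI; intros t _; apply H.
Qed.

Lemma norm_Cmod (z : C) : norm (z : C_R_NormedModule) = Cmod z.
Proof. symmetry. apply Cmod_norm. Qed.

Lemma CI_bound_le (f : R -> C) (a b M : R) : a <= b -> icont f a b ->
  (forall t, a <= t <= b -> Cmod (f t) <= M) -> Cmod (CI f a b) <= M * (b - a).
Proof.
  intros Hab Hc HM.
  rewrite <- norm_Cmod, Rmult_comm.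
  apply (norm_RInt_le_const (V := C_R_NormedModule) f a b (CI f a b) M Hab).
  - intros x Hx. rewrite norm_Cmod. now apply HM.
  - now apply is_RInt_CI.
Qed.

Lemma CI_bound (f : R -> C) (a b M : R) : (forall t, rcont f t) ->
  (forall t, Rmin a b <= t <= Rmax a b -> Cmod (f t) <= M) ->
  Cmod (CI f a b) <= M * Rabs (b - a).
Proof.
  intros Hc HM. destruct (Rle_dec a b) as [H|H].
  - rewrite Rabs_pos_eq by lra. apply CI_bound_le; auto.
    + intros t _; apply Hc.
    + intros t Ht. apply HM. now rewrite Rmin_left, Rmax_right.
  - rewrite CI_swap, Cmod_opp by auto. rewrite Rabs_left by lra.
    replace (- (b - a)) with (a - b) by ring. apply CI_bound_le; [lra| |].
    + intros t _; apply Hc.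
    + intros t Ht. apply HM. rewrite Rmin_right, Rmax_left; lra.
Qed.

Lemma icont_bounded (f : R -> C) (a b : R) : a <= b -> icont f a b ->
  exists M, 0 < M /\ forall t, a <= t <= b -> Cmod (f t) <= M.
Proof.
  intros Hab Hc.
  destruct (bounded_continuity (V := C_R_NormedModule) f a b) as [M HM].
  { intros x Hx. apply Hc. now rewrite Rmin_left, Rmax_right. }
  exists (Rmax 1 M). split; [apply Rlt_le_trans with 1; [lra|apply Rmax_l]|].
  intros t Ht. specialize (HM t Ht). rewrite <- norm_Cmod.
  left. eapply Rlt_le_trans; [exact HM|apply Rmax_r].
Qed.

Definition rderiv (f : R -> C) (t : R) (l : C) : Prop :=
  is_derive (V := C_R_NormedModule) f t l.

Lemma rderiv_line (f : C -> C) (p v l : C) (t : R) :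
  cderiv f (p + RtoC t * v)%C l ->
  rderiv (fun s => f (p + RtoC s * v)%C) t (v * l)%C.
Proof.
  intros H. split; [apply is_linear_scal_l|].
  intros x Hx. apply (is_filter_lim_locally_unique (V := R_NormedModule)) in Hx. subst x.
  intros [eps He].
  (* The direction [v] may be zero, hence the division by [Cmod v + 1] rather than by its length. *)
  assert (Hv : 0 < Cmod v + 1) by (pose proof (Cmod_ge_0 v); lra).
  destruct (cderiv_elim _ _ _ H (eps / (Cmod v + 1))) as [d [Hd Hw]]; [now apply Rdiv_lt_0_compat|].
  assert (Hd' : 0 < d / (Cmod v + 1)) by (now apply Rdiv_lt_0_compat).
  exists (mkposreal _ Hd'). intros s Hs. simpl in *.
  change (Rabs (s - t) < d / (Cmod v + 1)) in Hs.
  specialize (Hw (p + RtoC s * v)%C).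
  replace (p + RtoC s * v - (p + RtoC t * v))%C with (RtoC (s - t) * v)%C in Hw by (rewrite RtoC_minus; ring).
  rewrite Cmod_mult, Cmod_R in Hw.
  assert (Hsv : Rabs (s - t) * Cmod v <= Rabs (s - t) * (Cmod v + 1))
    by (apply Rmult_le_compat_l; [apply Rabs_pos|lra]).
  assert (Hlt : Rabs (s - t) * Cmod v < d).
  { eapply Rle_lt_trans; [exact Hsv|].
    apply Rmult_lt_reg_r with (/ (Cmod v + 1)); [now apply Rinv_0_lt_compat|].
    rewrite Rmult_assoc, Rinv_r by lra. lra. }
  specialize (Hw Hlt).
  change (norm (minus s t)) with (Rabs (s - t)).
  match goal with |- norm ?u <= _ =>
    replace u with (f (p + RtoC s * v) - f (p + RtoC t * v) - l * (RtoC (s - t) * v))%C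
  end.
  2:{ change (minus s t) with (s - t).
      apply C_ext; simpl; unfold plus, opp, scal, mult; simpl; unfold mult; simpl; ring. }
  rewrite norm_Cmod.
  eapply Rle_trans; [exact Hw|].
  apply Rle_trans with (eps / (Cmod v + 1) * (Rabs (s - t) * (Cmod v + 1))).
  - apply Rmult_le_compat_l; [left; now apply Rdiv_lt_0_compat|exact Hsv].
  - right. field. lra.
Qed.

Lemma rderiv_ext (f g : R -> C) (t : R) (l : C) :
  (forall s, f s = g s) -> rderiv f t l -> rderiv g t l.
Proof. intros E. apply is_derive_ext. exact E. Qed.

Lemma rderiv_horizontal (f : C -> C) (x y : R) (l : C) :
  cderiv f (x, y) l -> rderiv (fun s => f (s, y)) x l.
Proof.
  intros H. apply (rderiv_ext (fun s => f ((0, y) + RtoC s * 1)%C)).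
  { intros s. f_equal. apply C_ext; simpl; ring. }
  replace l with (1 * l)%C by ring. apply rderiv_line.
  replace ((0, y) + RtoC x * 1)%C with ((x, y) : C); auto. apply C_ext; simpl; ring.
Qed.

Lemma rderiv_vertical (f : C -> C) (x y : R) (l : C) :
  cderiv f (x, y) l -> rderiv (fun s => f (x, s)) y (Ci * l)%C.
Proof.
  intros H. apply (rderiv_ext (fun s => f ((x, 0) + RtoC s * Ci)%C)).
  { intros s. f_equal. apply C_ext; simpl; ring. }
  apply rderiv_line.
  replace ((x, 0) + RtoC y * Ci)%C with ((x, y) : C); auto. apply C_ext; simpl; ring.
Qed.

Lemma CI_derive (f df : R -> C) (a b : R) :
  (forall t, Rmin a b <= t <= Rmax a b -> rderiv f t (df t)) -> icont df a b ->
  CI df a b = (f b - f a)%C.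
Proof.
  intros H Hc. apply CI_unique.
  exact (is_RInt_derive (V := C_R_CompleteNormedModule) f df a b H Hc).
Qed.

(** * Goursat's theorem and primitives *)

(** The counterclockwise boundary integral; [Ci] appears on the vertical sides because [dz = i dy]
    there. The bounds may be in either order, which changes the sign. *)
Definition rect (f : C -> C) (a b c d : R) : C :=
  (CI (fun t => f (t, c)) a b + Ci * CI (fun t => f (b, t)) c d
   - CI (fun t => f (t, d)) a b - Ci * CI (fun t => f (a, t)) c d)%C.

Definition gcont (f : C -> C) : Prop := forall z, ccont f z.

Lemma gcont_horizontal (f : C -> C) (y t : R) : gcont f -> rcont (fun s => f (s, y)) t.
Proof. intros H. apply (rcont_ccont f (fun s => (s, y))); [apply rcont_horizontal|apply H]. Qed.

Lemma gcont_vertical (f : C -> C) (x t : R) : gcont f -> rcont (fun s => f (x, s)) t.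
Proof. intros H. apply (rcont_ccont f (fun s => (x, s))); [apply rcont_vertical|apply H]. Qed.

Lemma gcont_icont_horizontal (f : C -> C) (y a b : R) : gcont f -> icont (fun s => f (s, y)) a b.
Proof. intros H t _. now apply gcont_horizontal. Qed.

Lemma gcont_icont_vertical (f : C -> C) (x a b : R) : gcont f -> icont (fun s => f (x, s)) a b.
Proof. intros H t _. now apply gcont_vertical. Qed.

Lemma rect_split_x (f : C -> C) (a m b c d : R) : gcont f ->
  rect f a b c d = (rect f a m c d + rect f m b c d)%C.
Proof.
  intros H. unfold rect.
  rewrite (CI_Chasles (fun t => f (t, c)) a m b), (CI_Chasles (fun t => f (t, d)) a m b)
    by (intros; now apply gcont_horizontal). ring.
Qed.

Lemma rect_split_y (f : C -> C) (a b c m d : R) : gcont f ->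
  rect f a b c d = (rect f a b c m + rect f a b m d)%C.
Proof.
  intros H. unfold rect.
  rewrite (CI_Chasles (fun t => f (b, t)) c m d), (CI_Chasles (fun t => f (a, t)) c m d)
    by (intros; now apply gcont_vertical). ring.
Qed.

Lemma rect_swap_x (f : C -> C) (a b c d : R) : gcont f -> rect f b a c d = (- rect f a b c d)%C.
Proof.
  intros H. unfold rect.
  rewrite (CI_swap (fun t => f (t, c)) a b), (CI_swap (fun t => f (t, d)) a b)
    by (intros; now apply gcont_horizontal). ring.
Qed.

Lemma rect_swap_y (f : C -> C) (a b c d : R) : gcont f -> rect f a b d c = (- rect f a b c d)%C.
Proof.
  intros H. unfold rect.
  rewrite (CI_swap (fun t => f (b, t)) c d), (CI_swap (fun t => f (a, t)) c d)
    by (intros; now apply gcont_vertical). ring.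
Qed.

Lemma rect_minus (f g : C -> C) (a b c d : R) : gcont f -> gcont g ->
  rect (fun z => f z - g z)%C a b c d = (rect f a b c d - rect g a b c d)%C.
Proof.
  intros Hf Hg. unfold rect.
  rewrite (CI_minus (fun t => f (t, c)) (fun t => g (t, c))),
    (CI_minus (fun t => f (t, d)) (fun t => g (t, d))),
    (CI_minus (fun t => f (b, t)) (fun t => g (b, t))),
    (CI_minus (fun t => f (a, t)) (fun t => g (a, t)));
    auto using gcont_icont_horizontal, gcont_icont_vertical. ring.
Qed.

Lemma rect_primitive (F f : C -> C) (a b c d : R) : gcont f ->
  (forall z, cderiv F z (f z)) -> rect f a b c d = 0.
Proof.
  intros Hc H. unfold rect.
  rewrite (CI_derive (fun t => F (t, c)) (fun t => f (t, c)) a b);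
    [|intros t _; apply rderiv_horizontal, H|now apply gcont_icont_horizontal].
  rewrite (CI_derive (fun t => F (t, d)) (fun t => f (t, d)) a b);
    [|intros t _; apply rderiv_horizontal, H|now apply gcont_icont_horizontal].
  rewrite <- !CI_scal by (now apply gcont_icont_vertical).
  rewrite (CI_derive (fun t => F (a, t)) (fun t => Ci * f (a, t))%C c d);
    [|intros t _; apply rderiv_vertical, H|].
  rewrite (CI_derive (fun t => F (b, t)) (fun t => Ci * f (b, t))%C c d);
    [|intros t _; apply rderiv_vertical, H|].
  - ring.
  - intros t _. apply rcont_mult; [apply rcont_const|now apply gcont_vertical].
  - intros t _. apply rcont_mult; [apply rcont_const|now apply gcont_vertical].
Qed.

Lemma rect_bound (f : C -> C) (a b c d M : R) : gcont f -> a <= b -> c <= d ->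
  (forall x y, a <= x <= b -> c <= y <= d -> Cmod (f (x, y)) <= M) ->
  Cmod (rect f a b c d) <= 2 * M * ((b - a) + (d - c)).
Proof.
  intros Hc Hab Hcd HM. unfold rect.
  assert (H1 : Cmod (CI (fun t => f (t, c)) a b) <= M * (b - a))
    by (apply CI_bound_le; auto using gcont_icont_horizontal; intros; apply HM; lra).
  assert (H2 : Cmod (CI (fun t => f (t, d)) a b) <= M * (b - a))
    by (apply CI_bound_le; auto using gcont_icont_horizontal; intros; apply HM; lra).
  assert (H3 : Cmod (CI (fun t => f (a, t)) c d) <= M * (d - c))
    by (apply CI_bound_le; auto using gcont_icont_vertical; intros; apply HM; lra).
  assert (H4 : Cmod (CI (fun t => f (b, t)) c d) <= M * (d - c))
    by (apply CI_bound_le; auto using gcont_icont_vertical; intros; apply HM; lra).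
  set (A := CI (fun t => f (t, c)) a b) in *. set (B := CI (fun t => f (b, t)) c d) in *.
  set (D := CI (fun t => f (t, d)) a b) in *. set (E := CI (fun t => f (a, t)) c d) in *.
  replace (A + Ci * B - D - Ci * E)%C with ((A + Ci * B) + (- D + - (Ci * E)))%C by ring.
  pose proof (Cmod_triangle (A + Ci * B) (- D + - (Ci * E))) as T1.
  pose proof (Cmod_triangle A (Ci * B)) as T2.
  pose proof (Cmod_triangle (- D) (- (Ci * E))) as T3.
  rewrite !Cmod_opp in T3. rewrite !Cmod_rotate in *. lra.
Qed.

(** The affine approximation of [f] at [p] has a primitive and so contributes nothing. What remains
    is at most [eps] times the size of the rectangle, integrated along a boundary of comparable
    length. *)
Lemma goursat_local (f : C -> C) (p : C) (eps : R) : gcont f -> holo f p -> 0 < eps ->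
  exists del, 0 < del /\ forall a b c d, a <= fst p <= b -> c <= snd p <= d ->
    (b - a) + (d - c) < del ->
    Cmod (rect f a b c d) <= 2 * eps * ((b - a) + (d - c)) ^ 2.
Proof.
  intros Hc [l Hl] He. destruct (cderiv_elim _ _ _ Hl eps He) as [del [Hd H]].
  exists del. split; auto. intros a b c d Hx Hy Hs.
  set (g := fun z => (f p + l * (z - p))%C).
  assert (Hg : gcont g).
  { intros z. unfold g. apply ccont_plus; [apply ccont_const|].
    apply ccont_mult; [apply ccont_const|].
    apply ccont_plus; [apply ccont_id|apply ccont_const]. }
  assert (G0 : rect g a b c d = 0).
  { apply (rect_primitive (fun z => f p * z + l * ((z - p) ^ 2 * / 2))%C); auto.
    intros z. unfold g.
    eapply cderiv_eq.
    - apply cderiv_plus; [apply cderiv_scal, cderiv_id|].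
      apply cderiv_scal. apply cderiv_mult; [|apply cderiv_const].
      apply cderiv_pow. apply cderiv_minus; [apply cderiv_id|apply cderiv_const].
    - cbv beta. apply C_ext; simpl; field. }
  replace (rect f a b c d) with (rect (fun z => f z - g z)%C a b c d)
    by (rewrite rect_minus, G0 by auto; ring).
  eapply Rle_trans.
  - apply (rect_bound _ a b c d (eps * ((b - a) + (d - c)))); try lra.
    + intros z. apply (ccont_ext_loc (fun w => f w + (- (1)) * g w)%C _ z 1); [lra|intros; ring|].
      apply ccont_plus; [apply Hc|apply ccont_mult; [apply ccont_const|apply Hg]].
    + intros x y Hxx Hyy.
      assert (Hm : Cmod ((x, y) - p) <= (b - a) + (d - c)).
      { destruct p as [p1 p2]. simpl in *. eapply Rle_trans; [apply Cmod_pair_sub|].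
        apply Rplus_le_compat; apply Rabs_le; lra. }
      unfold g. replace (f (x, y) - (f p + l * ((x, y) - p)))%C
        with (f (x, y) - f p - l * ((x, y) - p))%C by ring.
      eapply Rle_trans; [apply H; lra|]. apply Rmult_le_compat_l; lra.
  - right. ring.
Qed.

Lemma nested_point (a l : nat -> R) :
  (forall n, 0 <= l n) -> (forall n, a n <= a (S n)) ->
  (forall n, a (S n) + l (S n) <= a n + l n) ->
  exists p, forall n, a n <= p <= a n + l n.
Proof.
  intros Hl Ha Hb.
  assert (Ma : forall n k, a n <= a (n + k)%nat).
  { intros n k. induction k as [|k IH]; [rewrite Nat.add_0_r; lra|].
    rewrite Nat.add_succ_r. specialize (Ha (n + k)%nat). lra. }
  assert (Mb : forall n k, a (n + k)%nat + l (n + k)%nat <= a n + l n).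
  { intros n k. induction k as [|k IH]; [rewrite Nat.add_0_r; lra|].
    rewrite Nat.add_succ_r. specialize (Hb (n + k)%nat). lra. }
  assert (U : forall n k, a k <= a n + l n).
  { intros n k. pose proof (Ma k n). pose proof (Mb n k). pose proof (Hl (n + k)%nat).
    rewrite (Nat.add_comm k n) in H. lra. }
  destruct (completeness (fun x => exists n, x = a n)) as [p [Hp1 Hp2]].
  - exists (a 0%nat + l 0%nat). intros x [n ->]. apply U.
  - exists (a 0%nat). now exists 0%nat.
  - exists p. intros n. split; [apply Hp1; now exists n|].
    apply Hp2. intros x [k ->]. apply U.
Qed.

Lemma pow2_pos (n : nat) : 0 < 2 ^ n.
Proof. apply pow_lt. lra. Qed.

Lemma half_pow_small (s del : R) : 0 < del -> exists n, s / 2 ^ n < del.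
Proof.
  intros Hd. destruct (Rle_dec s 0) as [Hs|Hs].
  - exists 0%nat. simpl. lra.
  - destruct (pow_lt_1_zero (/ 2)) with (y := del / s) as [N HN].
    + rewrite Rabs_pos_eq; lra.
    + apply Rdiv_lt_0_compat; lra.
    + exists N. specialize (HN N (le_n N)).
      rewrite pow_inv in HN.
      rewrite Rabs_pos_eq in HN by (left; apply Rinv_0_lt_compat, pow2_pos).
      apply Rmult_lt_reg_r with (/ s); [apply Rinv_0_lt_compat; lra|].
      unfold Rdiv in *. rewrite Rmult_comm, <- Rmult_assoc, Rinv_l, Rmult_1_l by lra. exact HN.
Qed.

(** The integral is the sum of those over the four quarters, so one of them carries at least a
    quarter of it. *)
Lemma goursat_quarter (f : C -> C) (a c w h eta : R) : gcont f -> 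
  eta <= Cmod (rect f a (a + w) c (c + h)) ->
  exists a' c', (a' = a \/ a' = a + w / 2) /\ (c' = c \/ c' = c + h / 2) /\
    eta / 4 <= Cmod (rect f a' (a' + w / 2) c' (c' + h / 2)).
Proof.
  intros Hc He. apply NNPP. intros N.
  assert (B : forall a' c', (a' = a \/ a' = a + w / 2) -> (c' = c \/ c' = c + h / 2) ->
    Cmod (rect f a' (a' + w / 2) c' (c' + h / 2)) < eta / 4).
  { intros a' c' H1 H2. apply Rnot_le_lt. intros H. apply N. exists a', c'. auto. }
  rewrite (rect_split_x f a (a + w / 2) (a + w)) in He by auto.
  rewrite (rect_split_y f a _ c (c + h / 2)) in He by auto.
  rewrite (rect_split_y f (a + w / 2) _ c (c + h / 2)) in He by auto.
  pose proof (B a c) as B1. pose proof (B (a + w / 2) c) as B2.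
  pose proof (B a (c + h / 2)) as B3. pose proof (B (a + w / 2) (c + h / 2)) as B4.
  replace (a + w / 2 + w / 2) with (a + w) in * by field.
  replace (c + h / 2 + h / 2) with (c + h) in * by field.
  match type of He with _ <= Cmod (?u + ?v + (?s + ?t)) =>
    pose proof (Cmod_triangle (u + v) (s + t)); pose proof (Cmod_triangle u v);
    pose proof (Cmod_triangle s t) end.
  specialize (B1 (or_introl eq_refl) (or_introl eq_refl)).
  specialize (B2 (or_intror eq_refl) (or_introl eq_refl)).
  specialize (B3 (or_introl eq_refl) (or_intror eq_refl)).
  specialize (B4 (or_intror eq_refl) (or_intror eq_refl)). lra.
Qed.

Lemma goursat (f : C -> C) (a b c d : R) : gcont f -> a <= b -> c <= d ->
  (forall x y, a <= x <= b -> c <= y <= d -> holo f (x, y)) -> rect f a b c d = 0.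
Proof.
  intros Hc Hab Hcd Hh. apply Cmod_eq_0. apply Rle_antisym; [|apply Cmod_ge_0].
  apply Rnot_lt_le. intros Hpos.
  set (eta := Cmod (rect f a b c d)) in *. set (w := b - a). set (h := d - c).
  set (wn := fun n => w / 2 ^ n). set (hn := fun n => h / 2 ^ n).
  assert (Wn : forall n, 0 <= wn n).
  { intros n. unfold wn, Rdiv. apply Rmult_le_pos; [unfold w; lra|].
    left. apply Rinv_0_lt_compat, pow2_pos. }
  assert (Hn : forall n, 0 <= hn n).
  { intros n. unfold hn, Rdiv. apply Rmult_le_pos; [unfold h; lra|].
    left. apply Rinv_0_lt_compat, pow2_pos. }
  assert (WS : forall n, wn (S n) = wn n / 2).
  { intros n. unfold wn. simpl. field. apply Rgt_not_eq, pow2_pos. }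
  assert (HS : forall n, hn (S n) = hn n / 2).
  { intros n. unfold hn. simpl. field. apply Rgt_not_eq, pow2_pos. }
  (* A rectangle is recorded by its lower left corner only, since at stage [n] its sides are [wn n]
     and [hn n]. *)
  set (bad := fun n (p : R * R) =>
    eta / 4 ^ n <= Cmod (rect f (fst p) (fst p + wn n) (snd p) (snd p + hn n))).
  set (next := fun n (p q : R * R) => bad (S n) q /\
     (fst p <= fst q /\ fst q + wn (S n) <= fst p + wn n) /\
     (snd p <= snd q /\ snd q + hn (S n) <= snd p + hn n)).
  assert (Hstep : forall n p, bad n p -> exists q, next n p q).
  { intros n p Hp. destruct (goursat_quarter f (fst p) (snd p) (wn n) (hn n) _ Hc Hp)
      as (a' & c' & Ha & Hc' & Hq).
    exists (a', c'). unfold next, bad. simpl fst; simpl snd. rewrite WS, HS.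
    pose proof (Wn n). pose proof (Hn n).
    split; [|split; [destruct Ha|destruct Hc']; lra].
    replace (eta / 4 ^ S n) with (eta / 4 ^ n / 4); auto.
    simpl. field. apply pow_nonzero. lra. }
  (* The nested rectangles are picked by the choice operator; [next] is satisfiable only from a bad
     rectangle, so badness is established along the recursion. *)
  set (u := nat_rect (fun _ => (R * R)%type) (a, c)
              (fun n p => epsilon (inhabits (0, 0)) (next n p))).
  assert (Ub : forall n, bad n (u n)).
  { induction n as [|n IH].
    - unfold bad, wn, hn. simpl. replace (a + w / 1) with b by (unfold w; field).
      replace (c + h / 1) with d by (unfold h; field). fold eta. lra.
    - apply (epsilon_spec (inhabits (0, 0)) (next n (u n)) (Hstep n _ IH)). }
  assert (Un : forall n, next n (u n) (u (S n))).
  { intros n. apply (epsilon_spec (inhabits (0, 0)) (next n (u n)) (Hstep n _ (Ub n))). }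
  destruct (nested_point (fun n => fst (u n)) wn Wn) as [px Px];
    [intros n; apply (Un n)|intros n; apply (Un n)|].
  destruct (nested_point (fun n => snd (u n)) hn Hn) as [py Py];
    [intros n; apply (Un n)|intros n; apply (Un n)|].
  assert (Hp : holo f (px, py)).
  { specialize (Px 0%nat). specialize (Py 0%nat). unfold wn, hn, w, h in Px, Py. simpl in Px, Py.
    apply Hh; lra. }
  set (s := w + h).
  assert (Hs : 0 <= s) by (unfold s, w, h; lra).
  (* At stage [n] the local estimate is [2 eps s^2 / 4^n], against the lower bound [eta / 4^n]. This
     [eps] makes the former at most half of the latter, and [+ 1] covers [s = 0]. *)
  set (eps := eta / (4 * (s ^ 2 + 1))).
  assert (Hs2 : 0 < s ^ 2 + 1) by nra.
  assert (He : 0 < eps) by (apply Rdiv_lt_0_compat; lra).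
  destruct (goursat_local f (px, py) eps Hc Hp He) as [del [Hd Hloc]].
  destruct (half_pow_small s del Hd) as [n Hn'].
  specialize (Hloc (fst (u n)) (fst (u n) + wn n) (snd (u n)) (snd (u n) + hn n) (Px n) (Py n)).
  specialize (Ub n). unfold bad in Ub.
  assert (Es : fst (u n) + wn n - fst (u n) + (snd (u n) + hn n - snd (u n)) = s / 2 ^ n).
  { unfold wn, hn, s. field. apply Rgt_not_eq, pow2_pos. }
  rewrite Es in Hloc. specialize (Hloc Hn').
  assert (E4 : (s / 2 ^ n) ^ 2 = s ^ 2 / 4 ^ n).
  { replace 4 with (2 ^ 2) by ring. rewrite <- pow_mult, (Nat.mul_comm 2 n), pow_mult.
    field. apply Rgt_not_eq, pow2_pos. }
  rewrite E4 in Hloc.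
  assert (P4 : 0 < / 4 ^ n) by (apply Rinv_0_lt_compat, pow_lt; lra).
  assert (X : eta / 4 ^ n <= 2 * eps * (s ^ 2 / 4 ^ n)) by lra.
  assert (Y : eta <= 2 * eps * s ^ 2).
  { apply Rmult_le_reg_r with (/ 4 ^ n); auto. unfold Rdiv in X. lra. }
  assert (Z : 2 * eps * s ^ 2 <= 2 * eps * (s ^ 2 + 1)) by (apply Rmult_le_compat_l; lra).
  assert (V : 2 * eps * (s ^ 2 + 1) = eta / 2) by (unfold eps; field; lra). lra.
Qed.

Lemma rect_bound_unordered (f : C -> C) (a b c d M : R) : gcont f ->
  (forall x y, Rmin a b <= x <= Rmax a b -> Rmin c d <= y <= Rmax c d -> Cmod (f (x, y)) <= M) ->
  Cmod (rect f a b c d) <= 2 * M * (Rabs (b - a) + Rabs (d - c)).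
Proof.
  intros Hc HM.
  assert (W : forall a b c d : R, c <= d ->
    (forall x y, Rmin a b <= x <= Rmax a b -> c <= y <= d -> Cmod (f (x, y)) <= M) ->
    Cmod (rect f a b c d) <= 2 * M * (Rabs (b - a) + (d - c))).
  { clear -Hc. intros a b c d Hcd HM. destruct (Rle_dec a b) as [H|H].
    - rewrite Rabs_pos_eq by lra. apply rect_bound; auto.
      rewrite Rmin_left, Rmax_right in HM by lra. exact HM.
    - rewrite rect_swap_x, Cmod_opp by auto. rewrite Rabs_left by lra.
      replace (- (b - a)) with (a - b) by ring. apply rect_bound; auto; try lra.
      rewrite Rmin_right, Rmax_left in HM by lra. exact HM. }
  destruct (Rle_dec c d) as [H|H].
  - rewrite (Rabs_pos_eq (d - c)) by lra. apply W; auto.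
    rewrite (Rmin_left c), (Rmax_right c) in HM by lra. exact HM.
  - rewrite rect_swap_y, Cmod_opp by auto. rewrite (Rabs_left (d - c)) by lra.
    replace (- (d - c)) with (c - d) by ring. apply W; auto; try lra.
    rewrite (Rmin_right c), (Rmax_left c) in HM by lra. exact HM.
Qed.

Lemma goursat_unordered (f : C -> C) (a b c d : R) : gcont f ->
  (forall x y, Rmin a b <= x <= Rmax a b -> Rmin c d <= y <= Rmax c d -> holo f (x, y)) ->
  rect f a b c d = 0.
Proof.
  intros Hc Hh.
  assert (W : forall a b c d : R, c <= d ->
    (forall x y, Rmin a b <= x <= Rmax a b -> c <= y <= d -> holo f (x, y)) ->
    rect f a b c d = 0).
  { clear -Hc. intros a b c d Hcd HM. destruct (Rle_dec a b) as [H|H].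
    - apply goursat; auto.
      rewrite Rmin_left, Rmax_right in HM by lra. exact HM.
    - rewrite rect_swap_x, goursat; auto; try lra; [apply C_ext; simpl; ring|].
      rewrite Rmin_right, Rmax_left in HM by lra. exact HM. }
  destruct (Rle_dec c d) as [H|H].
  - apply W; auto. rewrite (Rmin_left c), (Rmax_right c) in Hh by lra. exact Hh.
  - rewrite rect_swap_y, W; auto; try lra; [apply C_ext; simpl; ring|].
    rewrite (Rmin_right c), (Rmax_left c) in Hh by lra. exact Hh.
Qed.

Lemma between_combination (p b t s : R) : 0 < t <= 1 -> b <> p ->
  Rmin (p + t * (b - p)) b <= s <= Rmax (p + t * (b - p)) b -> s <> p.
Proof.
  intros Ht Hb Hs ->. destruct (Rdichotomy _ _ Hb) as [H|H].
  - assert (p + t * (b - p) < p) by nra.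
    pose proof (Rmax_lub_lt (p + t * (b - p)) b p H0 H). lra.
  - assert (p < p + t * (b - p)) by nra.
    pose proof (Rmin_glb_lt (p + t * (b - p)) b p H0 H). lra.
Qed.

Lemma rect_degenerate_x (f : C -> C) (a c d : R) : gcont f -> rect f a a c d = 0.
Proof.
  intros Hc. assert (E := rect_split_x f a a a c d Hc).
  replace (rect f a a c d) with (rect f a a c d + rect f a a c d - rect f a a c d)%C by ring.
  rewrite <- E. ring.
Qed.

Lemma rect_degenerate_y (f : C -> C) (a b c : R) : gcont f -> rect f a b c c = 0.
Proof.
  intros Hc. assert (E := rect_split_y f a b c c c Hc).
  replace (rect f a b c c) with (rect f a b c c + rect f a b c c - rect f a b c c)%C by ring.
  rewrite <- E. ring.
Qed.

(** Goursat's theorem on the pieces away from the exceptional corner shows that the rectangle can be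
    shrunk towards it without changing the integral. As [f] is bounded near the corner, the integral
    is at most a multiple of the perimeter, hence zero. *)
Lemma goursat_corner (f : C -> C) (x0 y0 b d : R) : gcont f ->
  (forall z, z <> ((x0, y0) : C) -> holo f z) -> rect f x0 b y0 d = 0.
Proof.
  intros Hc Hh.
  destruct (Req_dec b x0) as [->|Hb]; [now apply rect_degenerate_x|].
  destruct (Req_dec d y0) as [->|Hd]; [now apply rect_degenerate_y|].
  assert (Hsmall : forall t, 0 < t <= 1 ->
    rect f x0 b y0 d = rect f x0 (x0 + t * (b - x0)) y0 (y0 + t * (d - y0))).
  { intros t Ht.
    rewrite (rect_split_x f x0 (x0 + t * (b - x0)) b) by auto.
    rewrite (goursat_unordered f (x0 + t * (b - x0)) b); auto.
    2:{ intros x y Hx _. apply Hh. intros E. injection E as E1 E2.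
        revert E1. now apply (between_combination x0 b t). }
    rewrite (rect_split_y f x0 _ y0 (y0 + t * (d - y0)) d) by auto.
    rewrite (goursat_unordered f x0 _ (y0 + t * (d - y0)) d); auto.
    2:{ intros x y _ Hy. apply Hh. intros E. injection E as E1 E2.
        revert E2. now apply (between_combination y0 d t). }
    ring. }
  apply Cmod_eq_0. apply Rle_antisym; [|apply Cmod_ge_0].
  apply Rnot_lt_le. intros Hpos.
  destruct (ccont_bounded f (x0, y0) (Hc _)) as [r [Hr HM]].
  set (M := Cmod (f (x0, y0)) + 1) in *.
  assert (HM0 : 0 < M) by (pose proof (Cmod_ge_0 (f (x0, y0))); unfold M; lra).
  set (s := Rabs (b - x0) + Rabs (d - y0)).
  assert (Hs : 0 < s).
  { unfold s. pose proof (Rabs_pos_lt (b - x0) ltac:(lra)). pose proof (Rabs_pos (d - y0)). lra. }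
  set (eta := Cmod (rect f x0 b y0 d)) in *.
  (* The bound in [r] keeps the shrunken rectangle in the disc where [M] bounds [f]; the bound in
     [eta] makes its integral at most [eta / 2]. *)
  set (t := Rmin 1 (Rmin (r / (2 * s)) (eta / (4 * M * s)))).
  assert (Ht : 0 < t <= 1).
  { split; [|apply Rmin_l]. repeat apply Rmin_glb_lt; try lra; apply Rdiv_lt_0_compat; try lra.
    apply Rmult_lt_0_compat; lra. }
  assert (T1 : t * s <= r / 2).
  { assert (t <= r / (2 * s)) by (eapply Rle_trans; [apply Rmin_r|apply Rmin_l]).
    apply Rle_trans with (r / (2 * s) * s); [apply Rmult_le_compat_r; lra|right; field; lra]. }
  assert (T2 : 2 * M * (t * s) <= eta / 2).
  { assert (t <= eta / (4 * M * s)) by (eapply Rle_trans; [apply Rmin_r|apply Rmin_r]).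
    apply Rle_trans with (2 * M * (eta / (4 * M * s) * s)).
    - apply Rmult_le_compat_l; [lra|]. apply Rmult_le_compat_r; lra.
    - right; field; lra. }
  assert (B : Cmod (rect f x0 (x0 + t * (b - x0)) y0 (y0 + t * (d - y0))) <= 2 * M * (t * s)).
  { replace (t * s) with (Rabs (x0 + t * (b - x0) - x0) + Rabs (y0 + t * (d - y0) - y0)).
    - apply rect_bound_unordered; auto. intros x y Hx Hy. apply HM.
      eapply Rle_lt_trans; [apply Cmod_pair_sub|].
      apply Rle_lt_trans with (t * s); [|lra].
      assert (K : forall p v x, Rmin p (p + t * (v - p)) <= x <= Rmax p (p + t * (v - p)) -> Rabs (x - p) <= t * Rabs (v - p)).
      { intros p v x' Hx'. rewrite <- (Rabs_pos_eq t) by lra. rewrite <- Rabs_mult.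
        revert Hx'. unfold Rmin, Rmax. destruct (Rle_dec p (p + t * (v - p))); intros Hx';
        unfold Rabs; destruct (Rcase_abs (x' - p)), (Rcase_abs (t * (v - p))); lra. }
      unfold s. pose proof (K _ _ _ Hx). pose proof (K _ _ _ Hy). lra.
    - unfold s. replace (x0 + t * (b - x0) - x0) with (t * (b - x0)) by ring.
      replace (y0 + t * (d - y0) - y0) with (t * (d - y0)) by ring.
      rewrite !Rabs_mult, (Rabs_pos_eq t) by lra. ring. }
  rewrite <- (Hsmall t Ht) in B. fold eta in B. lra.
Qed.

(** Cutting at the coordinates of [z0] leaves four rectangles with a corner at [z0]. They are
    signed, as [z0] may lie outside the original one. The statement is meant for a difference
    quotient, whose differentiability at its base point is not yet known. *)
Lemma goursat_exceptional (f : C -> C) (z0 : C) (a b c d : R) : gcont f ->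
  (forall z, z <> z0 -> holo f z) -> rect f a b c d = 0.
Proof.
  destruct z0 as [x0 y0]. intros Hc Hh.
  rewrite (rect_split_x f a x0 b), (rect_swap_x f x0 a) by auto.
  rewrite (rect_split_y f x0 a c y0 d), (rect_split_y f x0 b c y0 d) by auto.
  rewrite (rect_swap_y f x0 a y0 c), (rect_swap_y f x0 b y0 c) by auto.
  rewrite !goursat_corner by auto. apply C_ext; simpl; ring.
Qed.

Definition primitive (f : C -> C) (z : C) : C :=
  (CI (fun t => f (t, 0)) 0 (fst z) + Ci * CI (fun t => f (fst z, t)) 0 (snd z))%C.

Lemma CI_const (c : C) (a b : R) : CI (fun _ => c) a b = (RtoC (b - a) * c)%C.
Proof.
  apply CI_unique.
  replace (RtoC (b - a) * c)%C with (scal (b - a) (c : C_R_NormedModule)).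
  - apply (is_RInt_const (V := C_R_NormedModule)).
  - apply C_ext; simpl; unfold scal; simpl; unfold mult; simpl; ring.
Qed.

(** Since rectangles contribute zero, the increment of [primitive f] from [z] to [w] is the integral
    along a horizontal and then a vertical segment from [z] to [w]; on both, [f] stays close to
    [f z]. *)
Lemma primitive_cderiv (f : C -> C) : gcont f ->
  (forall a b c d, rect f a b c d = 0) -> forall z, cderiv (primitive f) z (f z).
Proof.
  intros Hc H0 z. apply cderiv_intro. intros eps He.
  destruct (Hc z (eps / 2)) as [del [Hd Hdel]]; [lra|].
  exists (del / 2). split; [lra|]. intros w Hw.
  destruct z as [x y], w as [x' y'].
  pose proof (fst_le_Cmod ((x', y') - (x, y))%C) as A1.
  pose proof (snd_le_Cmod ((x', y') - (x, y))%C) as A2.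
  simpl in A1, A2. fold (x' - x) in A1. fold (y' - y) in A2.
  assert (E : (primitive f (x', y') - primitive f (x, y) - f (x, y) * ((x', y') - (x, y)))%C
    = (CI (fun t => f (t, y) - f (x, y)) x x' + Ci * CI (fun t => f (x', t) - f (x, y)) y y')%C).
  { rewrite (CI_minus (fun t => f (t, y)) (fun _ => f (x, y)) x x'),
      (CI_minus (fun t => f (x', t)) (fun _ => f (x, y)) y y');
      auto using gcont_icont_horizontal, gcont_icont_vertical;
      try (intros t _; apply rcont_const).
    rewrite !CI_const.
    unfold primitive. simpl fst; simpl snd.
    rewrite (CI_Chasles (fun t => f (t, 0)) 0 x x') by (intros; now apply gcont_horizontal).
    rewrite (CI_Chasles (fun t => f (x', t)) 0 y y') by (intros; now apply gcont_vertical).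
    specialize (H0 x x' 0 y). unfold rect in H0.
    replace ((x', y') - (x, y))%C with (RtoC (x' - x) + Ci * RtoC (y' - y))%C by (apply C_ext; simpl; ring).
    match type of H0 with (?p + ?q - ?r - ?s)%C = _ =>
      assert (Hp : p = (p + q - r - s + (r + s - q))%C) by ring;
      rewrite H0 in Hp; rewrite Hp; ring end. }
  rewrite E. 
  assert (Mx : Rabs (x' - x) < del / 2) by lra.
  assert (My : Rabs (y' - y) < del / 2) by lra.
  assert (K : forall p q t, Rmin p q <= t <= Rmax p q -> Rabs (t - p) <= Rabs (q - p)).
  { intros p q t. unfold Rmin, Rmax. destruct (Rle_dec p q); intros; unfold Rabs;
      destruct (Rcase_abs (t - p)), (Rcase_abs (q - p)); lra. }
  assert (B1 : Cmod (CI (fun t => f (t, y) - f (x, y))%C x x') <= eps / 2 * Rabs (x' - x)).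
  { apply CI_bound.
    - intros t. apply (rcont_plus (fun t => f (t, y))); [now apply gcont_horizontal|apply rcont_const].
    - intros t Ht. left. apply Hdel. eapply Rle_lt_trans; [apply Cmod_pair_sub|].
      rewrite Rminus_diag, Rabs_R0. pose proof (K _ _ _ Ht). lra. }
  assert (B2 : Cmod (CI (fun t => f (x', t) - f (x, y))%C y y') <= eps / 2 * Rabs (y' - y)).
  { apply CI_bound.
    - intros t. apply (rcont_plus (fun t => f (x', t))); [now apply gcont_vertical|apply rcont_const].
    - intros t Ht. left. apply Hdel. eapply Rle_lt_trans; [apply Cmod_pair_sub|].
      pose proof (K _ _ _ Ht). lra. }
  eapply Rle_trans; [apply Cmod_triangle|]. rewrite Cmod_rotate.
  set (m := Cmod ((x', y') - (x, y))%C) in *.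
  assert (eps / 2 * Rabs (x' - x) <= eps / 2 * m) by (apply Rmult_le_compat_l; lra).
  assert (eps / 2 * Rabs (y' - y) <= eps / 2 * m) by (apply Rmult_le_compat_l; lra).
  lra.
Qed.

(** * Cauchy's formula and the maximum principle *)

Lemma Csub_nz (w z : C) : w <> z -> (w - z)%C <> 0%C.
Proof. intros N E. apply N. replace w with (w - z + z)%C by ring. rewrite E. ring. Qed.

Definition slope (f : C -> C) (z0 w : C) : C :=
  if Ceq_dec w z0 then C_derive f z0 else ((f w - f z0) / (w - z0))%C.

Lemma slope_spec (f : C -> C) (z0 w : C) : f w = (f z0 + (w - z0) * slope f z0 w)%C.
Proof.
  unfold slope. destruct (Ceq_dec w z0) as [->|N]; [ring|]. field. now apply Csub_nz.
Qed.

Lemma slope_holo (f : C -> C) (z0 : C) : (forall z, holo f z) ->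
  forall z, z <> z0 -> holo (slope f z0) z.
Proof.
  intros Hf z N.
  apply (holo_ext_loc (fun w => (f w - f z0) * / (w - z0))%C _ z (Cmod (z - z0))).
  - apply Cmod_gt_0. now apply Csub_nz.
  - intros w Hw. unfold slope. destruct (Ceq_dec w z0) as [->|_]; [|reflexivity].
    rewrite Cmod_sub_sym in Hw. lra.
  - apply holo_mult; [apply holo_minus; [apply Hf|apply holo_const]|].
    apply holo_inv; [now apply Csub_nz|]. apply holo_minus; [apply holo_id|apply holo_const].
Qed.

(** Near [z0] the slope coincides with the continuous function provided by Caratheodory's
    definition. *)
Lemma slope_gcont (f : C -> C) (z0 : C) : (forall z, holo f z) -> gcont (slope f z0).
Proof.
  intros Hf z. destruct (Ceq_dec z z0) as [->|N].
  - destruct (holo_C_derive f z0 (Hf z0)) as (phi & r & Hr & Hc & Hl & E).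
    apply (ccont_ext_loc phi _ z0 r Hr); auto.
    intros w Hw. unfold slope. destruct (Ceq_dec w z0) as [->|N]; auto.
    rewrite (E w Hw). field. now apply Csub_nz.
  - now apply holo_ccont, slope_holo.
Qed.

Definition inside (a b c d : R) (z : C) : Prop := a < fst z < b /\ c < snd z < d.

(* [side] ranges over the four sides of the rectangle, parametrised by [p t]. *)
Definition side (a b c d : R) (p : R -> C) (s e : R) : Prop :=
  s <= e /\ (forall t, rcont p t) /\
  forall t, s <= t <= e -> a <= fst (p t) <= b /\ c <= snd (p t) <= d /\
    (fst (p t) = a \/ fst (p t) = b \/ snd (p t) = c \/ snd (p t) = d).

Lemma side_bottom (a b c d : R) : a <= b -> c <= d -> side a b c d (fun t => (t, c)) a b.
Proof.
  intros. split; [auto|split; [apply rcont_horizontal|]]. simpl. intros. split; [lra|split; [lra|auto]].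
Qed.
Lemma side_top (a b c d : R) : a <= b -> c <= d -> side a b c d (fun t => (t, d)) a b.
Proof.
  intros. split; [auto|split; [apply rcont_horizontal|]]. simpl. intros. split; [lra|split; [lra|auto]].
Qed.
Lemma side_left (a b c d : R) : a <= b -> c <= d -> side a b c d (fun t => (a, t)) c d.
Proof.
  intros. split; [auto|split; [apply rcont_vertical|]]. simpl. intros. split; [lra|split; [lra|auto]].
Qed.
Lemma side_right (a b c d : R) : a <= b -> c <= d -> side a b c d (fun t => (b, t)) c d.
Proof.
  intros. split; [auto|split; [apply rcont_vertical|]]. simpl. intros. split; [lra|split; [lra|auto]].
Qed.

Lemma inside_dist (a b c d : R) (z : C) : inside a b c d z ->
  exists r, 0 < r /\ forall p s e t, side a b c d p s e -> s <= t <= e -> r <= Cmod (p t - z).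
Proof.
  destruct z as [x y]. intros [Hx Hy]. simpl in Hx, Hy.
  exists (Rmin (Rmin (x - a) (b - x)) (Rmin (y - c) (d - y))).
  split; [repeat apply Rmin_glb_lt; lra|].
  intros p s e t (_ & _ & H) Ht. destruct (H t Ht) as (_ & _ & H4).
  pose proof (fst_le_Cmod (p t - (x, y))%C) as A1. pose proof (snd_le_Cmod (p t - (x, y))%C) as A2.
  simpl in A1, A2. fold (fst (p t) - x) in A1. fold (snd (p t) - y) in A2.
  destruct (p t) as [u v]. simpl in *. fold (u - x) in *. fold (v - y) in *.
  pose proof (Rmin_l (Rmin (x - a) (b - x)) (Rmin (y - c) (d - y))).
  pose proof (Rmin_r (Rmin (x - a) (b - x)) (Rmin (y - c) (d - y))).
  pose proof (Rmin_l (x - a) (b - x)). pose proof (Rmin_r (x - a) (b - x)).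
  pose proof (Rmin_l (y - c) (d - y)). pose proof (Rmin_r (y - c) (d - y)).
  pose proof (Rle_abs (u - x)). pose proof (Rle_abs (- (u - x))).
  pose proof (Rle_abs (v - y)). pose proof (Rle_abs (- (v - y))).
  rewrite Rabs_Ropp in *.
  destruct H4 as [E|[E|[E|E]]]; subst; lra.
Qed.

Lemma side_icont_inv (a b c d : R) (z : C) (p : R -> C) (s e : R) (n : nat) :
  inside a b c d z -> side a b c d p s e -> icont (fun t => (/ (p t - z)) ^ n)%C s e.
Proof.
  intros Hz Hp t Ht. destruct (inside_dist a b c d z Hz) as [r [Hr H]].
  assert (Hse : s <= e) by apply Hp.
  rewrite Rmin_left, Rmax_right in Ht by auto. specialize (H p s e t Hp Ht).
  assert (N : (p t - z)%C <> 0%C) by (apply Cmod_gt_0; lra).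
  apply (rcont_ccont (fun w => (/ (w - z)) ^ n)%C p t); [apply Hp|].
  apply holo_ccont, holo_pow, holo_inv; auto. apply holo_minus; [apply holo_id|apply holo_const].
Qed.

Lemma side_icont (a b c d : R) (p : R -> C) (s e : R) (f : C -> C) :
  gcont f -> side a b c d p s e -> icont (fun t => f (p t)) s e.
Proof. intros Hf Hp t _. apply (rcont_ccont f p); [apply Hp|apply Hf]. Qed.

(** The exponent 1 is that of Cauchy's formula; 2 and 3 arise by differentiating in [z]. *)
Definition cauchy_kernel (f : C -> C) (z : C) (n : nat) (w : C) : C := (f w * (/ (w - z)) ^ n)%C.

Lemma side_icont_kernel (a b c d : R) (z : C) (p : R -> C) (s e : R) (f : C -> C) (n : nat) :
  gcont f -> inside a b c d z -> side a b c d p s e -> icont (fun t => cauchy_kernel f z n (p t)) s e.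
Proof.
  intros Hf Hz Hp t Ht. apply (rcont_mult (fun t => f (p t)) (fun t => (/ (p t - z)) ^ n)%C).
  - now apply (side_icont a b c d p s e f).
  - now apply (side_icont_inv a b c d z p s e n).
Qed.

Lemma side_CI_cauchy (a b c d : R) (f : C -> C) (z : C) (p : R -> C) (s e : R) :
  (forall w, holo f w) -> inside a b c d z -> side a b c d p s e ->
  CI (fun t => cauchy_kernel f z 1 (p t)) s e =
  (CI (fun t => slope f z (p t)) s e + f z * CI (fun t => cauchy_kernel (fun _ => 1) z 1 (p t)) s e)%C.
Proof.
  intros Hf Hz Hp.
  assert (G1 : gcont (fun _ => RtoC 1)) by (intros w; apply ccont_const).
  assert (I1 := side_icont_kernel a b c d z p s e (fun _ => RtoC 1) 1 G1 Hz Hp).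
  rewrite <- CI_scal by auto.
  rewrite <- (CI_plus (fun t => slope f z (p t))).
  - apply CI_ext. intros t Ht. rewrite Rmin_left, Rmax_right in Ht by apply Hp.
    destruct (inside_dist a b c d z Hz) as [r [Hr H]].
    specialize (H p s e t Hp ltac:(lra)).
    assert (N : (p t - z)%C <> 0%C) by (apply Cmod_gt_0; lra).
    unfold cauchy_kernel. rewrite (slope_spec f z (p t)). simpl. field. auto.
  - apply (side_icont a b c d); auto. now apply slope_gcont.
  - intros t Ht. apply rcont_mult; [apply rcont_const|now apply I1].
Qed.

(** The kernel splits as [f w / (w - z) = slope f z w + f z / (w - z)], and the slope integrates to
    zero because [z] is its only exceptional point. *)
Lemma cauchy_formula (f : C -> C) (a b c d : R) (z : C) :
  (forall w, holo f w) -> inside a b c d z ->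
  rect (cauchy_kernel f z 1) a b c d = (f z * rect (cauchy_kernel (fun _ => 1) z 1) a b c d)%C.
Proof.
  intros Hf Hz. assert (a <= b /\ c <= d) as [Hab Hcd] by (destruct Hz; lra).
  assert (S := goursat_exceptional (slope f z) z a b c d (slope_gcont f z Hf) (slope_holo f z Hf)).
  unfold rect in *.
  rewrite (side_CI_cauchy a b c d f z (fun t => (t, c))), (side_CI_cauchy a b c d f z (fun t => (t, d))),
    (side_CI_cauchy a b c d f z (fun t => (a, t))), (side_CI_cauchy a b c d f z (fun t => (b, t)));
    auto using side_bottom, side_top, side_left, side_right.
  match type of S with ?l = _ => match goal with |- _ = ?r =>
    transitivity (l + r)%C; [ring|rewrite S; ring] end end.
Qed.

Lemma RInt_lower (g : R -> R) (a b l m : R) : a <= b -> is_RInt g a b l ->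
  (forall t, a <= t <= b -> m <= g t) -> m * (b - a) <= l.
Proof.
  intros Hab Hl Hm.
  replace (m * (b - a)) with (scal (b - a) m) by (unfold scal; simpl; unfold mult; simpl; ring).
  apply (is_RInt_le (fun _ => m) g a b); auto.
  - apply (is_RInt_const (V := R_NormedModule)).
  - intros t Ht. apply Hm. lra.
Qed.

Lemma CI_fst_lower (g : R -> C) (a b m : R) : a <= b -> icont g a b ->
  (forall t, a <= t <= b -> m <= fst (g t)) -> m * (b - a) <= fst (CI g a b).
Proof.
  intros Hab Hc Hm. apply (RInt_lower (fun t => fst (g t)) a b); auto.
  apply (is_RInt_fct_extend_fst (U := R_NormedModule) (V := R_NormedModule)). now apply is_RInt_CI.
Qed.

Lemma CI_snd_lower (g : R -> C) (a b m : R) : a <= b -> icont g a b ->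
  (forall t, a <= t <= b -> m <= snd (g t)) -> m * (b - a) <= snd (CI g a b).
Proof.
  intros Hab Hc Hm. apply (RInt_lower (fun t => snd (g t)) a b); auto.
  apply (is_RInt_fct_extend_snd (U := R_NormedModule) (V := R_NormedModule)). now apply is_RInt_CI.
Qed.

Lemma CI_opp (f : R -> C) (a b : R) : icont f a b -> CI (fun t => - f t)%C a b = (- CI f a b)%C.
Proof.
  intros H. apply CI_unique. apply (is_RInt_opp (V := C_R_NormedModule) f a b). now apply is_RInt_CI.
Qed.

Lemma sum_sq_pos (u v : R) : u <> 0 \/ v <> 0 -> 0 < u ^ 2 + v ^ 2.
Proof.
  pose proof (pow2_ge_0 u). pose proof (pow2_ge_0 v).
  intros [N|N]; apply pow2_gt_0 in N; lra.
Qed.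

Lemma inv_lower (u X Y : R) : 0 < u -> u ^ 2 + X ^ 2 <= Y -> u / Y <= u / (u ^ 2 + X ^ 2).
Proof.
  intros Hu HY. apply Rmult_le_compat_l; [lra|]. apply Rinv_le_contravar; nra.
Qed.

(** The imaginary part of the integral is the variation of the argument of [w - z]. Each side
    contributes a nonnegative amount, and the bottom side a positive one. *)
Lemma cauchy_winding_nz (a b c d : R) (z : C) : inside a b c d z ->
  rect (cauchy_kernel (fun _ => 1) z 1) a b c d <> 0.
Proof.
  intros Hz E. assert (a <= b /\ c <= d) as [Hab Hcd] by (destruct Hz; lra).
  assert (G1 : gcont (fun _ => RtoC 1)) by (intros w; apply ccont_const).
  assert (I : forall p s e, side a b c d p s e -> icont (fun t => cauchy_kernel (fun _ => 1) z 1 (p t)) s e)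
    by (intros; now apply (side_icont_kernel a b c d)).
  pose proof (I _ _ _ (side_bottom a b c d Hab Hcd)) as Ib.
  pose proof (I _ _ _ (side_top a b c d Hab Hcd)) as It.
  pose proof (I _ _ _ (side_left a b c d Hab Hcd)) as Il.
  pose proof (I _ _ _ (side_right a b c d Hab Hcd)) as Ir.
  destruct z as [x y]. destruct Hz as [Hx Hy]. simpl in Hx, Hy.
  set (D := (b - a) ^ 2 + (d - c) ^ 2).
  assert (HD : 0 < D) by (unfold D; nra).
  set (k := cauchy_kernel (fun _ => 1) (x, y) 1) in *.
  assert (Kf : forall u v, fst (k (u, v)) = (u - x) / ((u - x) ^ 2 + (v - y) ^ 2)).
  { intros u v. unfold k, cauchy_kernel. simpl. unfold Rdiv, Rminus. ring. }
  assert (Ks : forall u v, snd (k (u, v)) = - (v - y) / ((u - x) ^ 2 + (v - y) ^ 2)).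
  { intros u v. unfold k, cauchy_kernel. simpl. unfold Rdiv, Rminus. ring. }
  assert (Bb : (y - c) / D * (b - a) <= snd (CI (fun t => k (t, c)) a b)).
  { apply CI_snd_lower; auto. intros t Ht. rewrite Ks.
    replace (- (c - y)) with (y - c) by ring.
    replace ((t - x) ^ 2 + (c - y) ^ 2) with ((y - c) ^ 2 + (t - x) ^ 2) by ring.
    apply inv_lower; [lra|]. unfold D. nra. }
  assert (Bt : 0 * (b - a) <= snd (CI (fun t => - k (t, d))%C a b)).
  { apply CI_snd_lower; auto.
    - intros t Ht. apply (rcont_ccont Copp (fun t => k (t, d))); [now apply It|].
      apply holo_ccont. eexists. apply cderiv_opp, cderiv_id.
    - intros t Ht. change (0 <= - snd (k (t, d))). rewrite Ks.
      replace (- (- (d - y) / ((t - x) ^ 2 + (d - y) ^ 2))) with ((d - y) / ((t - x) ^ 2 + (d - y) ^ 2)) by (unfold Rdiv; ring).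
      left. apply Rdiv_lt_0_compat; [lra|apply sum_sq_pos; lra]. }
  assert (Br : 0 * (d - c) <= fst (CI (fun t => k (b, t)) c d)).
  { apply CI_fst_lower; auto. intros t Ht. rewrite Kf. left. apply Rdiv_lt_0_compat; [lra|apply sum_sq_pos; lra]. }
  assert (Bl : 0 * (d - c) <= fst (CI (fun t => - k (a, t))%C c d)).
  { apply CI_fst_lower; auto.
    - intros t Ht. apply (rcont_ccont Copp (fun t => k (a, t))); [now apply Il|].
      apply holo_ccont. eexists. apply cderiv_opp, cderiv_id.
    - intros t Ht. change (0 <= - fst (k (a, t))). rewrite Kf.
      replace (- ((a - x) / ((a - x) ^ 2 + (t - y) ^ 2))) with ((x - a) / ((a - x) ^ 2 + (t - y) ^ 2)) by (unfold Rdiv; ring).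
      left. apply Rdiv_lt_0_compat; [lra|apply sum_sq_pos; lra]. }
  rewrite CI_opp in Bt by auto. rewrite CI_opp in Bl by auto.
  assert (P : 0 < (y - c) / D * (b - a)) by (apply Rmult_lt_0_compat; [apply Rdiv_lt_0_compat|]; lra).
  apply (f_equal snd) in E. unfold rect in E.
  set (vb := CI (fun t => k (t, c)) a b) in *. set (vt := CI (fun t => k (t, d)) a b) in *.
  set (vl := CI (fun t => k (a, t)) c d) in *. set (vr := CI (fun t => k (b, t)) c d) in *.
  clearbody vb vt vl vr. destruct vb, vt, vl, vr. simpl in E, Bt, Bl, Bb, Br. lra.
Qed.

(** The constant [K] depends only on the rectangle and on [z], so that it serves all the powers of a
    function at once. *)
Lemma rect_kernel_bound (a b c d : R) (z : C) : inside a b c d z ->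
  exists K, 0 < K /\ forall f M, gcont f -> 0 <= M ->
    (forall p s e t, side a b c d p s e -> s <= t <= e -> Cmod (f (p t)) <= M) ->
    Cmod (rect (cauchy_kernel f z 1) a b c d) <= K * M.
Proof.
  intros Hz. assert (a <= b /\ c <= d) as [Hab Hcd] by (destruct Hz; lra).
  destruct (inside_dist a b c d z Hz) as [r [Hr Hdist]].
  exists (2 / r * ((b - a) + (d - c)) + 1). split.
  { assert (0 <= 2 / r * ((b - a) + (d - c))); [|lra].
    apply Rmult_le_pos; [left; apply Rdiv_lt_0_compat|]; lra. }
  intros f M Hc HM HS.
  assert (B : forall p s e, side a b c d p s e ->
    Cmod (CI (fun t => cauchy_kernel f z 1 (p t)) s e) <= M / r * (e - s)).
  { intros p s e Hp. apply CI_bound_le; [apply Hp|now apply (side_icont_kernel a b c d)|].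
    intros t Ht. unfold cauchy_kernel. simpl. specialize (HS p s e t Hp Ht). specialize (Hdist p s e t Hp Ht).
    assert (N : (p t - z)%C <> 0%C) by (apply Cmod_gt_0; lra).
    rewrite Cmult_1_r, Cmod_mult, Cmod_inv by auto. unfold Rdiv.
    apply Rmult_le_compat; auto using Cmod_ge_0.
    - left. apply Rinv_0_lt_compat. lra.
    - apply Rinv_le_contravar; lra. }
  pose proof (B _ _ _ (side_bottom a b c d Hab Hcd)) as H1.
  pose proof (B _ _ _ (side_top a b c d Hab Hcd)) as H2.
  pose proof (B _ _ _ (side_left a b c d Hab Hcd)) as H3.
  pose proof (B _ _ _ (side_right a b c d Hab Hcd)) as H4.
  unfold rect. set (k := cauchy_kernel f z 1) in *.
  set (A := CI (fun t => k (t, c)) a b) in *. set (B' := CI (fun t => k (b, t)) c d) in *.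
  set (D := CI (fun t => k (t, d)) a b) in *. set (E := CI (fun t => k (a, t)) c d) in *.
  replace (A + Ci * B' - D - Ci * E)%C with ((A + Ci * B') + (- D + - (Ci * E)))%C by ring.
  pose proof (Cmod_triangle (A + Ci * B') (- D + - (Ci * E))) as T1.
  pose proof (Cmod_triangle A (Ci * B')) as T2.
  pose proof (Cmod_triangle (- D) (- (Ci * E))) as T3.
  rewrite !Cmod_opp in T3. rewrite !Cmod_rotate in *.
  replace ((2 / r * (b - a + (d - c)) + 1) * M) with (2 * (M / r * (b - a)) + 2 * (M / r * (d - c)) + M) by (field; lra).
  lra.
Qed.

Lemma pow_bounded_le1 (x K : R) : 0 <= x -> (forall n, x ^ n <= K) -> x <= 1.
Proof.
  intros Hx H. apply Rnot_lt_le. intros H1.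
  destruct (Pow_x_infinity x) with (b := K + 1) as [N HN]; [rewrite Rabs_pos_eq; lra|].
  specialize (HN N (le_n N)). rewrite Rabs_pos_eq in HN by (now apply pow_le).
  specialize (H N). lra.
Qed.

(* Landau's trick: Cauchy's formula for [f ^ n] gives [|f z| ^ n <= K M ^ n]
   with [K] independent of [n]. *)
Lemma maximum_modulus (f : C -> C) (a b c d M : R) (z : C) :
  (forall w, holo f w) -> inside a b c d z -> 0 <= M ->
  (forall p s e t, side a b c d p s e -> s <= t <= e -> Cmod (f (p t)) <= M) ->
  Cmod (f z) <= M.
Proof.
  intros Hf Hz HM0 HM.
  (* The powers are normalised by division, while [M] may be zero; it is approached from above. *)
  assert (W : forall M', 0 < M' -> M <= M' -> Cmod (f z) <= M').
  { intros M' HM' HMM.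
    destruct (rect_kernel_bound a b c d z Hz) as [K [HK HB]].
    assert (HW := cauchy_winding_nz a b c d z Hz). apply Cmod_gt_0 in HW.
    set (W := rect (cauchy_kernel (fun _ => 1) z 1) a b c d) in *.
    assert (Cmod (f z) / M' <= 1).
    { apply (pow_bounded_le1 _ (K / Cmod W)).
      - apply Rmult_le_pos; [apply Cmod_ge_0|left; now apply Rinv_0_lt_compat].
      - intros n. assert (Hfn : forall w, holo (fun w => f w ^ n)%C w) by (intros; now apply holo_pow).
        assert (E := cauchy_formula (fun w => f w ^ n)%C a b c d z Hfn Hz). fold W in E.
        assert (B : Cmod (rect (cauchy_kernel (fun w => f w ^ n)%C z 1) a b c d) <= K * M' ^ n).
        { apply HB; [intros w; now apply holo_ccont|apply pow_le; lra|].
          intros p s e t Hp Ht. rewrite Cmod_pow. apply pow_incr. split; [apply Cmod_ge_0|].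
          eapply Rle_trans; [now apply (HM p s e t)|auto]. }
        rewrite E, Cmod_mult, Cmod_pow in B.
        unfold Rdiv. rewrite Rpow_mult_distr, pow_inv.
        assert (Pn : 0 < M' ^ n) by (now apply pow_lt).
        apply Rmult_le_reg_r with (M' ^ n * Cmod W); [now apply Rmult_lt_0_compat|].
        replace (Cmod (f z) ^ n * / M' ^ n * (M' ^ n * Cmod W)) with (Cmod (f z) ^ n * Cmod W) by (field; lra).
        replace (K * / Cmod W * (M' ^ n * Cmod W)) with (K * M' ^ n) by (field; lra). exact B. }
    apply Rmult_le_reg_r with (/ M'); [now apply Rinv_0_lt_compat|].
    rewrite Rinv_r by lra. exact H. }
  apply le_epsilon. intros eps He. apply W; lra.
Qed.

(** * Derivatives and Taylor expansion of entire functions *)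

(** A second order remainder that is uniform in [t] integrates to at most [B (e - s) |z' - z|^2],
    which is negligible against [|z' - z|]. *)
Lemma CI_param_cderiv (F : C -> R -> C) (F' : R -> C) (s e : R) (z : C) (rho B : R) :
  s <= e -> 0 < rho -> 0 <= B ->
  (forall z', Cmod (z' - z) < rho -> icont (F z') s e) -> icont F' s e ->
  (forall z' t, Cmod (z' - z) < rho -> s <= t <= e ->
     Cmod (F z' t - F z t - (z' - z) * F' t) <= B * Cmod (z' - z) ^ 2) ->
  cderiv (fun z' => CI (F z') s e) z (CI F' s e).
Proof.
  intros Hse Hrho HB HF HF' H. apply cderiv_intro. intros eps He.
  set (K := B * (e - s) + 1).
  assert (HK : 0 < K) by (assert (0 <= B * (e - s)) by (apply Rmult_le_pos; lra); unfold K; lra).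
  exists (Rmin rho (eps / K)). split; [apply Rmin_glb_lt; auto; now apply Rdiv_lt_0_compat|].
  intros w Hw.
  assert (H1 : Cmod (w - z) < rho) by (eapply Rlt_le_trans; [exact Hw|apply Rmin_l]).
  assert (H2 : Cmod (w - z) < eps / K) by (eapply Rlt_le_trans; [exact Hw|apply Rmin_r]).
  assert (Hz : icont (F z) s e).
  { apply HF. replace (z - z)%C with (RtoC 0) by ring. now rewrite Cmod_0. }
  assert (Hw' := HF w H1).
  replace (CI (F w) s e - CI (F z) s e - CI F' s e * (w - z))%C
    with (CI (fun t => F w t - F z t - (w - z) * F' t) s e)%C.
  2:{ rewrite (CI_minus (fun t => F w t - F z t)%C (fun t => (w - z) * F' t)%C).
      - rewrite CI_minus, CI_scal by auto. ring.
      - intros t Ht. apply (rcont_plus (F w)); [now apply Hw'|].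
        apply (rcont_ccont Copp (F z)); [now apply Hz|].
        apply holo_ccont. eexists. apply cderiv_opp, cderiv_id.
      - intros t Ht. apply rcont_mult; [apply rcont_const|now apply HF']. }
  eapply Rle_trans.
  - apply (CI_bound_le _ s e (B * Cmod (w - z) ^ 2) Hse).
    + intros t Ht. apply (rcont_plus (fun t => F w t - F z t)%C).
      * apply (rcont_plus (F w)); [now apply Hw'|].
        apply (rcont_ccont Copp (F z)); [now apply Hz|].
        apply holo_ccont. eexists. apply cderiv_opp, cderiv_id.
      * apply (rcont_ccont Copp (fun t => (w - z) * F' t)%C).
        -- apply rcont_mult; [apply rcont_const|now apply HF'].
        -- apply holo_ccont. eexists. apply cderiv_opp, cderiv_id.
    + intros t Ht. now apply H.
  - pose proof (Cmod_ge_0 (w - z)) as P. set (m := Cmod (w - z)) in *.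
    assert (m * K <= eps).
    { left. apply Rmult_lt_reg_r with (/ K); [now apply Rinv_0_lt_compat|].
      rewrite Rmult_assoc, Rinv_r by lra. lra. }
    replace (B * m ^ 2 * (e - s)) with (m * (m * (B * (e - s)))) by ring.
    rewrite (Rmult_comm eps). apply Rmult_le_compat_l; auto.
    assert (m * (B * (e - s)) <= m * K) by (apply Rmult_le_compat_l; unfold K; lra). lra.
Qed.

Lemma inside_open (a b c d : R) (z : C) : inside a b c d z ->
  exists r, 0 < r /\ forall w, Cmod (w - z) < r -> inside a b c d w.
Proof.
  destruct z as [x y]. intros [Hx Hy]. simpl in Hx, Hy.
  exists (Rmin (Rmin (x - a) (b - x)) (Rmin (y - c) (d - y))).
  split; [repeat apply Rmin_glb_lt; lra|].
  intros [u v] Hw.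
  pose proof (fst_le_Cmod ((u, v) - (x, y))%C) as A1. pose proof (snd_le_Cmod ((u, v) - (x, y))%C) as A2.
  simpl in A1, A2. fold (u - x) in A1. fold (v - y) in A2.
  pose proof (Rmin_l (Rmin (x - a) (b - x)) (Rmin (y - c) (d - y))).
  pose proof (Rmin_r (Rmin (x - a) (b - x)) (Rmin (y - c) (d - y))).
  pose proof (Rmin_l (x - a) (b - x)). pose proof (Rmin_r (x - a) (b - x)).
  pose proof (Rmin_l (y - c) (d - y)). pose proof (Rmin_r (y - c) (d - y)).
  pose proof (Rle_abs (u - x)). pose proof (Rle_abs (- (u - x))).
  pose proof (Rle_abs (v - y)). pose proof (Rle_abs (- (v - y))).
  rewrite Rabs_Ropp in *. unfold inside. simpl. lra.
Qed.

Section KernelDerivative.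
Variables (f : C -> C) (a b c d : R) (z : C).
Hypotheses (Hf : gcont f) (Hz : inside a b c d z).

Lemma kernel_nbhd (p : R -> C) (s e : R) : side a b c d p s e ->
  exists rho r M, 0 < rho /\ 0 < r /\ 0 < M /\
    (forall w, Cmod (w - z) < rho -> inside a b c d w) /\
    forall w t, Cmod (w - z) < rho -> s <= t <= e ->
      Cmod (f (p t)) <= M /\ (p t - w)%C <> 0%C /\ (p t - z)%C <> 0%C /\
      Cmod (/ (p t - w)) <= r /\ Cmod (/ (p t - z)) <= r.
Proof.
  intros Hp.
  destruct (inside_dist a b c d z Hz) as [r [Hr Hd]].
  destruct (inside_open a b c d z Hz) as [r' [Hr' Ho]].
  destruct (icont_bounded (fun t => f (p t)) s e) as [M [HM0 HM]];
    [apply Hp|now apply (side_icont a b c d)|].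
  (* A point within [r / 2] of [z] stays at distance at least [r / 2] from the sides, hence the
     bound [2 / r] on the inverses. *)
  exists (Rmin (r / 2) r'), (2 / r), M.
  split; [apply Rmin_glb_lt; lra|]. split; [apply Rdiv_lt_0_compat; lra|]. split; auto.
  split.
  { intros w Hw. apply Ho. eapply Rlt_le_trans; [exact Hw|apply Rmin_r]. }
  intros w t Hw Ht.
  assert (Hw' : Cmod (w - z) < r / 2) by (eapply Rlt_le_trans; [exact Hw|apply Rmin_l]).
  specialize (Hd p s e t Hp Ht). specialize (HM t Ht).
  assert (D : r / 2 <= Cmod (p t - w)).
  { pose proof (Cmod_sub_ge (p t - z) (w - z)) as T.
    replace (p t - z - (w - z))%C with (p t - w)%C in T by ring. lra. }
  assert (N1 : (p t - w)%C <> 0%C) by (apply Cmod_gt_0; lra).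
  assert (N2 : (p t - z)%C <> 0%C) by (apply Cmod_gt_0; lra).
  split; [auto|split; [auto|split; [auto|]]].
  rewrite !Cmod_inv by auto.
  replace (2 / r) with (/ (r / 2)) by (field; lra).
  split; apply Rinv_le_contravar; lra.
Qed.

Lemma side_kernel_cderiv1 (p : R -> C) (s e : R) : side a b c d p s e ->
  cderiv (fun w => CI (fun t => cauchy_kernel f w 1 (p t)) s e) z
    (CI (fun t => cauchy_kernel f z 2 (p t)) s e).
Proof.
  intros Hp. destruct (kernel_nbhd p s e Hp) as (rho & r & M & Hrho & Hr & HM & Hin & H).
  apply (CI_param_cderiv (fun w t => cauchy_kernel f w 1 (p t)) _ s e z rho (M * (r * r * r)));
    auto.
  - apply Hp.
  - assert (0 < r * r * r) by (repeat apply Rmult_lt_0_compat; auto).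
    apply Rmult_le_pos; lra.
  - intros w Hw. apply (side_icont_kernel a b c d); auto.
  - apply (side_icont_kernel a b c d); auto.
  - intros w t Hw Ht. destruct (H w t Hw Ht) as (B & N1 & N2 & B1 & B2).
    unfold cauchy_kernel.
    (* The exact remainder of [1 / (p - w)] after its first order expansion in [w] has the factor
       [(w - z)^2]. *)
    replace (f (p t) * (/ (p t - w)) ^ 1 - f (p t) * (/ (p t - z)) ^ 1 - (w - z) * (f (p t) * (/ (p t - z)) ^ 2))%C
      with (f (p t) * (/ (p t - z) * / (p t - z) * / (p t - w)) * ((w - z) * (w - z)))%C.
    2:{ simpl. field. auto. }
    rewrite !Cmod_mult. simpl. rewrite Rmult_1_r.
    apply Rmult_le_compat_r; [apply Rmult_le_pos; apply Cmod_ge_0|].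
    repeat (apply Rmult_le_compat; auto using Cmod_ge_0, Rmult_le_pos).
Qed.

Lemma side_kernel_cderiv2 (p : R -> C) (s e : R) : side a b c d p s e ->
  cderiv (fun w => CI (fun t => cauchy_kernel f w 2 (p t)) s e) z
    (CI (fun t => 2 * cauchy_kernel f z 3 (p t))%C s e).
Proof.
  intros Hp. destruct (kernel_nbhd p s e Hp) as (rho & r & M & Hrho & Hr & HM & Hin & H).
  apply (CI_param_cderiv (fun w t => cauchy_kernel f w 2 (p t)) _ s e z rho (M * (r * r * r * (r + 2 * r))));
    auto.
  - apply Hp.
  - assert (0 < r * r * r * (r + 2 * r)) by (repeat apply Rmult_lt_0_compat; lra).
    apply Rmult_le_pos; lra.
  - intros w Hw. apply (side_icont_kernel a b c d); auto.
  - intros t Ht. apply rcont_mult; [apply rcont_const|].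
    now apply (side_icont_kernel a b c d z p s e f 3).
  - intros w t Hw Ht. destruct (H w t Hw Ht) as (B & N1 & N2 & B1 & B2).
    unfold cauchy_kernel.
    replace (f (p t) * (/ (p t - w)) ^ 2 - f (p t) * (/ (p t - z)) ^ 2 - (w - z) * (2 * (f (p t) * (/ (p t - z)) ^ 3)))%C
      with (f (p t) * (/ (p t - z) * / (p t - z) * / (p t - w) * (/ (p t - w) + 2 * / (p t - z))) * ((w - z) * (w - z)))%C.
    2:{ simpl. field. auto. }
    rewrite !Cmod_mult. simpl. rewrite Rmult_1_r.
    apply Rmult_le_compat_r; [apply Rmult_le_pos; apply Cmod_ge_0|].
    repeat (apply Rmult_le_compat; auto using Cmod_ge_0, Rmult_le_pos).
    eapply Rle_trans; [apply Cmod_triangle|]. rewrite Cmod_mult, Cmod_R, Rabs_pos_eq by lra. lra.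
Qed.

Lemma rect_kernel_cderiv :
  cderiv (fun w => rect (cauchy_kernel f w 1) a b c d) z (rect (cauchy_kernel f z 2) a b c d).
Proof.
  assert (a <= b /\ c <= d) as [Hab Hcd] by (destruct Hz; lra).
  unfold rect. repeat first [apply cderiv_minus|apply cderiv_plus|apply cderiv_scal].
  - exact (side_kernel_cderiv1 _ _ _ (side_bottom a b c d Hab Hcd)).
  - exact (side_kernel_cderiv1 _ _ _ (side_right a b c d Hab Hcd)).
  - exact (side_kernel_cderiv1 _ _ _ (side_top a b c d Hab Hcd)).
  - exact (side_kernel_cderiv1 _ _ _ (side_left a b c d Hab Hcd)).
Qed.

Lemma rect_kernel_holo : holo (fun w => rect (cauchy_kernel f w 2) a b c d) z.
Proof.
  assert (a <= b /\ c <= d) as [Hab Hcd] by (destruct Hz; lra).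
  eexists. unfold rect. repeat first [apply cderiv_minus|apply cderiv_plus|apply cderiv_scal].
  - exact (side_kernel_cderiv2 _ _ _ (side_bottom a b c d Hab Hcd)).
  - exact (side_kernel_cderiv2 _ _ _ (side_right a b c d Hab Hcd)).
  - exact (side_kernel_cderiv2 _ _ _ (side_top a b c d Hab Hcd)).
  - exact (side_kernel_cderiv2 _ _ _ (side_left a b c d Hab Hcd)).
Qed.

End KernelDerivative.

(** Near a point, [f] is the quotient of the Cauchy integrals [N] of [f] and [W] of 1. Both can be
    differentiated twice under the integral sign, so the derivative given by the quotient rule is
    again holomorphic. *)
Lemma C_derive_holo (f : C -> C) : (forall z, holo f z) -> forall z, holo (C_derive f) z.
Proof.
  intros Hf z1. destruct z1 as [x y].
  assert (Hin : inside (x - 1) (x + 1) (y - 1) (y + 1) (x, y)) by (unfold inside; simpl; lra).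
  destruct (inside_open _ _ _ _ _ Hin) as [r [Hr Ho]].
  set (N := fun w => rect (cauchy_kernel f w 1) (x - 1) (x + 1) (y - 1) (y + 1)).
  set (W := fun w => rect (cauchy_kernel (fun _ => 1) w 1) (x - 1) (x + 1) (y - 1) (y + 1)).
  set (N2 := fun w => rect (cauchy_kernel f w 2) (x - 1) (x + 1) (y - 1) (y + 1)).
  set (W2 := fun w => rect (cauchy_kernel (fun _ => 1) w 2) (x - 1) (x + 1) (y - 1) (y + 1)).
  assert (Gf : gcont f) by (intros w; now apply holo_ccont).
  assert (G1 : gcont (fun _ => RtoC 1)) by (intros w; apply ccont_const).
  assert (DN : forall w, inside (x - 1) (x + 1) (y - 1) (y + 1) w -> cderiv N w (N2 w))
    by (intros w Hw; exact (rect_kernel_cderiv f _ _ _ _ w Gf Hw)).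
  assert (DW : forall w, inside (x - 1) (x + 1) (y - 1) (y + 1) w -> cderiv W w (W2 w))
    by (intros w Hw; exact (rect_kernel_cderiv (fun _ => RtoC 1) _ _ _ _ w G1 Hw)).
  assert (NZ : forall w, inside (x - 1) (x + 1) (y - 1) (y + 1) w -> W w <> 0%C)
    by (intros w Hw; exact (cauchy_winding_nz _ _ _ _ w Hw)).
  assert (E : forall w, inside (x - 1) (x + 1) (y - 1) (y + 1) w -> f w = (N w * / W w)%C).
  { intros w Hw. unfold N. rewrite (cauchy_formula f _ _ _ _ w Hf Hw). fold (W w).
    field. now apply NZ. }
  apply (holo_ext_loc (fun w => N2 w * / W w + N w * (- / (W w * W w) * W2 w))%C _ (x, y) r Hr).
  - intros w Hw. symmetry. apply cderiv_C_derive.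
    destruct (inside_open _ _ _ _ _ (Ho w Hw)) as [r' [Hr' Ho']].
    apply (cderiv_ext_loc (fun w => N w * / W w)%C f w _ r' Hr').
    + intros u Hu. symmetry. apply E. now apply Ho'.
    + exact (cderiv_mult N (fun w => / W w)%C w _ _ (DN w (Ho w Hw))
        (cderiv_comp W Cinv w _ _ (DW w (Ho w Hw)) (cderiv_Cinv (W w) (NZ w (Ho w Hw))))).
  - assert (hN : holo N (x, y)) by (exists (N2 (x, y)); exact (DN _ Hin)).
    assert (hW : holo W (x, y)) by (exists (W2 (x, y)); exact (DW _ Hin)).
    assert (hN2 : holo N2 (x, y)) by exact (rect_kernel_holo f _ _ _ _ _ Gf Hin).
    assert (hW2 : holo W2 (x, y)) by exact (rect_kernel_holo _ _ _ _ _ _ G1 Hin).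
    assert (nW := NZ (x, y) Hin).
    apply holo_plus; apply holo_mult; auto; [now apply holo_inv|].
    apply holo_mult; auto.
    apply (holo_ext (fun w => 0 - / (W w * W w))%C); [intros; ring|].
    apply holo_minus; [apply holo_const|]. apply holo_inv; [now apply Cmult_nz|now apply holo_mult].
Qed.

Lemma exists_primitive_exceptional (f : C -> C) (z0 : C) : gcont f ->
  (forall z, z <> z0 -> holo f z) -> exists F, forall z, cderiv F z (f z).
Proof.
  intros Hc Hh. exists (primitive f). apply primitive_cderiv; auto.
  intros. now apply (goursat_exceptional f z0).
Qed.

Lemma exists_primitive (f : C -> C) : (forall z, holo f z) ->
  exists F, forall z, cderiv F z (f z).
Proof.
  intros H. apply (exists_primitive_exceptional f 0); auto. intros z. now apply holo_ccont.
Qed.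

(** Removability in the manner of Morera: the slope has a primitive, so it is the derivative of an
    entire function. *)
Lemma slope_entire (f : C -> C) (z0 : C) : (forall z, holo f z) -> forall z, holo (slope f z0) z.
Proof.
  intros H z.
  destruct (exists_primitive_exceptional (slope f z0) z0) as [F HF];
    [now apply slope_gcont|now apply slope_holo|].
  apply (holo_ext (C_derive F)); [intros w; now apply cderiv_C_derive|].
  apply C_derive_holo. intros w. eexists. apply HF.
Qed.

Lemma C_derive_n_holo (f : C -> C) (n : nat) : (forall z, holo f z) ->
  forall z, holo (C_derive_n f n) z.
Proof.
  intros H. induction n as [|n IH]; [exact H|]. exact (C_derive_holo _ IH).
Qed.

Lemma C_derive_ext (f g : C -> C) : (forall z, f z = g z) -> forall z, C_derive f z = C_derive g z.
Proof. intros E. replace g with f; [auto|]. now apply functional_extensionality. Qed.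

(** Leibniz' rule for a factor [w]. At 0 it expresses the derivatives of [f] through those of its
    slope, which is how the Taylor coefficients are identified. *)
Lemma C_derive_n_mult_id (q : C -> C) (c : C) (n : nat) : (forall z, holo q z) ->
  forall z, C_derive_n (fun w => c + w * q w)%C (S n) z =
    (z * C_derive_n q (S n) z + RtoC (INR (S n)) * C_derive_n q n z)%C.
Proof.
  intros H. induction n as [|n IH]; intros z.
  - apply cderiv_C_derive. eapply cderiv_eq.
    + apply cderiv_plus; [apply cderiv_const|]. apply cderiv_mult; [apply cderiv_id|].
      apply holo_C_derive, H.
    + simpl. ring.
  - change (C_derive (C_derive_n (fun w => c + w * q w)%C (S n)) z =
      (z * C_derive_n q (S (S n)) z + RtoC (INR (S (S n))) * C_derive_n q (S n) z)%C).
    rewrite (C_derive_ext _ _ IH). apply cderiv_C_derive. eapply cderiv_eq.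
    + apply cderiv_plus.
      * apply cderiv_mult; [apply cderiv_id|]. apply holo_C_derive. now apply C_derive_n_holo.
      * apply cderiv_scal. apply holo_C_derive. now apply C_derive_n_holo.
    + rewrite (S_INR (S n)), RtoC_plus.
      change (C_derive (C_derive_n q (S n)) z) with (C_derive_n q (S (S n)) z).
      change (C_derive (C_derive_n q n) z) with (C_derive_n q (S n) z). ring.
Qed.

Lemma RtoC_nz (x : R) : x <> 0 -> RtoC x <> 0%C.
Proof. intros N E. apply N. now apply RtoC_inj. Qed.

(** Dividing by [z] once more at each stage works because the slope at 0 of an entire function is
    entire; the last slope is the remainder [g]. *)
Lemma taylor_remainder (f : C -> C) (n : nat) : (forall z, holo f z) ->
  exists g, (forall z, holo g z) /\ forall z,
    f z = (sum_n (G := C_AbelianMonoid)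
             (fun k => C_derive_n f k 0 / RtoC (INR (fact k)) * z ^ k)%C n + z ^ (S n) * g z)%C.
Proof.
  revert f. induction n as [|n IH]; intros f Hf.
  - exists (slope f 0). split; [now apply slope_entire|]. intros z.
    rewrite sum_O. rewrite (slope_spec f 0 z) at 1. simpl. field.
  - destruct (IH (slope f 0)) as [g [Hg E]]; [now apply slope_entire|].
    exists g. split; auto. intros z.
    rewrite (slope_spec f 0 z) at 1. rewrite (E z).
    unfold sum_n. rewrite (sum_n_m_Chasles (G := C_AbelianMonoid) _ 0 0 (S n)) by lia.
    rewrite (sum_n_n (G := C_AbelianMonoid)).
    rewrite <- (sum_n_m_S (G := C_AbelianMonoid) _ 0 n).
    match goal with |- _ = (plus ?u ?v + ?w)%C => change (plus u v + w)%C with (u + v + w)%C end.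
    rewrite (sum_n_m_ext (G := C_AbelianMonoid)
      (fun k => C_derive_n f (S k) 0 / RtoC (INR (fact (S k))) * z ^ S k)%C
      (fun k => mult (z : C_Ring) (C_derive_n (slope f 0) k 0 / RtoC (INR (fact k)) * z ^ k)%C)).
    + rewrite (sum_n_m_mult_l (K := C_Ring)).
      simpl. unfold mult; simpl.
      match goal with |- (_ + _ * (?s + _))%C = (_ + _ * ?s' + _)%C =>
        change s' with s; generalize s end. intros s. field.
    + intros k. replace (C_derive_n f (S k) 0) with (RtoC (INR (S k)) * C_derive_n (slope f 0) k 0)%C.
      * change (mult (z : C_Ring) (C_derive_n (slope f 0) k 0 / RtoC (INR (fact k)) * z ^ k)%C)
          with (z * (C_derive_n (slope f 0) k 0 / RtoC (INR (fact k)) * z ^ k))%C.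
        rewrite fact_simpl, mult_INR, RtoC_mult. 
        change (z ^ S k)%C with (z * z ^ k)%C.
        match goal with |- ?u = ?v => change (@eq C u v) end. field. split.
        -- apply RtoC_nz. apply INR_fact_neq_0.
        -- apply RtoC_nz. apply not_0_INR. lia.
      * replace f with (fun w => f 0 + w * slope f 0 w)%C at 2.
        -- rewrite C_derive_n_mult_id by (now apply slope_entire). ring.
        -- apply functional_extensionality. intros w. rewrite (slope_spec f 0 w). ring.
Qed.

(** * The Phragmen-Lindelof principle in a quadrant *)

Definition cexp (z : C) : C := (exp (fst z) * cos (snd z), exp (fst z) * sin (snd z)).

Lemma cexp_plus (z w : C) : cexp (z + w) = (cexp z * cexp w)%C.
Proof.
  destruct z as [x y], w as [u v]. unfold cexp. apply C_ext; simpl;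
  rewrite exp_plus; [rewrite cos_plus|rewrite sin_plus]; ring.
Qed.

Lemma Cmod_cexp (z : C) : Cmod (cexp z) = exp (fst z).
Proof.
  unfold cexp, Cmod. simpl fst; simpl snd.
  replace ((exp (fst z) * cos (snd z)) ^ 2 + (exp (fst z) * sin (snd z)) ^ 2)
    with (exp (fst z) ^ 2 * (Rsqr (sin (snd z)) + Rsqr (cos (snd z)))) by (unfold Rsqr; ring).
  rewrite sin2_cos2, Rmult_1_r. apply sqrt_pow2. left; apply exp_pos.
Qed.

Lemma derivable_lim_0_linear (f : R -> R) (l eps : R) : derivable_pt_lim f 0 l -> 0 < eps ->
  exists d, 0 < d /\ forall h, Rabs h < d -> Rabs (f h - f 0 - l * h) <= eps * Rabs h.
Proof.
  intros H He. destruct (H eps He) as [d Hd]. exists d. split; [apply cond_pos|].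
  intros h Hh. destruct (Req_dec h 0) as [->|N].
  - replace (f 0 - f 0 - l * 0) with 0 by ring. rewrite Rabs_R0. lra.
  - specialize (Hd h N Hh). rewrite Rplus_0_l in Hd.
    replace (f h - f 0 - l * h) with (((f h - f 0) / h - l) * h) by (field; auto).
    rewrite Rabs_mult. apply Rmult_le_compat_r; [apply Rabs_pos|lra].
Qed.

Lemma cexp_cderiv_0 : cderiv cexp 0 1.
Proof.
  apply cderiv_intro. intros eps He.
  (* The first order errors of [exp], [sin] and [cos] add up to at most [6 e m]; [e <= 1] and
     [|u| < e / 2] give [|exp u - 1| <= e]. *)
  set (e := Rmin 1 (eps / 6)).
  assert (He' : 0 < e) by (apply Rmin_glb_lt; lra).
  assert (e1 : e <= 1) by apply Rmin_l. assert (e6 : e <= eps / 6) by apply Rmin_r.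
  destruct (derivable_lim_0_linear exp 1 e derivable_pt_lim_exp_0 He') as [d1 [Hd1 H1]].
  destruct (derivable_lim_0_linear sin 1 e) as [d2 [Hd2 H2]]; auto.
  { rewrite <- cos_0. apply derivable_pt_lim_sin. }
  destruct (derivable_lim_0_linear cos 0 e) as [d3 [Hd3 H3]]; auto.
  { replace 0 with (- sin 0) at 2 by (rewrite sin_0; ring). apply derivable_pt_lim_cos. }
  exists (Rmin (e / 2) (Rmin d1 (Rmin d2 d3))).
  split; [repeat apply Rmin_glb_lt; lra|].
  intros [u v] Hw. replace ((u, v) - 0)%C with ((u, v) : C) in * by (apply C_ext; simpl; ring).
  pose proof (fst_le_Cmod (u, v)) as A1. pose proof (snd_le_Cmod (u, v)) as A2. simpl in A1, A2.
  set (m := Cmod (u, v)) in *.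
  assert (m < e / 2 /\ m < d1 /\ m < d2 /\ m < d3) as (M0 & M1 & M2 & M3).
  { pose proof (Rmin_l (e / 2) (Rmin d1 (Rmin d2 d3))). pose proof (Rmin_r (e / 2) (Rmin d1 (Rmin d2 d3))).
    pose proof (Rmin_l d1 (Rmin d2 d3)). pose proof (Rmin_r d1 (Rmin d2 d3)).
    pose proof (Rmin_l d2 d3). pose proof (Rmin_r d2 d3). lra. }
  specialize (H1 u ltac:(lra)). specialize (H2 v ltac:(lra)). specialize (H3 v ltac:(lra)).
  rewrite exp_0 in H1. rewrite sin_0 in H2. rewrite cos_0 in H3.
  set (al := exp u - 1 - 1 * u) in *. set (ga := sin v - 0 - 1 * v) in *. set (be := cos v - 1 - 0 * v) in *.
  pose proof (Rabs_pos u). pose proof (Rabs_pos v).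
  assert (Eu1 : Rabs (exp u - 1) <= e).
  { replace (exp u - 1) with (al + u) by (unfold al; ring).
    eapply Rle_trans; [apply Rabs_triang|].
    assert (e * Rabs u <= 1 * Rabs u) by (apply Rmult_le_compat_r; lra). lra. }
  assert (Eu2 : Rabs (exp u) <= 2).
  { rewrite Rabs_pos_eq by (left; apply exp_pos).
    pose proof (Rle_abs (exp u - 1)). lra. }
  eapply Rle_trans; [apply Cmod_le_abs|].
  replace (fst (cexp (u, v) - cexp 0 - 1 * (u, v))%C) with (al + exp u * be)
    by (unfold cexp, al, be; simpl; rewrite exp_0, cos_0; ring).
  replace (snd (cexp (u, v) - cexp 0 - 1 * (u, v))%C) with (exp u * ga + v * (exp u - 1))
    by (unfold cexp, ga; simpl; rewrite exp_0, sin_0; ring).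
  pose proof (Rabs_triang al (exp u * be)) as T1.
  pose proof (Rabs_triang (exp u * ga) (v * (exp u - 1))) as T2.
  rewrite Rabs_mult in T1. rewrite (Rabs_mult (exp u)), (Rabs_mult v) in T2.
  assert (Rabs (exp u) * Rabs be <= 2 * (e * Rabs v)) by (apply Rmult_le_compat; auto using Rabs_pos).
  assert (Rabs (exp u) * Rabs ga <= 2 * (e * Rabs v)) by (apply Rmult_le_compat; auto using Rabs_pos).
  assert (Rabs v * Rabs (exp u - 1) <= Rabs v * e) by (apply Rmult_le_compat_l; auto).
  assert (e * Rabs u <= e * m) by (apply Rmult_le_compat_l; lra).
  assert (e * Rabs v <= e * m) by (apply Rmult_le_compat_l; lra).
  assert (6 * e * m <= eps * m) by (apply Rmult_le_compat_r; lra). lra.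
Qed.

Lemma cexp_cderiv (z : C) : cderiv cexp z (cexp z).
Proof.
  apply (cderiv_ext (fun w => cexp z * cexp (w - z))%C).
  { intros w. rewrite <- cexp_plus. f_equal. ring. }
  eapply cderiv_eq.
  - apply cderiv_scal. apply (cderiv_comp (fun w => w - z)%C cexp).
    + apply cderiv_minus; [apply cderiv_id|apply cderiv_const].
    + replace (z - z)%C with (RtoC 0) by ring. apply cexp_cderiv_0.
  - apply C_ext; simpl; ring.
Qed.

Lemma cexp_holo (z : C) : holo cexp z.
Proof. eexists. apply cexp_cderiv. Qed.

Lemma cos_3PI8_pos : 0 < cos (3 * PI / 8).
Proof. pose proof PI_RGT_0. apply cos_gt_0; lra. Qed.

(** The angle [3/2 (v - PI/4)] stays in [[-3 PI/8, 3 PI/8]], where the cosine is bounded below by a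
    positive number. The exponent [3/2] exceeds 1, to beat exponential type, and is below 2, the
    critical order of a quadrant. *)
Lemma cos_tilt_lower (v : R) : 0 <= v <= PI / 2 -> cos (3 * PI / 8) <= cos (3 / 2 * v - 3 * PI / 8).
Proof.
  intros Hv. pose proof PI_RGT_0. destruct (Rle_dec 0 (3 / 2 * v - 3 * PI / 8)).
  - apply cos_decr_1; lra.
  - rewrite <- (cos_neg (3 / 2 * v - _)). apply cos_decr_1; lra.
Qed.

Lemma exp_ge_1 (x : R) : 0 <= x -> 1 <= exp x.
Proof. intros. pose proof (exp_ineq1_le x). lra. Qed.

Lemma exp_le (x y : R) : x <= y -> exp x <= exp y.
Proof. intros [H| ->]; [left; now apply exp_increasing|lra]. Qed.

Lemma polar_quadrant (x y : R) : 0 < x -> 0 < y ->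
  cexp (ln (Cmod (x, y)), atan (y / x)) = (x, y).
Proof.
  intros Hx Hy.
  assert (Hm : 0 < Cmod (x, y)).
  { apply Cmod_gt_0. intros E. apply (f_equal fst) in E. simpl in E. lra. }
  unfold cexp. simpl fst; simpl snd. rewrite exp_ln by auto.
  assert (E : Cmod (x, y) = x * sqrt (1 + (y / x)²)).
  { unfold Cmod. simpl fst; simpl snd.
    replace (x ^ 2 + y ^ 2) with (x ^ 2 * (1 + (y / x)²)) by (unfold Rsqr; field; lra).
    rewrite sqrt_mult, sqrt_pow2; try lra; [apply pow2_ge_0|].
    pose proof (Rle_0_sqr (y / x)). lra. }
  assert (Hs : 0 < sqrt (1 + (y / x)²)).
  { apply sqrt_lt_R0. pose proof (Rle_0_sqr (y / x)). lra. }
  rewrite cos_atan, sin_atan, E. apply C_ext; simpl; field; lra.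
Qed.

(* In the coordinate [zeta = ln z] the quadrant is a half strip, exhausted by
   rectangles; the factor [exp (- del * e^(3/2 (zeta - i PI / 4)))] beats the
   exponential growth of [h] on the far side and tends to [1] with [del]. *)
Lemma phragmen_lindelof_quadrant (h : C -> C) (A B M : R) :
  (forall z, holo h z) -> 0 <= A -> 0 <= B ->
  (forall z, Cmod (h z) <= A * exp (B * Cmod z)) ->
  (forall x, 0 <= x -> Cmod (h (x, 0)) <= M) ->
  (forall y, 0 <= y -> Cmod (h (0, y)) <= M) ->
  forall x y, 0 <= x -> 0 <= y -> Cmod (h (x, y)) <= Rmax M (A * exp B).
Proof.
  intros Hh HA HB Hg Hx Hy x y Px Py.
  set (M' := Rmax M (A * exp B)).
  assert (MM : M <= M') by apply Rmax_l. assert (MA : A * exp B <= M') by apply Rmax_r.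
  assert (HM' : 0 <= M').
  { eapply Rle_trans; [|exact MA]. apply Rmult_le_pos; [auto|left; apply exp_pos]. }
  destruct Px as [Px|<-]; [|eapply Rle_trans; [now apply Hy|auto]].
  destruct Py as [Py|<-]; [|eapply Rle_trans; [apply Hx; lra|auto]].
  destruct (Rle_dec (Cmod (x, y)) 1) as [H1|H1].
  { eapply Rle_trans; [apply Hg|]. eapply Rle_trans; [|exact MA].
    apply Rmult_le_compat_l; auto. apply exp_le.
    replace B with (B * 1) at 2 by ring. now apply Rmult_le_compat_l. }
  assert (Hm : 1 < Cmod (x, y)) by lra. clear H1.
  set (u := ln (Cmod (x, y))). set (v := atan (y / x)).
  assert (Hu : 0 < u) by (unfold u; rewrite <- ln_1; apply ln_increasing; lra).
  assert (Hv : 0 < v < PI / 2).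
  { pose proof (atan_bound (y / x)). split; [|unfold v; lra].
    unfold v. rewrite <- atan_0. apply atan_increasing. now apply Rdiv_lt_0_compat. }
  assert (Hz := polar_quadrant x y Px Py). fold u v in Hz.
  set (T := exp (3 / 2 * u)).
  assert (HT : 0 < T) by apply exp_pos.
  assert (Key : forall del, 0 < del -> Cmod (h (x, y)) * exp (- (del * T)) <= M').
  { intros del Hdel.
    set (tilt := fun z => cexp (RtoC (3 / 2) * z + (0, (- (3 * PI / 8))%R))%C).
    set (mu := fun z => cexp (RtoC (- del) * tilt z)%C).
    assert (Hmu : forall a b, Cmod (mu (a, b)) = exp (- (del * exp (3 / 2 * a) * cos (3 / 2 * b - 3 * PI / 8)))).
    { intros a b. unfold mu. rewrite Cmod_cexp. f_equal. unfold tilt, cexp. simpl.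
      replace (3 / 2 * a - 0 * b + 0) with (3 / 2 * a) by ring.
      replace (3 / 2 * b + 0 * a + - (3 * PI / 8)) with (3 / 2 * b - 3 * PI / 8) by ring. ring. }
    assert (Hmu1 : forall a b, 0 <= b <= PI / 2 ->
      Cmod (mu (a, b)) <= exp (- (del * cos (3 * PI / 8) * exp (3 / 2 * a)))).
    { intros a b Hb. rewrite Hmu. apply exp_le. apply Ropp_le_contravar.
      pose proof (cos_tilt_lower b Hb) as Hc. pose proof (exp_pos (3 / 2 * a)) as He.
      rewrite Rmult_assoc, Rmult_assoc. apply Rmult_le_compat_l; [lra|].
      rewrite Rmult_comm. apply Rmult_le_compat_l; lra. }
    assert (Hc0 := cos_3PI8_pos). set (c0 := cos (3 * PI / 8)) in *.
    assert (Hmu2 : forall a b, 0 <= b <= PI / 2 -> Cmod (mu (a, b)) <= 1).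
    { intros a b Hb. eapply Rle_trans; [now apply Hmu1|]. rewrite <- exp_0. apply exp_le.
      pose proof (exp_pos (3 / 2 * a)).
      assert (0 < del * c0 * exp (3 / 2 * a)) by (repeat apply Rmult_lt_0_compat; auto). lra. }
    (* Large enough for [B e^R0 <= del c0 e^(3/2 R0)], through [1 + x <= e^x] at [x = R0 / 2]; the
       summand [u + 1] keeps the point inside the rectangle. *)
    set (R0 := 2 * (B / (del * c0)) + u + 1).
    assert (HR1 : 0 <= B / (del * c0)).
    { apply Rmult_le_pos; auto. left. apply Rinv_0_lt_compat. now apply Rmult_lt_0_compat. }
    set (k := fun z => (h (cexp z) * mu z)%C).
    assert (Hk : forall z, holo k z).
    { intros z. apply holo_mult; [apply (holo_comp cexp h); [apply cexp_holo|apply Hh]|].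
      apply (holo_comp (fun z => RtoC (- del) * tilt z)%C cexp); [|apply cexp_holo].
      apply holo_mult; [apply holo_const|].
      apply (holo_comp (fun z => RtoC (3 / 2) * z + (0, (- (3 * PI / 8))%R))%C cexp); [|apply cexp_holo].
      apply holo_plus; [|apply holo_const]. apply holo_mult; [apply holo_const|apply holo_id]. }
    assert (Kz : Cmod (k (u, v)) <= M').
    { apply (maximum_modulus k 0 R0 0 (PI / 2) M' (u, v)); auto.
      - unfold inside. simpl. unfold R0. lra.
      - intros p s e t Hp Ht. destruct Hp as (_ & _ & Hp). destruct (Hp t Ht) as (Hp1 & Hp2 & Hp3).
        destruct (p t) as [a b]. simpl in Hp1, Hp2, Hp3. unfold k. rewrite Cmod_mult.
        pose proof (Hmu2 a b Hp2) as Hm2. pose proof (Cmod_ge_0 (mu (a, b))) as Hm0.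
        assert (Red : Cmod (h (cexp (a, b))) <= M' -> Cmod (h (cexp (a, b))) * Cmod (mu (a, b)) <= M').
        { intros HH. rewrite <- (Rmult_1_r M'). apply Rmult_le_compat; auto using Cmod_ge_0. }
        (* The sides are, in the plane of [h], the arc of the unit circle, the far arc, the positive
           real axis and the positive imaginary axis. *)
        destruct Hp3 as [E|[E|[E|E]]]; subst.
        + apply Red. eapply Rle_trans; [apply Hg|]. rewrite Cmod_cexp. simpl fst.
          rewrite exp_0, Rmult_1_r. auto.
        + eapply Rle_trans; [apply Rmult_le_compat; [apply Cmod_ge_0|auto|apply Hg|apply Hmu1, Hp2]|].
          rewrite Cmod_cexp. simpl fst. rewrite Rmult_assoc, <- exp_plus.
          eapply Rle_trans; [|exact MA]. apply Rmult_le_compat_l; auto. apply exp_le.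
          assert (Hexp : B <= del * c0 * exp (1 / 2 * R0)).
          { apply Rle_trans with (del * c0 * (1 + 1 / 2 * R0)).
            - unfold R0. replace B with (del * c0 * (B / (del * c0))) at 1 by (field; lra).
              apply Rmult_le_compat_l; [left; now apply Rmult_lt_0_compat|]. lra.
            - apply Rmult_le_compat_l; [left; now apply Rmult_lt_0_compat|]. apply exp_ineq1_le. }
          replace (3 / 2 * R0) with (1 / 2 * R0 + R0) by field. rewrite exp_plus.
          pose proof (exp_pos R0).
          assert (B * exp R0 <= del * c0 * exp (1 / 2 * R0) * exp R0) by (apply Rmult_le_compat_r; lra).
          lra.
        + apply Red. unfold cexp. simpl. rewrite cos_0, sin_0, Rmult_0_r, Rmult_1_r.
          eapply Rle_trans; [apply Hx; left; apply exp_pos|auto].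
        + apply Red. unfold cexp. simpl. rewrite cos_PI2, sin_PI2, Rmult_0_r, Rmult_1_r.
          eapply Rle_trans; [apply Hy; left; apply exp_pos|auto]. }
    unfold k in Kz. rewrite Cmod_mult, Hz, Hmu in Kz.
    eapply Rle_trans; [|exact Kz]. apply Rmult_le_compat_l; [apply Cmod_ge_0|].
    apply exp_le. apply Ropp_le_contravar. fold T.
    replace (del * T) with (del * T * 1) at 2 by ring.
    apply Rmult_le_compat_l; [left; now apply Rmult_lt_0_compat|]. apply COS_bound. }
  apply Rnot_lt_le. intros Hlt.
  pose proof (Cmod_ge_0 (h (x, y))) as P0. set (N := Cmod (h (x, y))) in *.
  assert (HN : 0 < N) by lra.
  assert (HTN : 0 < T * N) by (now apply Rmult_lt_0_compat).
  (* With this [del], [N exp (- del T) >= N (1 - del T)], which is the midpoint of [N] and [M'] and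
     so exceeds [M']. *)
  specialize (Key ((N - M') / (2 * (T * N))) ltac:(apply Rdiv_lt_0_compat; lra)).
  pose proof (exp_ineq1_le (- ((N - M') / (2 * (T * N)) * T))) as Hexp.
  assert (N * (1 + - ((N - M') / (2 * (T * N)) * T)) <= M').
  { eapply Rle_trans; [apply Rmult_le_compat_l; [lra|exact Hexp]|exact Key]. }
  replace (N * (1 + - ((N - M') / (2 * (T * N)) * T))) with (N - (N - M') / 2) in H by (field; lra).
  lra.
Qed.

(** * Functions of exponential type with a limit on the half line *)

Definition tends (G : R -> C) (L : C) : Prop :=
  forall eta, 0 < eta -> exists X0, forall x, X0 <= x -> Cmod (G x - L) <= eta.

Lemma pow4_le (a b : R) : 0 <= b -> a ^ 4 <= b ^ 4 -> a <= b.
Proof.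
  intros Hb H. apply Rnot_lt_le. intros Hlt.
  assert (b ^ 2 < a ^ 2) by (simpl; nra). nra.
Qed.

(* On each side of the square centred at [(X, y)] and resting on the real axis,
   one of the four factors [h (z0 + i^k (w - z0))] is evaluated on the axis. *)
Lemma square_rotation_bound (h : C -> C) (X y K e : R) : (forall z, holo h z) ->
  0 < y -> y <= X -> 0 <= K -> 0 <= e ->
  (forall u v, 0 <= u -> 0 <= v -> Cmod (h (u, v)) <= K) ->
  (forall u, X - y <= u -> Cmod (h (u, 0)) <= e) ->
  Cmod (h (X, y)) ^ 4 <= e * K ^ 3.
Proof.
  intros Hh Hy HX HK He HQ Hr.
  set (z0 := (X, y) : C).
  set (P := fun w => (h w * h (z0 + Ci * (w - z0)) * (h (z0 + - (1) * (w - z0)) * h (z0 + - Ci * (w - z0))))%C).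
  assert (HP : forall w, holo P w).
  { assert (Hl : forall c w, holo (fun w => h (z0 + c * (w - z0)))%C w).
    { intros c w. apply (holo_comp (fun w => z0 + c * (w - z0))%C h); [|apply Hh].
      apply holo_plus; [apply holo_const|]. apply holo_mult; [apply holo_const|].
      apply holo_minus; [apply holo_id|apply holo_const]. }
    intros w. apply holo_mult; apply holo_mult; auto. }
  assert (B : Cmod (P z0) <= e * K ^ 3).
  { assert (HeK : 0 <= e * K ^ 3) by (apply Rmult_le_pos; [auto|now apply pow_le]).
    apply (maximum_modulus P (X - y) (X + y) 0 (2 * y)); auto.
    - unfold inside, z0. simpl. lra.
    - intros p s t0 t Hp Ht. destruct Hp as (_ & _ & Hp). destruct (Hp t Ht) as (H1 & H2 & H3).
      destruct (p t) as [u v]. simpl in H1, H2, H3. unfold P.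
      replace (z0 + Ci * ((u, v) - z0))%C with ((X - (v - y), y + (u - X)) : C) by (apply C_ext; simpl; ring).
      replace (z0 + - (1) * ((u, v) - z0))%C with ((2 * X - u, 2 * y - v) : C) by (apply C_ext; simpl; ring).
      replace (z0 + - Ci * ((u, v) - z0))%C with ((X + (v - y), y - (u - X)) : C) by (apply C_ext; simpl; ring).
      rewrite !Cmod_mult.
      assert (B0 : Cmod (h (u, v)) <= K) by (apply HQ; lra).
      assert (B1 : Cmod (h (X - (v - y), y + (u - X))) <= K) by (apply HQ; lra).
      assert (B2 : Cmod (h (2 * X - u, 2 * y - v)) <= K) by (apply HQ; lra).
      assert (B3 : Cmod (h (X + (v - y), y - (u - X))) <= K) by (apply HQ; lra).
      assert (Fin : forall a0 a1 a2 a3, 0 <= a0 -> 0 <= a1 -> 0 <= a2 -> 0 <= a3 ->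
        a0 <= K -> a1 <= K -> a2 <= K -> a3 <= K ->
        (a0 <= e \/ a1 <= e \/ a2 <= e \/ a3 <= e) -> a0 * a1 * (a2 * a3) <= e * K ^ 3).
      { intros a0 a1 a2 a3 P0 P1 P2 P3 K0 K1 K2 K3 [E|[E|[E|E]]].
        - replace (e * K ^ 3) with (e * K * (K * K)) by ring.
          repeat (apply Rmult_le_compat; auto using Rmult_le_pos).
        - replace (e * K ^ 3) with (K * e * (K * K)) by ring.
          repeat (apply Rmult_le_compat; auto using Rmult_le_pos).
        - replace (e * K ^ 3) with (K * K * (e * K)) by ring.
          repeat (apply Rmult_le_compat; auto using Rmult_le_pos).
        - replace (e * K ^ 3) with (K * K * (K * e)) by ring.
          repeat (apply Rmult_le_compat; auto using Rmult_le_pos). }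
      apply Fin; auto using Cmod_ge_0.
      destruct H3 as [E|[E|[E|E]]]; subst.
      + right; left. replace (y + (X - y - X)) with 0 by ring. apply Hr. lra.
      + right; right; right. replace (y - (X + y - X)) with 0 by ring. apply Hr. lra.
      + left. apply Hr. lra.
      + right; right; left. replace (2 * y - 2 * y) with 0 by ring. apply Hr. lra. }
  unfold P in B. 
  replace (z0 + Ci * (z0 - z0))%C with z0 in B by ring.
  replace (z0 + - (1) * (z0 - z0))%C with z0 in B by ring.
  replace (z0 + - Ci * (z0 - z0))%C with z0 in B by ring.
  rewrite !Cmod_mult in B. eapply Rle_trans; [|exact B]. right. ring.
Qed.

Lemma Cmod_sub_le (a b : C) : Cmod (a - b) <= Cmod a + Cmod b.
Proof. pose proof (Cmod_triangle a (- b)). rewrite Cmod_opp in H. exact H. Qed.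

(** The factor [e^(isz)] cancels the growth of [G - L] on the imaginary axis, so that
    Phragmen-Lindelof bounds the product [H] by a constant [K]. At great height the spare rate
    [s' - s] absorbs [K]; at bounded height the smallness on the real axis is propagated by
    [square_rotation_bound]. *)
Lemma exp_type_tends_upper (G : C -> C) (A s s' : R) (L : C) :
  (forall z, holo G z) -> 0 <= A -> 0 < s -> s < s' ->
  (forall z, Cmod (G z) <= A * exp (s * Cmod z)) ->
  tends (fun x => G (x, 0)) L ->
  forall eta, 0 < eta -> exists X0, forall X y, X0 <= X -> 0 <= y ->
    Cmod (G (X, y) - L) <= eta * exp (s' * y).
Proof.
  intros HG HA Hs Hs' Hgr HL eta Heta.
  set (H := fun z => ((G z - L) * cexp (Ci * RtoC s * z))%C).
  assert (Hexp : forall x y, Cmod (cexp (Ci * RtoC s * (x, y))) = exp (- (s * y))).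
  { intros x y. rewrite Cmod_cexp. f_equal. simpl. ring. }
  assert (HH : forall z, holo H z).
  { intros z. apply holo_mult; [apply holo_minus; [apply HG|apply holo_const]|].
    apply (holo_comp (fun z => Ci * RtoC s * z)%C cexp); [|apply cexp_holo].
    apply holo_mult; [apply holo_const|apply holo_id]. }
  assert (PL := Cmod_ge_0 L).
  assert (HGL : forall z, Cmod (G z - L) <= (A + Cmod L) * exp (s * Cmod z)).
  { intros z. eapply Rle_trans; [apply Cmod_sub_le|]. specialize (Hgr z).
    assert (1 <= exp (s * Cmod z)) by (apply exp_ge_1, Rmult_le_pos; [lra|apply Cmod_ge_0]).
    assert (Cmod L * 1 <= Cmod L * exp (s * Cmod z)) by (apply Rmult_le_compat_l; auto). lra. }
  destruct (HL 1 Rlt_0_1) as [X1 HX1].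
  set (M := Rmax (Rmax 1 ((A + Cmod L) * exp (s * Rmax 0 X1))) (A + Cmod L)).
  assert (M1 : Rmax 1 ((A + Cmod L) * exp (s * Rmax 0 X1)) <= M) by apply Rmax_l.
  assert (M2 : A + Cmod L <= M) by apply Rmax_r.
  assert (M3 := Rmax_l 1 ((A + Cmod L) * exp (s * Rmax 0 X1))).
  assert (M4 := Rmax_r 1 ((A + Cmod L) * exp (s * Rmax 0 X1))).
  set (K := Rmax M ((A + Cmod L) * exp (2 * s))).
  assert (HK : 1 <= K) by (eapply Rle_trans; [|apply Rmax_l]; lra).
  assert (HQ : forall u v, 0 <= u -> 0 <= v -> Cmod (H (u, v)) <= K).
  (* The growth bound must hold in the whole plane, and [e^(isz)] grows in the lower half plane,
     hence the rate [2 s]. *)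
  { apply phragmen_lindelof_quadrant; auto; try lra.
    - intros [x y]. unfold H. rewrite Cmod_mult, Hexp.
      replace (2 * s * Cmod (x, y)) with (s * Cmod (x, y) + s * Cmod (x, y)) by ring.
      rewrite exp_plus, <- Rmult_assoc.
      apply Rmult_le_compat; auto using Cmod_ge_0; [left; apply exp_pos|].
      apply exp_le. pose proof (snd_le_Cmod (x, y)) as Hy. simpl in Hy.
      pose proof (Rle_abs (- y)). rewrite Rabs_Ropp in H0.
      replace (- (s * y)) with (s * - y) by ring. apply Rmult_le_compat_l; lra.
    - intros x Hx. unfold H. rewrite Cmod_mult, Hexp.
      replace (- (s * 0)) with 0 by ring. rewrite exp_0, Rmult_1_r.
      destruct (Rle_dec X1 x) as [Hx1|Hx1]; [specialize (HX1 x Hx1); lra|].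
      eapply Rle_trans; [apply HGL|]. eapply Rle_trans; [|exact M1]. eapply Rle_trans; [|exact M4].
      apply Rmult_le_compat_l; [lra|]. apply exp_le, Rmult_le_compat_l; [lra|].
      change ((x, 0) : C) with (RtoC x). rewrite Cmod_R, Rabs_pos_eq by auto.
      pose proof (Rmax_r 0 X1). lra.
    - intros y Hy. unfold H. rewrite Cmod_mult, Hexp.
      eapply Rle_trans; [|exact M2].
      apply Rle_trans with ((A + Cmod L) * exp (s * Cmod (0, y)) * exp (- (s * y))).
      { apply Rmult_le_compat_r; [left; apply exp_pos|apply HGL]. }
      assert (Hm : Cmod (0, y) <= y).
      { eapply Rle_trans; [apply Cmod_le_abs|]. simpl. rewrite Rabs_R0, Rabs_pos_eq by auto. lra. }
      rewrite Rmult_assoc, <- exp_plus. rewrite <- (Rmult_1_r (A + Cmod L)) at 2.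
      apply Rmult_le_compat_l; [lra|]. rewrite <- exp_0. apply exp_le.
      assert (s * Cmod (0, y) <= s * y) by (apply Rmult_le_compat_l; lra). lra. }
  (* Above this height, [K <= eta (s' - s) y <= eta e^((s' - s) y)]. *)
  set (Y0 := K / (eta * (s' - s))).
  assert (HY0 : 0 < Y0) by (apply Rdiv_lt_0_compat; [lra|apply Rmult_lt_0_compat; lra]).
  (* Chosen so that [e K^3 <= eta^4], the fourth power coming from the four rotated factors. *)
  set (e := Rmin eta (eta ^ 4 / K ^ 3)).
  assert (HK3 : 0 < K ^ 3) by (apply pow_lt; lra).
  assert (He : 0 < e).
  { apply Rmin_glb_lt; auto. apply Rdiv_lt_0_compat; auto. now apply pow_lt. }
  assert (e1 : e <= eta) by apply Rmin_l. assert (e2 : e <= eta ^ 4 / K ^ 3) by apply Rmin_r.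
  destruct (HL e He) as [X2 HX2].
  (* For [y <= Y0] the square centred at [(X, y)] has half side [y <= X], and its base lies to the
     right of [X2]. *)
  exists (Rmax Y0 (X2 + Y0)). intros X y HX Hy.
  pose proof (Rmax_l Y0 (X2 + Y0)). pose proof (Rmax_r Y0 (X2 + Y0)).
  assert (HHr : forall u, X2 <= u -> Cmod (H (u, 0)) <= e).
  { intros u Hu. unfold H. rewrite Cmod_mult, Hexp.
    replace (- (s * 0)) with 0 by ring. rewrite exp_0, Rmult_1_r. now apply HX2. }
  assert (Fin : Cmod (H (X, y)) <= eta * exp ((s' - s) * y)).
  { assert (Hge : 1 <= exp ((s' - s) * y)) by (apply exp_ge_1, Rmult_le_pos; lra).
    destruct (Rle_dec y Y0) as [Hy0|Hy0].
    - apply Rle_trans with (eta * 1); [rewrite Rmult_1_r|apply Rmult_le_compat_l; lra].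
      destruct Hy as [Hy| <-]; [|specialize (HHr X ltac:(lra)); lra].
      apply pow4_le; [lra|].
      eapply Rle_trans; [apply (square_rotation_bound H X y K e)|]; auto; try lra.
      + intros u Hu. apply HHr. lra.
      + apply Rle_trans with (eta ^ 4 / K ^ 3 * K ^ 3); [apply Rmult_le_compat_r; lra|].
        right. field. lra.
    - eapply Rle_trans; [apply HQ; lra|].
      apply Rle_trans with (eta * ((s' - s) * y)).
      + apply Rle_trans with (eta * ((s' - s) * Y0)).
        * right. unfold Y0. field. lra.
        * apply Rmult_le_compat_l; [lra|]. apply Rmult_le_compat_l; lra.
      + apply Rmult_le_compat_l; [lra|]. pose proof (exp_ineq1_le ((s' - s) * y)). lra. }
  unfold H in Fin. rewrite Cmod_mult, Hexp in Fin.
  apply Rmult_le_reg_r with (exp (- (s * y))); [apply exp_pos|].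
  eapply Rle_trans; [exact Fin|]. right. rewrite Rmult_assoc, <- exp_plus. f_equal. f_equal. ring.
Qed.

Lemma cderiv_conj (f : C -> C) (z l : C) :
  cderiv f (Cconj z) l -> cderiv (fun w => Cconj (f (Cconj w))) z (Cconj l).
Proof.
  intros H. apply cderiv_intro. intros eps He.
  destruct (cderiv_elim _ _ _ H eps He) as [d [Hd Hw]]. exists d. split; auto.
  intros w Hwd. specialize (Hw (Cconj w)).
  assert (E : (Cconj w - Cconj z)%C = Cconj (w - z)) by (apply C_ext; simpl; ring).
  rewrite E, Cmod_conj in Hw. specialize (Hw Hwd).
  replace (Cconj (f (Cconj w)) - Cconj (f (Cconj z)) - Cconj l * (w - z))%C
    with (Cconj (f (Cconj w) - f (Cconj z) - l * Cconj (w - z))) by (apply C_ext; simpl; ring).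
  now rewrite Cmod_conj.
Qed.

(** The lower half plane follows by reflection: the conjugate of [G] at the conjugate point
    satisfies the same hypotheses, with the conjugate of [L]. *)
Lemma exp_type_tends (G : C -> C) (A s s' : R) (L : C) :
  (forall z, holo G z) -> 0 <= A -> 0 < s -> s < s' ->
  (forall z, Cmod (G z) <= A * exp (s * Cmod z)) ->
  tends (fun x => G (x, 0)) L ->
  forall eta, 0 < eta -> exists X0, forall X y, X0 <= X ->
    Cmod (G (X, y) - L) <= eta * exp (s' * Rabs y).
Proof.
  intros HG HA Hs Hs' Hgr HL eta Heta.
  destruct (exp_type_tends_upper G A s s' L HG HA Hs Hs' Hgr HL eta Heta) as [X1 H1].
  destruct (exp_type_tends_upper (fun w => Cconj (G (Cconj w))) A s s' (Cconj L)) with (eta := eta) as [X2 H2]; auto.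
  - intros z. destruct (HG (Cconj z)) as [l Hl]. eexists. apply cderiv_conj, Hl.
  - intros z. rewrite Cmod_conj. specialize (Hgr (Cconj z)). now rewrite Cmod_conj in Hgr.
  - intros e He. destruct (HL e He) as [X0 H0]. exists X0. intros x Hx. specialize (H0 x Hx).
    replace (Cconj (G (Cconj (x, 0))) - Cconj L)%C with (Cconj (G (x, 0) - L)).
    + now rewrite Cmod_conj.
    + replace (Cconj (x, 0)) with ((x, 0) : C) by (apply C_ext; simpl; ring).
      apply C_ext; simpl; ring.
  - exists (Rmax X1 X2). intros X y HX.
    pose proof (Rmax_l X1 X2). pose proof (Rmax_r X1 X2).
    destruct (Rle_dec 0 y) as [Hy|Hy].
    + rewrite Rabs_pos_eq by auto. apply H1; lra.
    + rewrite Rabs_left by lra. specialize (H2 X (- y) ltac:(lra) ltac:(lra)).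
      replace (Cconj (G (Cconj (X, (- y)%R))) - Cconj L)%C with (Cconj (G (X, y) - L)) in H2.
      * rewrite Cmod_conj in H2. exact H2.
      * replace (Cconj (X, (- y)%R)) with ((X, y) : C) by (apply C_ext; simpl; ring).
        apply C_ext; simpl; ring.
Qed.

Lemma rderiv_dominated (phi dphi : R -> C) (psi dpsi : R -> R) (a b : R) : a <= b ->
  (forall t, rderiv phi t (dphi t)) -> (forall t, rcont dphi t) ->
  (forall t, is_derive psi t (dpsi t)) -> (forall t, continuous dpsi t) ->
  (forall t, a <= t <= b -> Cmod (dphi t) <= dpsi t) ->
  Cmod (phi b - phi a) <= psi b - psi a.
Proof.
  intros Hab Hd Hc Hpsi Hpc Hle. rewrite <- norm_Cmod.
  apply (norm_RInt_le (V := C_R_NormedModule) dphi dpsi a b); auto.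
  - intros t Ht. rewrite norm_Cmod. auto.
  - apply (is_RInt_derive (V := C_R_CompleteNormedModule) phi dphi a b); intros; [apply Hd|apply Hc].
  - apply (is_RInt_derive (V := R_CompleteNormedModule) psi dpsi a b); intros; [apply Hpsi|apply Hpc].
Qed.

Lemma rcont_line (f : C -> C) (p v : C) (t : R) : gcont f -> rcont (fun s => f (p + RtoC s * v)%C) t.
Proof.
  intros H. apply (rcont_ccont f (fun s => p + RtoC s * v)%C); [|apply H].
  apply rcont_plus; [apply rcont_const|]. apply rcont_mult; [|apply rcont_const].
  apply (rcont_RtoC (fun s => s)). apply continuous_id.
Qed.

Lemma segment_bound (F f : C -> C) (p v : C) (M : R) :
  (forall z, cderiv F z (f z)) -> gcont f ->
  (forall t, 0 <= t <= 1 -> Cmod (f (p + RtoC t * v)%C) <= M) ->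
  Cmod (F (p + v)%C - F p) <= Cmod v * M.
Proof.
  intros HF Hc HM.
  assert (B : Cmod (F (p + RtoC 1 * v)%C - F (p + RtoC 0 * v)%C) <= (Cmod v * M) * 1 - (Cmod v * M) * 0).
  { apply (rderiv_dominated (fun t => F (p + RtoC t * v)%C) (fun t => v * f (p + RtoC t * v))%C
      (fun t => (Cmod v * M) * t) (fun _ => Cmod v * M) 0 1); try lra.
    - intros t. apply rderiv_line, HF.
    - intros t. apply rcont_mult; [apply rcont_const|now apply rcont_line].
    - intros t. auto_derive; auto. ring.
    - intros t. apply continuous_const.
    - intros t Ht. rewrite Cmod_mult. apply Rmult_le_compat_l; [apply Cmod_ge_0|auto]. }
  replace (p + RtoC 1 * v)%C with (p + v)%C in B by ring.
  replace (p + RtoC 0 * v)%C with p in B by ring. lra.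
Qed.

Lemma cderiv_zero_const (F : C -> C) : (forall z, cderiv F z 0) -> forall z, F z = F 0.
Proof.
  intros H z. assert (B : Cmod (F (0 + z)%C - F 0) <= Cmod z * 0).
  { apply (segment_bound F (fun _ => 0)); auto.
    - intros w; apply ccont_const.
    - intros; rewrite Cmod_0; lra. }
  replace (0 + z)%C with z in B by ring.
  assert (E : (F z - F 0)%C = 0%C) by (apply Cmod_eq_0; pose proof (Cmod_ge_0 (F z - F 0)); lra).
  replace (F z) with (F z - F 0 + F 0)%C by ring. rewrite E. ring.
Qed.

(** Integrating along a ray costs a factor [|z|], which is at most [e^((s' - s) |z|) / (s' - s)]. *)
Lemma primitive_growth (F f : C -> C) (A s s' : R) :
  (forall z, cderiv F z (f z)) -> (forall z, holo f z) -> F 0 = 0 -> 0 <= A -> 0 < s -> s < s' ->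
  (forall z, Cmod (f z) <= A * exp (s * Cmod z)) ->
  forall z, Cmod (F z) <= A / (s' - s) * exp (s' * Cmod z).
Proof.
  intros HF Hf F0 HA Hs Hs' Hg z.
  assert (B : Cmod (F (0 + z)%C - F 0) <= Cmod z * (A * exp (s * Cmod z))).
  { apply (segment_bound F f); auto.
    - intros w. now apply holo_ccont.
    - intros t Ht. eapply Rle_trans; [apply Hg|]. apply Rmult_le_compat_l; auto.
      apply exp_le, Rmult_le_compat_l; [lra|].
      replace (0 + RtoC t * z)%C with (RtoC t * z)%C by ring.
      rewrite Cmod_mult, Cmod_R, Rabs_pos_eq by lra.
      rewrite <- (Rmult_1_l (Cmod z)) at 2. apply Rmult_le_compat_r; [apply Cmod_ge_0|lra]. }
  rewrite F0 in B. replace (F (0 + z)%C - 0)%C with (F z) in B by (replace (0 + z)%C with z by ring; ring).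
  eapply Rle_trans; [exact B|].
  replace (s' * Cmod z) with ((s' - s) * Cmod z + s * Cmod z) by ring. rewrite exp_plus.
  replace (A / (s' - s) * (exp ((s' - s) * Cmod z) * exp (s * Cmod z)))
    with (exp ((s' - s) * Cmod z) / (s' - s) * (A * exp (s * Cmod z))) by (field; lra).
  apply Rmult_le_compat_r; [apply Rmult_le_pos; [auto|left; apply exp_pos]|].
  apply Rmult_le_reg_r with (s' - s); [lra|].
  replace (exp ((s' - s) * Cmod z) / (s' - s) * (s' - s)) with (exp ((s' - s) * Cmod z)) by (field; lra).
  pose proof (exp_ineq1_le ((s' - s) * Cmod z)). lra.
Qed.

Lemma exp_decay (B k : R) (eps : R) : 0 <= B -> 0 < k -> 0 < eps -> exists Y, 0 <= Y /\ B * exp (- (k * Y)) <= eps.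
Proof.
  intros HB Hk He. exists (B / (k * eps)).
  assert (0 < k * eps) by (now apply Rmult_lt_0_compat).
  split; [apply Rmult_le_pos; [auto|left; now apply Rinv_0_lt_compat]|].
  rewrite exp_Ropp. pose proof (exp_pos (k * (B / (k * eps)))).
  apply Rmult_le_reg_r with (exp (k * (B / (k * eps)))); auto.
  rewrite Rmult_assoc, Rinv_l by lra. rewrite Rmult_1_r.
  pose proof (exp_ineq1_le (k * (B / (k * eps)))).
  apply Rle_trans with (eps * (k * (B / (k * eps)))).
  - right. field. lra.
  - apply Rmult_le_compat_l; lra.
Qed.

Lemma vertical_side_bound (P p : C -> C) (X Y eta k : R) :
  (forall z, cderiv P z (p z)) -> gcont p -> 0 <= Y -> 0 < k -> 0 <= eta ->
  (forall y, 0 <= y -> Cmod (p (X, y)) <= eta * exp (- (k * y))) ->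
  Cmod (P (X, Y) - P (X, 0)) <= eta / k.
Proof.
  intros HP Hc HY Hk He Hp.
  eapply Rle_trans.
  - apply (rderiv_dominated (fun t => P (X, t)) (fun t => Ci * p (X, t))%C
      (fun t => - (eta / k) * exp (- (k * t))) (fun t => eta * exp (- (k * t))) 0 Y); auto.
    + intros t. apply rderiv_vertical, HP.
    + intros t. apply rcont_mult; [apply rcont_const|now apply gcont_vertical].
    + intros t. auto_derive; auto. field. lra.
    + intros t. apply (ex_derive_continuous (V := R_NormedModule)). auto_derive. auto.
    + intros t Ht. rewrite Cmod_rotate. apply Hp. lra.
  - replace (- (k * 0)) with 0 by ring. rewrite exp_0.
    assert (0 <= eta / k) by (apply Rmult_le_pos; [auto|left; now apply Rinv_0_lt_compat]).
    pose proof (exp_pos (- (k * Y))).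
    assert (0 <= eta / k * exp (- (k * Y))) by (apply Rmult_le_pos; lra). lra.
Qed.

(** * Vanishing of the cosine transform at frequencies beyond the type *)

Section FourierVanishing.
Variables (g G : C -> C) (A s w : R) (L : C).
Hypotheses (g_holo : forall z, holo g z) (g_even : forall z, g (- z)%C = g z)
  (A_ge0 : 0 <= A) (s_gt0 : 0 < s) (s_lt_w : s < w)
  (g_growth : forall z, Cmod (g z) <= A * exp (s * Cmod z))
  (G_deriv : forall z, cderiv G z (g z)) (G_0 : G 0 = 0)
  (G_tends : tends (fun x => G (x, 0)) L).

Let E (z : C) : C := cexp (Ci * RtoC w * z).

Lemma wave_cderiv (z : C) : cderiv E z (Ci * RtoC w * E z).
Proof.
  eapply cderiv_eq.
  - apply (cderiv_comp (fun z => Ci * RtoC w * z)%C cexp); [apply cderiv_scal, cderiv_id|apply cexp_cderiv].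
  - unfold E. ring.
Qed.

Lemma Cmod_wave (x y : R) : Cmod (E (x, y)) = exp (- (w * y)).
Proof. unfold E. rewrite Cmod_cexp. f_equal. simpl. ring. Qed.

Lemma G_odd (z : C) : G (- z)%C = (- G z)%C.
Proof.
  assert (H : (G z + G (- z))%C = 0%C).
  { transitivity (G 0 + G (- 0))%C.
    - apply (cderiv_zero_const (fun z => G z + G (- z))%C). intros u.
      eapply cderiv_eq.
      + apply cderiv_plus; [apply G_deriv|].
        apply (cderiv_comp Copp G); [apply cderiv_opp, cderiv_id|apply G_deriv].
      + rewrite g_even. apply C_ext; simpl; ring.
    - replace (- 0)%C with (RtoC 0) by ring. rewrite G_0. ring. }
  replace (G (- z)%C) with (G z + G (- z) - G z)%C by ring. rewrite H. ring.
Qed.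

(** As [(G E)' = g E + i w G E] and [G] is odd, the quantity is the integral of [g E] over
    [[-X, X]], integrated by parts. After moving the integral of [G E] upwards, [G - L] is small on
    the right side and [G + L] on the left one; the constants [L] and [-L] integrate explicitly
    against the wave. *)
Lemma wave_primitive_vanishes (P : C -> C) :
  (forall z, cderiv P z (G z * E z)%C) ->
  tends (fun x => (G (x, 0%R) * (E (x, 0%R) + E ((- x)%R, 0%R))
    - Ci * RtoC w * (P (x, 0%R) - P ((- x)%R, 0%R)))%C) 0.
Proof.
  intros HP eps Heps.
  (* Two intermediate rates: [s1] for the growth of the primitive [G], [s2] for its uniform approach
     to the limit. The decay of the wave leaves [k = w - s2] on the vertical sides and [w - s1] on
     the top. *)
  set (s1 := s + (w - s) / 3). set (s2 := s + 2 * (w - s) / 3).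
  assert (Gg := primitive_growth G g A s s1 G_deriv g_holo G_0 A_ge0 s_gt0 ltac:(unfold s1; lra) g_growth).
  set (A1 := A / (s1 - s)) in *.
  assert (HA1 : 0 <= A1).
  { apply Rmult_le_pos; auto. left. apply Rinv_0_lt_compat. unfold s1; lra. }
  assert (HG : forall z, holo G z) by (intros z; eexists; apply G_deriv).
  assert (HE : forall z, holo E z) by (intros z; eexists; apply wave_cderiv).
  set (k := w - s2). assert (Hk : 0 < k) by (unfold k, s2; lra).
  (* The boundary values cost [2 eta] and the two vertical sides [2 w eta / k], in all [eps / 2]. *)
  set (eta := eps / (2 * (2 + 2 * w / k))).
  assert (Hw : 0 < w) by lra.
  assert (Hwk : 0 < w / k) by (now apply Rdiv_lt_0_compat).
  assert (Heta : 0 < eta) by (apply Rdiv_lt_0_compat; lra).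
  destruct (exp_type_tends G A1 s1 s2 L HG HA1 ltac:(unfold s1; lra) ltac:(unfold s1, s2; lra) Gg G_tends eta Heta)
    as [X0 HX0].
  exists (Rmax 0 X0). intros X HX.
  assert (X1 : 0 <= X) by (eapply Rle_trans; [apply Rmax_l|exact HX]).
  assert (X2 : X0 <= X) by (eapply Rle_trans; [apply Rmax_r|exact HX]). clear HX.
  assert (iw : (Ci * RtoC w)%C <> 0%C).
  { apply Cmult_nz; [|apply RtoC_nz; lra]. apply Cmod_gt_0. rewrite Cmod_Ci. lra. }
  (* Subtracting a constant [c] from [G] only corrects the primitive by a multiple of the wave; the
     values used are [L] on the right and [- L] on the left. *)
  assert (HPM : forall c z, cderiv (fun z => P z - c * / (Ci * RtoC w) * E z)%C z ((G z - c) * E z)%C).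
  { intros c z. eapply cderiv_eq; [apply cderiv_minus; [apply HP|apply cderiv_scal, wave_cderiv]|].
    field. split; [apply RtoC_nz; lra|]. apply Cmod_gt_0. rewrite Cmod_Ci. lra. }
  assert (HcM : forall c, gcont (fun z => (G z - c) * E z)%C).
  { intros c z. apply holo_ccont, holo_mult; auto. apply holo_minus; [auto|apply holo_const]. }
  assert (Main : forall Y, 0 <= Y ->
    Cmod (G (X, 0%R) * (E (X, 0%R) + E ((- X)%R, 0%R)) - Ci * RtoC w * (P (X, 0%R) - P ((- X)%R, 0%R)))
    <= eps / 2 + (w * (2 * X * (A1 * exp (s1 * X))) * exp (- ((w - s1) * Y)) + 2 * Cmod L * exp (- (w * Y)))).
  { intros Y HY.
    set (r := (P (X, Y) - L * / (Ci * RtoC w) * E (X, Y) - (P (X, 0%R) - L * / (Ci * RtoC w) * E (X, 0%R)))%C).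
    assert (Br : Cmod r <= eta / k).
    { apply (vertical_side_bound (fun z => P z - L * / (Ci * RtoC w) * E z)%C _ X Y eta k (HPM L)); auto; try lra.
      intros y Hy. rewrite Cmod_mult, Cmod_wave. specialize (HX0 X y X2). rewrite Rabs_pos_eq in HX0 by auto.
      apply Rle_trans with (eta * exp (s2 * y) * exp (- (w * y))); [apply Rmult_le_compat_r; [left; apply exp_pos|auto]|].
      right. rewrite Rmult_assoc, <- exp_plus. f_equal. f_equal. unfold k. ring. }
    set (l := (P ((- X)%R, Y) - - L * / (Ci * RtoC w) * E ((- X)%R, Y) - (P ((- X)%R, 0%R) - - L * / (Ci * RtoC w) * E ((- X)%R, 0%R)))%C).
    assert (Bl : Cmod l <= eta / k).
    { apply (vertical_side_bound (fun z => P z - - L * / (Ci * RtoC w) * E z)%C _ (- X) Y eta k (HPM (- L)%C)); auto; try lra.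
      intros y Hy. rewrite Cmod_mult, Cmod_wave. specialize (HX0 X (- y) X2). rewrite Rabs_Ropp, Rabs_pos_eq in HX0 by auto.
      apply Rle_trans with (eta * exp (s2 * y) * exp (- (w * y))); [apply Rmult_le_compat_r; [left; apply exp_pos|]|].
      - replace (G ((- X)%R, y) - - L)%C with (- (G (X, (- y)%R) - L))%C; [now rewrite Cmod_opp|].
        replace ((- X, y) : C) with (- (X, (- y)%R))%C by (apply C_ext; simpl; ring).
        rewrite G_odd. ring.
      - right. rewrite Rmult_assoc, <- exp_plus. f_equal. f_equal. unfold k. ring. }
    set (tp := (P (X, Y) - P ((- X)%R, Y))%C).
    assert (Bt : Cmod tp <= 2 * X * (A1 * exp (s1 * X) * exp (- ((w - s1) * Y)))).
    { assert (B : Cmod (P (((- X)%R, Y) + RtoC (2 * X))%C - P ((- X)%R, Y))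
        <= Cmod (RtoC (2 * X)) * (A1 * exp (s1 * X) * exp (- ((w - s1) * Y)))).
      { apply (segment_bound P (fun z => G z * E z)%C); auto.
        - intros z. apply holo_ccont, holo_mult; auto.
        - intros t Ht.
          replace (((- X)%R, Y) + RtoC t * RtoC (2 * X))%C with ((- X + t * (2 * X), Y) : C) by (apply C_ext; simpl; ring).
          rewrite Cmod_mult, Cmod_wave.
          apply Rle_trans with (A1 * exp (s1 * (X + Y)) * exp (- (w * Y))).
          + apply Rmult_le_compat_r; [left; apply exp_pos|]. eapply Rle_trans; [apply Gg|].
            apply Rmult_le_compat_l; auto. apply exp_le, Rmult_le_compat_l; [unfold s1; lra|].
            eapply Rle_trans; [apply Cmod_le_abs|]. simpl. rewrite (Rabs_pos_eq Y) by auto.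
            apply Rplus_le_compat_r. apply Rabs_le. nra.
          + right. rewrite !Rmult_assoc, <- !exp_plus. f_equal. f_equal. ring. }
      replace (((- X)%R, Y) + RtoC (2 * X))%C with ((X, Y) : C) in B by (apply C_ext; simpl; ring).
      rewrite Cmod_R, Rabs_pos_eq in B by lra. exact B. }
    (* Path independence of [P] around the rectangle; the corrections by [L] replace [G] by [G - L]
       at the bottom corners and leave the wave at the top corners. *)
    replace (G (X, 0%R) * (E (X, 0%R) + E ((- X)%R, 0%R)) - Ci * RtoC w * (P (X, 0%R) - P ((- X)%R, 0%R)))%C
      with ((G (X, 0%R) - L) * (E (X, 0%R) + E ((- X)%R, 0%R)) + Ci * RtoC w * (r - l - tp)
            + L * (E (X, Y) + E ((- X)%R, Y)))%C.
    2:{ unfold r, l, tp. field. split; [apply RtoC_nz; lra|]. apply Cmod_gt_0. rewrite Cmod_Ci. lra. }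
    eapply Rle_trans; [apply Cmod_triangle|]. eapply Rle_trans; [apply Rplus_le_compat_r, Cmod_triangle|].
    rewrite !Cmod_mult.
    assert (C1 : Cmod (G (X, 0%R) - L) * Cmod (E (X, 0%R) + E ((- X)%R, 0%R)) <= eta * 2).
    { apply Rmult_le_compat; auto using Cmod_ge_0.
      - specialize (HX0 X 0 X2). rewrite Rabs_R0, Rmult_0_r, exp_0 in HX0. lra.
      - eapply Rle_trans; [apply Cmod_triangle|]. rewrite !Cmod_wave.
        replace (- (w * 0)) with 0 by ring. rewrite exp_0. lra. }
    assert (C2 : Cmod Ci * Cmod (RtoC w) * Cmod (r - l - tp) <=
       w * (eta / k + eta / k + 2 * X * (A1 * exp (s1 * X) * exp (- ((w - s1) * Y))))).
    { rewrite Cmod_Ci, Rmult_1_l, Cmod_R, Rabs_pos_eq by lra. apply Rmult_le_compat_l; [lra|].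
      pose proof (Cmod_sub_le (r - l) tp). pose proof (Cmod_sub_le r l). lra. }
    assert (C3 : Cmod L * Cmod (E (X, Y) + E ((- X)%R, Y)) <= Cmod L * (2 * exp (- (w * Y)))).
    { apply Rmult_le_compat_l; [apply Cmod_ge_0|]. eapply Rle_trans; [apply Cmod_triangle|].
      rewrite !Cmod_wave. lra. }
    assert (Ee : eta * 2 + w * (eta / k + eta / k) = eps / 2).
    { unfold eta. field. assert (0 < 2 * k + 2 * w) by lra. lra. }
    lra. }
  replace (G (X, 0%R) * (E (X, 0%R) + E ((- X)%R, 0%R)) - Ci * RtoC w * (P (X, 0%R) - P ((- X)%R, 0%R)) - 0)%C
    with (G (X, 0%R) * (E (X, 0%R) + E ((- X)%R, 0%R)) - Ci * RtoC w * (P (X, 0%R) - P ((- X)%R, 0%R)))%C by ring.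
  assert (B1 : 0 <= w * (2 * X * (A1 * exp (s1 * X)))).
  { apply Rmult_le_pos; [lra|]. apply Rmult_le_pos; [lra|]. apply Rmult_le_pos; [auto|left; apply exp_pos]. }
  assert (B2 : 0 <= 2 * Cmod L) by (pose proof (Cmod_ge_0 L); lra).
  (* Since [X] is fixed by now, [Y] may depend on it, which compensates the factor
     [exp (s1 * X)]. *)
  destruct (exp_decay (w * (2 * X * (A1 * exp (s1 * X))) + 2 * Cmod L) (w - s1) (eps / 2)) as [Y [HY HB]];
    [lra|unfold s1; lra|lra|].
  eapply Rle_trans; [apply (Main Y HY)|].
  assert (2 * Cmod L * exp (- (w * Y)) <= 2 * Cmod L * exp (- ((w - s1) * Y))).
  { apply Rmult_le_compat_l; auto. apply exp_le. apply Ropp_le_contravar.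
    apply Rmult_le_compat_r; [auto|unfold s1; lra]. }
  lra.
Qed.

Lemma wave_cos (x : R) : (E (x, 0%R) + E ((- x)%R, 0%R))%C = RtoC (2 * cos (w * x)).
Proof.
  unfold E, cexp. simpl.
  replace ((0 * w - 1 * 0) * x - (0 * 0 + 1 * w) * 0) with 0 by ring.
  replace ((0 * w - 1 * 0) * - x - (0 * 0 + 1 * w) * 0) with 0 by ring.
  replace ((0 * w - 1 * 0) * 0 + (0 * 0 + 1 * w) * x) with (w * x) by ring.
  replace ((0 * w - 1 * 0) * 0 + (0 * 0 + 1 * w) * - x) with (- (w * x)) by ring.
  rewrite cos_neg, sin_neg, exp_0. apply C_ext; simpl; ring.
Qed.

(** [Q] is a primitive of [g E] obtained by parts. Its odd part [S] has derivative [g z cos (w z)]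
    because [g] is even, vanishes at 0, and on the real axis is half of the quantity in
    [wave_primitive_vanishes]. *)
Lemma fourier_cosine_vanishes : exists D : R -> C, D 0 = 0 /\
  (forall x, rderiv D x (g (RtoC x) * RtoC (cos (w * x)))%C) /\ tends D 0.
Proof.
  assert (HG : forall z, holo G z) by (intros z; eexists; apply G_deriv).
  assert (HE : forall z, holo E z) by (intros z; eexists; apply wave_cderiv).
  destruct (exists_primitive (fun z => G z * E z)%C) as [P HP]; [intros z; now apply holo_mult|].
  set (Q := fun z => (G z * E z - Ci * RtoC w * P z)%C).
  assert (HQ : forall z, cderiv Q z (g z * E z)%C).
  { intros z. unfold Q. eapply cderiv_eq.
    - apply cderiv_minus; [apply cderiv_mult; [apply G_deriv|apply wave_cderiv]|apply cderiv_scal, HP].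
    - cbv beta. ring. }
  set (S := fun z => ((Q z - Q (- z)) * / 2)%C).
  assert (HS : forall z, cderiv S z ((g z * E z + g z * E (- z)) * / 2)%C).
  { intros z. unfold S. eapply cderiv_eq.
    - apply cderiv_mult; [|apply cderiv_const]. apply cderiv_minus; [apply HQ|].
      apply (cderiv_comp Copp Q); [apply cderiv_opp, cderiv_id|apply HQ].
    - cbv beta. rewrite g_even. ring. }
  exists (fun x => S (x, 0)). split; [|split].
  - unfold S. replace (- (0%R, 0%R))%C with ((0, 0) : C) by (apply C_ext; simpl; ring). ring.
  - intros x. eapply eq_rect; [apply rderiv_horizontal, HS|].
    replace (- (x, 0%R))%C with ((- x, 0) : C) by (apply C_ext; simpl; ring).
    change (x, 0) with (RtoC x) at 1 3.
    replace (g (RtoC x) * E (x, 0%R) + g (RtoC x) * E ((- x)%R, 0%R))%C with (g (RtoC x) * (E (x, 0%R) + E ((- x)%R, 0%R)))%C by ring.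
    rewrite wave_cos, RtoC_mult. field.
  - intros e He. destruct (wave_primitive_vanishes P HP e He) as [X0 HX0].
    exists X0. intros x Hx. specialize (HX0 x Hx).
    replace (S (x, 0%R) - 0)%C with ((G (x, 0%R) * (E (x, 0%R) + E ((- x)%R, 0%R)) - Ci * RtoC w * (P (x, 0%R) - P ((- x)%R, 0%R)) - 0) * / 2)%C.
    + rewrite Cmod_mult. replace (Cmod (/ 2)) with (/ 2).
      * pose proof (Cmod_ge_0 (G (x, 0%R) * (E (x, 0%R) + E ((- x)%R, 0%R)) - Ci * RtoC w * (P (x, 0%R) - P ((- x)%R, 0%R)) - 0)). lra.
      * rewrite <- RtoC_inv, Cmod_R, Rabs_pos_eq; lra.
    + unfold S, Q. replace (- (x, 0%R))%C with ((- x, 0) : C) by (apply C_ext; simpl; ring).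
      replace (G (- x, 0)) with (- G (x, 0%R))%C by (rewrite <- G_odd; f_equal; apply C_ext; simpl; ring). ring.
Qed.

End FourierVanishing.

(** * Taylor expansion of even functions of exponential type *)

Definition csum (u : nat -> C) (n : nat) : C := sum_n (G := C_AbelianMonoid) u n.

Lemma csum_S (u : nat -> C) (n : nat) : csum u (S n) = (csum u n + u (S n))%C.
Proof. exact (sum_Sn (G := C_AbelianMonoid) u n). Qed.

Lemma csum_O (u : nat -> C) : csum u 0 = u 0%nat.
Proof. exact (sum_O (G := C_AbelianMonoid) u). Qed.

Lemma csum_ext (u v : nat -> C) (n : nat) : (forall k, (k <= n)%nat -> u k = v k) -> csum u n = csum v n.
Proof. exact (sum_n_ext_loc (G := C_AbelianMonoid) u v n). Qed.

Lemma csum_scal (c : C) (u : nat -> C) (n : nat) : csum (fun k => c * u k)%C n = (c * csum u n)%C.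
Proof. induction n as [|n IH]; [now rewrite !csum_O|]. rewrite !csum_S, IH. ring. Qed.

Lemma csum_even_odd (u : nat -> C) (n : nat) :
  csum u (2 * n + 1) = csum (fun j => u (2 * j)%nat + u (2 * j + 1)%nat)%C n.
Proof.
  induction n as [|n IH].
  - rewrite csum_O. change (2 * 0 + 1)%nat with 1%nat. rewrite csum_S, csum_O. reflexivity.
  - replace (2 * S n + 1)%nat with (S (S (2 * n + 1))) by lia.
    rewrite !csum_S, IH.
    replace (S (2 * n + 1)) with (2 * S n)%nat by lia.
    replace (S (2 * S n)) with (2 * S n + 1)%nat by lia. ring.
Qed.

Lemma C_derive_n_even (f : C -> C) (n : nat) : (forall z, holo f z) ->
  (forall z, f (- z)%C = f z) -> forall z, C_derive_n f n (- z)%C = (RtoC ((-1) ^ n) * C_derive_n f n z)%C.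
Proof.
  intros Hf He. induction n as [|n IH]; intros z.
  - simpl. rewrite He. ring.
  - set (h := C_derive_n f n) in *.
    assert (Hh : forall z, holo h z) by (apply C_derive_n_holo; auto).
    change (C_derive h (- z)%C = (RtoC ((-1) ^ S n) * C_derive h z)%C).
    assert (D : C_derive (fun w => RtoC ((-1) ^ n) * h (- w))%C (- z) = C_derive h (- z)).
    { apply C_derive_ext. intros w. rewrite IH, Cmult_assoc, <- RtoC_mult, <- Rpow_mult_distr.
      replace (-1 * -1) with 1 by ring. rewrite pow1. ring. }
    rewrite <- D. apply cderiv_C_derive. eapply cderiv_eq.
    + apply cderiv_scal. apply (cderiv_comp Copp h); [apply cderiv_opp, cderiv_id|].
      replace (- - z)%C with z by ring. apply holo_C_derive, Hh.
    + apply C_ext; simpl; ring.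
Qed.

Lemma C_derive_n_even_odd_0 (f : C -> C) (j : nat) : (forall z, holo f z) ->
  (forall z, f (- z)%C = f z) -> C_derive_n f (2 * j + 1) 0 = 0.
Proof.
  intros Hf He. pose proof (C_derive_n_even f (2 * j + 1) Hf He 0) as H.
  replace (- 0)%C with (RtoC 0) in H by ring.
  rewrite pow_add, pow_1, pow_1_even in H.
  set (c := C_derive_n f (2 * j + 1) 0) in *.
  replace (RtoC (1 * -1)) with (- (1))%C in H by (apply C_ext; simpl; ring).
  assert (E : (2 * c)%C = 0%C).
  { replace (2 * c)%C with (c + c)%C by (apply C_ext; simpl; ring). rewrite H at 1. ring. }
  replace c with (/ 2 * (2 * c))%C by field. rewrite E. ring.
Qed.

Definition taylor_coef (f : C -> C) (j : nat) : C := (C_derive_n f (2 * j) 0 / RtoC (INR (fact (2 * j))))%C.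

Lemma even_taylor (f : C -> C) (n : nat) : (forall z, holo f z) -> (forall z, f (- z)%C = f z) ->
  exists g, (forall z, holo g z) /\ (forall z, g (- z)%C = g z) /\ forall z,
    f z = (csum (fun j => taylor_coef f j * z ^ (2 * j))%C n + z ^ (2 * S n) * g z)%C.
Proof.
  (* The expansion goes to the odd degree [2n + 1], whose coefficient vanishes, so that the
     remainder carries [z^(2n+2)]. *)
  intros Hf He. destruct (taylor_remainder f (2 * n + 1) Hf) as [g [Hg E]].
  assert (E' : forall z, f z = (csum (fun j => taylor_coef f j * z ^ (2 * j))%C n + z ^ (2 * S n) * g z)%C).
  { intros z. rewrite (E z), csum_even_odd.
    replace (S (2 * n + 1)) with (2 * S n)%nat by lia. f_equal.
    apply csum_ext. intros j _. rewrite C_derive_n_even_odd_0 by auto. unfold taylor_coef, Cdiv. ring. }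
  exists g. split; auto. split; auto.
  intros z. destruct (Ceq_dec z 0) as [->|N]; [f_equal; ring|].
  assert (Ev : forall k w, ((- w) ^ (2 * k))%C = (w ^ (2 * k))%C).
  { intros k w. rewrite !Cpow_mult_r. f_equal. simpl. ring. }
  pose proof (E' z) as H1. pose proof (E' (- z)%C) as H2. rewrite He, H1, Ev in H2.
  rewrite (csum_ext (fun j => taylor_coef f j * (- z) ^ (2 * j))%C (fun j => taylor_coef f j * z ^ (2 * j))%C) in H2
    by (intros; now rewrite Ev).
  assert (Nz : (z ^ (2 * S n))%C <> 0%C) by (apply Cpow_nz; auto).
  set (S' := csum (fun j => taylor_coef f j * z ^ (2 * j))%C n) in *.
  set (Z := (z ^ (2 * S n))%C) in *.
  replace (g (- z)%C) with ((S' + Z * g (- z) - S') / Z)%C by (field; auto).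
  rewrite <- H2. field. auto.
Qed.

Lemma csum_pow_bound (a : nat -> C) (n N : nat) : (2 * n <= N)%nat ->
  exists S0, 0 <= S0 /\ forall z, 1 <= Cmod z ->
    Cmod (csum (fun j => a j * z ^ (2 * j))%C n) <= S0 * Cmod z ^ N.
Proof.
  induction n as [|n IH]; intros HN.
  - exists (Cmod (a 0%nat)). split; [apply Cmod_ge_0|]. intros z Hz. rewrite csum_O, Cmod_mult, Cmod_pow.
    apply Rmult_le_compat_l; [apply Cmod_ge_0|]. apply Rle_pow; auto.
  - destruct IH as [S0 [HS H]]; [lia|]. exists (S0 + Cmod (a (S n))).
    split; [pose proof (Cmod_ge_0 (a (S n))); lra|]. intros z Hz. rewrite csum_S.
    eapply Rle_trans; [apply Cmod_triangle|]. rewrite Rmult_plus_distr_r. apply Rplus_le_compat; auto.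
    rewrite Cmod_mult, Cmod_pow. apply Rmult_le_compat_l; [apply Cmod_ge_0|]. apply Rle_pow; auto.
Qed.

(** Away from 0 the bound on [f] is divided by [z^(2n+2)]. Inside a square of half side [r0] the
    maximum principle takes over; on its boundary [r0 <= |w| <= 2 r0], hence the constant [A]. *)
Lemma even_taylor_growth (f g : C -> C) (a : nat -> C) (n : nat) (tau s : R) :
  (forall z, holo g z) -> exponential_type f tau -> 0 < tau -> tau < s ->
  (forall z, f z = (csum (fun j => a j * z ^ (2 * j))%C n + z ^ (2 * S n) * g z)%C) ->
  exists A, 0 <= A /\ forall z, Cmod (g z) <= A * exp (s * Cmod z).
Proof.
  intros Hg Hf Htau Hs E.
  destruct (csum_pow_bound a n (2 * S n)) as [S0 [HS0 HS]]; [lia|].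
  destruct (Hf (s - tau)) as [r Hr]; [lra|]. replace (tau + (s - tau)) with s in Hr by ring.
  set (r0 := Rmax 1 r). assert (R1 : 1 <= r0) by apply Rmax_l. assert (R2 : r <= r0) by apply Rmax_r.
  assert (Far : forall z, r0 <= Cmod z -> Cmod (g z) <= (1 + S0) * exp (s * Cmod z)).
  { intros z Hz. specialize (HS z ltac:(lra)). specialize (Hr z ltac:(lra)).
    assert (HN : 1 <= Cmod z ^ (2 * S n)) by (apply pow_R1_Rle; lra).
    set (N := (2 * S n)%nat) in *.
    assert (B : Cmod z ^ N * Cmod (g z) <= exp (s * Cmod z) + S0 * Cmod z ^ N).
    { rewrite <- Cmod_pow, <- Cmod_mult.
      replace (z ^ N * g z)%C with (f z - csum (fun j => a j * z ^ (2 * j))%C n)%C by (rewrite (E z); fold N; ring).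
      eapply Rle_trans; [apply Cmod_sub_le|]. rewrite Cmod_pow. lra. }
    assert (He : 1 <= exp (s * Cmod z)) by (apply exp_ge_1, Rmult_le_pos; lra).
    apply Rmult_le_reg_l with (Cmod z ^ N); [lra|]. eapply Rle_trans; [exact B|].
    rewrite Rmult_plus_distr_r, Rmult_plus_distr_l. apply Rplus_le_compat.
    - rewrite Rmult_1_l. rewrite <- (Rmult_1_l (exp _)) at 1. apply Rmult_le_compat_r; lra.
    - rewrite (Rmult_comm (Cmod z ^ N)). apply Rmult_le_compat_r; [lra|].
      rewrite <- (Rmult_1_r S0) at 1. apply Rmult_le_compat_l; lra. }
  set (A := (1 + S0) * exp (s * (2 * r0))).
  assert (He : 1 <= exp (s * (2 * r0))) by (apply exp_ge_1, Rmult_le_pos; lra).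
  assert (HA : 1 + S0 <= A) by (unfold A; rewrite <- (Rmult_1_r (1 + S0)) at 1; apply Rmult_le_compat_l; lra).
  exists A. split; [lra|]. intros z.
  assert (Hez : 1 <= exp (s * Cmod z)) by (apply exp_ge_1, Rmult_le_pos; [lra|apply Cmod_ge_0]).
  destruct (Rle_dec r0 (Cmod z)) as [Hz|Hz].
  - eapply Rle_trans; [now apply Far|]. apply Rmult_le_compat_r; lra.
  - apply Rle_trans with (A * 1); [rewrite Rmult_1_r|apply Rmult_le_compat_l; lra].
    apply (maximum_modulus g (- r0) r0 (- r0) r0 A z); auto; try lra.
    + pose proof (fst_le_Cmod z). pose proof (snd_le_Cmod z).
      unfold inside. split; apply Rabs_lt_between; lra.
    + intros p u v t Hp Ht. destruct Hp as (_ & _ & Hp). destruct (Hp t Ht) as (H1 & H2 & H3).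
      set (w := p t) in *.
      assert (W1 : r0 <= Cmod w).
      { pose proof (fst_le_Cmod w). pose proof (snd_le_Cmod w).
        destruct H3 as [H3|[H3|[H3|H3]]]; rewrite H3 in *; rewrite ?Rabs_Ropp, (Rabs_pos_eq r0) in * by lra; lra. }
      assert (W2 : Cmod w <= 2 * r0).
      { eapply Rle_trans; [apply Cmod_le_abs|].
        assert (Rabs (fst w) <= r0) by (apply Rabs_le; lra).
        assert (Rabs (snd w) <= r0) by (apply Rabs_le; lra). lra. }
      eapply Rle_trans; [now apply Far|]. unfold A. apply Rmult_le_compat_l; [lra|].
      apply exp_le, Rmult_le_compat_l; lra.
Qed.

(** * Improper integrals and uniqueness of the finite part *)

Definition tends0 (G : R -> C) (L : C) : Prop :=
  forall eta, 0 < eta -> exists d, 0 < d /\ forall x, 0 < x < d -> Cmod (G x - L) <= eta.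

Lemma Cball_intro (z w : C) (e : R) : Cmod (w - z) < e -> ball (M := C_UniformSpace) z e w.
Proof.
  intros H. split.
  - eapply Rle_lt_trans; [apply (fst_le_Cmod (w - z)%C)|exact H].
  - eapply Rle_lt_trans; [apply (snd_le_Cmod (w - z)%C)|exact H].
Qed.

Lemma Cball_elim (z w : C) (e : R) : ball (M := C_UniformSpace) z e w -> Cmod (w - z) < 2 * e.
Proof.
  intros [H1 H2]. change (Rabs (fst w - fst z) < e) in H1. change (Rabs (snd w - snd z) < e) in H2.
  eapply Rle_lt_trans; [apply Cmod_le_abs|].
  change (Rabs (fst w - fst z) + Rabs (snd w - snd z) < 2 * e). lra.
Qed.

Lemma filterlim_tends0 (G : R -> C) (L : C) :
  filterlim G (at_right 0) (locally (T := C_UniformSpace) L) <-> tends0 G L.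
Proof.
  split.
  - intros H eta He. assert (He' : 0 < eta / 2) by lra.
    destruct (H (ball (M := C_UniformSpace) L (mkposreal _ He'))) as [d Hd].
    { now exists (mkposreal _ He'). }
    exists d. split; [apply cond_pos|]. intros x Hx.
    assert (B : ball (M := C_UniformSpace) L (eta / 2) (G x)).
    { apply Hd; [|apply Hx]. change (Rabs (x - 0) < d). rewrite Rminus_0_r, Rabs_pos_eq; lra. }
    apply Cball_elim in B. lra.
  - intros H P [e He]. assert (He2 : 0 < e / 2) by (pose proof (cond_pos e); lra).
    destruct (H (e / 2) He2) as [d [Hd Hx]]. exists (mkposreal d Hd). intros x Hxd Hx0.
    change (Rabs (x - 0) < d) in Hxd. rewrite Rminus_0_r, Rabs_pos_eq in Hxd by lra.
    apply He, Cball_intro. specialize (Hx x ltac:(lra)). lra.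
Qed.

Section ImproperIntegral.
Variables (g U : R -> C).
Hypotheses (U_deriv : forall x, 0 < x -> rderiv U x (g x)) (g_cont : forall x, 0 < x -> rcont g x).

Lemma is_RInt_of_primitive (a b : R) : 0 < a -> 0 < b ->
  is_RInt (V := C_R_NormedModule) g a b (U b - U a)%C.
Proof.
  intros Ha Hb. apply (is_RInt_derive (V := C_R_CompleteNormedModule) U g a b).
  - intros x Hx. apply U_deriv. eapply Rlt_le_trans; [|apply Hx]. now apply Rmin_glb_lt.
  - intros x Hx. apply g_cont. eapply Rlt_le_trans; [|apply Hx]. now apply Rmin_glb_lt.
Qed.

Lemma tail_integral_of_primitive (eps : R) (L : C) : 0 < eps -> tends U L ->
  is_tail_integral g eps (L - U eps)%C.
Proof.
  intros He HL P [e HP].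
  assert (He2 : 0 < e / 2) by (pose proof (cond_pos e); lra).
  destruct (HL _ He2) as [X0 HX0].
  apply (Filter_prod _ _ _ (fun a => a = eps) (fun b => Rmax X0 eps < b)).
  - reflexivity.
  - exists (Rmax X0 eps). auto.
  - intros a b -> Hb. simpl. exists (U b - U eps)%C.
    pose proof (Rmax_l X0 eps). pose proof (Rmax_r X0 eps).
    split; [apply is_RInt_of_primitive; lra|]. apply HP, Cball_intro.
    replace (U b - U eps - (L - U eps))%C with (U b - L)%C by ring.
    specialize (HX0 b ltac:(lra)). lra.
Qed.

Lemma integral_0_infty_of_primitive (L0 L : C) : tends0 U L0 -> tends U L ->
  is_integral_0_infty g (L - L0)%C.
Proof.
  intros H0 HL P [e HP].
  assert (He2 : 0 < e / 3) by (pose proof (cond_pos e); lra).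
  destruct (HL _ He2) as [X0 HX0]. destruct (H0 _ He2) as [d [Hd Hd0]].
  apply (Filter_prod _ _ _ (fun a => 0 < a < d) (fun b => Rmax X0 0 < b)).
  - exists (mkposreal d Hd). intros x Hx Hx0. change (Rabs (x - 0) < d) in Hx.
    rewrite Rminus_0_r, Rabs_pos_eq in Hx; lra.
  - exists (Rmax X0 0). auto.
  - intros a b Ha Hb. simpl. exists (U b - U a)%C.
    pose proof (Rmax_l X0 0). pose proof (Rmax_r X0 0).
    split; [apply is_RInt_of_primitive; lra|]. apply HP, Cball_intro.
    replace (U b - U a - (L - L0))%C with ((U b - L) - (U a - L0))%C by ring.
    specialize (HX0 b ltac:(lra)). specialize (Hd0 a Ha).
    eapply Rle_lt_trans; [apply Cmod_sub_le|]. lra.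
Qed.

(** Convergence of a tail becomes a limit of the primitive: the values that the filter supplies over
    [[eps, b]] are [U b - U eps] by uniqueness of the integral. *)
Lemma tail_integral_tends (eps : R) (v : C) : 0 < eps -> is_tail_integral g eps v ->
  tends U (v + U eps)%C.
Proof.
  intros He H eta Heta. assert (Heta' : 0 < eta / 2) by lra.
  destruct (H (ball (M := C_UniformSpace) v (mkposreal _ Heta'))) as [Q R HQ [X0 HR] HQR].
  { now exists (mkposreal _ Heta'). }
  exists (Rmax (X0 + 1) eps). intros b Hb.
  pose proof (Rmax_l (X0 + 1) eps). pose proof (Rmax_r (X0 + 1) eps).
  destruct (HQR eps b HQ (HR b ltac:(lra))) as [y [Hy By]]. simpl in Hy.
  assert (E : y = (U b - U eps)%C).
  { rewrite <- (CI_unique _ _ _ _ Hy). apply CI_unique. apply is_RInt_of_primitive; lra. }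
  apply Cball_elim in By. simpl in By. subst y.
  replace (U b - (v + U eps))%C with (U b - U eps - v)%C by ring. lra.
Qed.

Lemma tends_unique (L L' : C) : tends U L -> tends U L' -> L = L'.
Proof.
  intros H H'. assert (E : Cmod (L - L') = 0).
  { apply Rle_antisym; [|apply Cmod_ge_0]. apply le_epsilon. intros e He.
    destruct (H (e / 2)) as [X HX]; [lra|]. destruct (H' (e / 2)) as [X' HX']; [lra|].
    specialize (HX (Rmax X X') (Rmax_l _ _)). specialize (HX' (Rmax X X') (Rmax_r _ _)).
    replace (L - L')%C with ((U (Rmax X X') - L') - (U (Rmax X X') - L))%C by ring.
    eapply Rle_trans; [apply Cmod_sub_le|]. lra. }
  apply Cmod_eq_0 in E. replace L with (L - L' + L')%C by ring. rewrite E. ring.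
Qed.

Lemma tail_integral_value (eps : R) (v L : C) : 0 < eps -> tends U L ->
  is_tail_integral g eps v -> v = (L - U eps)%C.
Proof.
  intros He HL Hv. rewrite (tends_unique L _ HL (tail_integral_tends eps v He Hv)). ring.
Qed.

End ImproperIntegral.

(** * Comparison of monomials near zero and uniqueness of divergent parts *)

Definition monomial (t : asym_term) (eps : R) : R := Rpower eps (- expo t) * ln eps ^ logp t.

(** The order of growth at [0+], which is lexicographic because any power of [eps] dominates every
    power of its logarithm. *)
Definition smaller (t' t : asym_term) : Prop :=
  expo t' < expo t \/ (expo t' = expo t /\ (logp t' < logp t)%nat).

(** Raising [1 + x <= e^x], at [x = beta l / (n+1)], to the power [n + 1] gives
    [c l^(n+1) <= e^(beta l)]; the extra factor [l] pays for [eta]. *)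
Lemma pow_le_exp (n : nat) (beta eta : R) : 0 < beta -> 0 < eta ->
  exists X, forall l, X <= l -> l ^ n <= eta * exp (beta * l).
Proof.
  intros Hb He. set (c := (beta / INR (S n)) ^ S n).
  assert (HS : 0 < INR (S n)) by (apply lt_0_INR; lia).
  assert (Hc : 0 < c) by (apply pow_lt, Rdiv_lt_0_compat; auto).
  exists (Rmax 1 (/ (c * eta))). intros l Hl.
  assert (L1 : 1 <= l) by (eapply Rle_trans; [apply Rmax_l|exact Hl]).
  assert (L2 : / (c * eta) <= l) by (eapply Rle_trans; [apply Rmax_r|exact Hl]).
  assert (Hce : 0 < c * eta) by (now apply Rmult_lt_0_compat).
  assert (E : c * l ^ S n <= exp (beta * l)).
  { unfold c. rewrite <- Rpow_mult_distr.
    replace (exp (beta * l)) with (exp (beta / INR (S n) * l) ^ S n).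
    - apply pow_incr. split; [apply Rmult_le_pos; [left; now apply Rdiv_lt_0_compat|lra]|].
      pose proof (exp_ineq1_le (beta / INR (S n) * l)). lra.
    - rewrite <- Rpower_pow by apply exp_pos. unfold Rpower. rewrite ln_exp. f_equal. field. lra. }
  assert (P : 0 <= l ^ n) by (apply pow_le; lra).
  apply Rle_trans with (eta * (c * l ^ S n)); [|apply Rmult_le_compat_l; lra].
  simpl. replace (eta * (c * (l * l ^ n))) with ((c * eta * l) * l ^ n) by ring.
  rewrite <- (Rmult_1_l (l ^ n)) at 1. apply Rmult_le_compat_r; auto.
  replace 1 with (c * eta * / (c * eta)) by (field; lra). apply Rmult_le_compat_l; lra.
Qed.

(** In the variable [l = - ln eps] the comparison near 0 becomes one between exponentials and powers
    at infinity. *)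
Lemma Rabs_monomial (t : asym_term) (eps : R) : 0 < eps -> ln eps < 0 ->
  Rabs (monomial t eps) = exp (expo t * - ln eps) * (- ln eps) ^ logp t.
Proof.
  intros He Hl. unfold monomial, Rpower. rewrite Rabs_mult, <- RPow_abs, (Rabs_left (ln eps)) by auto.
  rewrite Rabs_pos_eq by (left; apply exp_pos). f_equal. f_equal. ring.
Qed.

Lemma smaller_dominated (t' t : asym_term) (eta : R) : smaller t' t -> 0 < eta ->
  exists X, forall eps, 0 < eps -> ln eps <= - X ->
    Rabs (monomial t' eps) <= eta * Rabs (monomial t eps) /\ 0 < Rabs (monomial t eps).
Proof.
  intros Ht He. 
  assert (K : exists X, 1 <= X /\ forall l, X <= l ->
    exp (expo t' * l) * l ^ logp t' <= eta * (exp (expo t * l) * l ^ logp t)).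
  { destruct Ht as [Ht|[Ht Hk]].
    - destruct (pow_le_exp (logp t') (expo t - expo t') eta) as [X HX]; [lra|auto|].
      exists (Rmax 1 X). split; [apply Rmax_l|]. intros l Hl.
      assert (L1 : 1 <= l) by (eapply Rle_trans; [apply Rmax_l|exact Hl]).
      specialize (HX l ltac:(eapply Rle_trans; [apply Rmax_r|exact Hl])).
      assert (P1 : 1 <= l ^ logp t) by (now apply pow_R1_Rle).
      apply Rle_trans with (exp (expo t' * l) * (eta * exp ((expo t - expo t') * l))).
      + apply Rmult_le_compat_l; [left; apply exp_pos|auto].
      + replace (exp (expo t' * l) * (eta * exp ((expo t - expo t') * l))) with (eta * exp (expo t * l)).
        * apply Rmult_le_compat_l; [lra|]. rewrite <- (Rmult_1_r (exp _)) at 1.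
          apply Rmult_le_compat_l; [left; apply exp_pos|auto].
        * replace (expo t * l) with (expo t' * l + (expo t - expo t') * l) by ring. rewrite exp_plus. ring.
    - exists (Rmax 1 (/ eta)). split; [apply Rmax_l|]. intros l Hl.
      assert (L1 : 1 <= l) by (eapply Rle_trans; [apply Rmax_l|exact Hl]).
      assert (L2 : / eta <= l) by (eapply Rle_trans; [apply Rmax_r|exact Hl]).
      rewrite Ht.
      replace (eta * (exp (expo t * l) * l ^ logp t)) with (exp (expo t * l) * (eta * l ^ logp t)) by ring.
      apply Rmult_le_compat_l; [left; apply exp_pos|].
      apply Rle_trans with (eta * l ^ S (logp t')).
      + simpl. rewrite <- Rmult_assoc. rewrite <- (Rmult_1_l (l ^ logp t')) at 1.
        apply Rmult_le_compat_r; [apply pow_le; lra|].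
        replace 1 with (eta * / eta) by (field; lra). apply Rmult_le_compat_l; lra.
      + apply Rmult_le_compat_l; [lra|]. apply Rle_pow; [auto|lia]. }
  destruct K as [X [HX1 HX]]. exists X. intros eps Hp Hl.
  rewrite !Rabs_monomial by lra. split; [apply HX; lra|].
  apply Rmult_lt_0_compat; [apply exp_pos|apply pow_lt; lra].
Qed.

Lemma term_val_monomial (t : asym_term) (eps : R) : term_val t eps = (coef t * RtoC (monomial t eps))%C.
Proof. reflexivity. Qed.

Lemma terms_val_cons (t : asym_term) (ts : list asym_term) (eps : R) :
  terms_val (t :: ts) eps = (term_val t eps + terms_val ts eps)%C.
Proof. reflexivity. Qed.

Lemma terms_val_app (ts us : list asym_term) (eps : R) :
  terms_val (ts ++ us) eps = (terms_val ts eps + terms_val us eps)%C.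
Proof.
  induction ts as [|t ts IH].
  - simpl. change (terms_val nil eps) with (RtoC 0). ring.
  - simpl app. rewrite !terms_val_cons, IH. ring.
Qed.

Lemma terms_dominated (t : asym_term) (ts : list asym_term) (eta : R) :
  List.Forall (fun t' => smaller t' t) ts -> 0 < eta ->
  exists X, forall eps, 0 < eps -> ln eps <= - X ->
    Cmod (terms_val ts eps) <= eta * Rabs (monomial t eps).
Proof.
  intros H. revert eta. induction H as [|t' ts Ht' _ IH]; intros eta He.
  - exists 0. intros eps _ _. change (terms_val nil eps) with (RtoC 0). rewrite Cmod_0.
    apply Rmult_le_pos; [lra|apply Rabs_pos].
  - destruct (IH (eta / 2)) as [X1 H1]; [lra|].
    pose proof (Cmod_ge_0 (coef t')) as Pc.
    assert (He' : 0 < eta / (2 * (Cmod (coef t') + 1))) by (apply Rdiv_lt_0_compat; lra).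
    destruct (smaller_dominated t' t _ Ht' He') as [X2 H2].
    exists (Rmax X1 X2). intros eps Hp Hl.
    pose proof (Rmax_l X1 X2). pose proof (Rmax_r X1 X2).
    specialize (H1 eps Hp ltac:(lra)). destruct (H2 eps Hp ltac:(lra)) as [H3 _].
    rewrite terms_val_cons. eapply Rle_trans; [apply Cmod_triangle|].
    rewrite term_val_monomial, Cmod_mult, Cmod_R.
    assert (Cmod (coef t') * Rabs (monomial t' eps) <= eta / 2 * Rabs (monomial t eps)).
    { apply Rle_trans with ((Cmod (coef t') + 1) * (eta / (2 * (Cmod (coef t') + 1)) * Rabs (monomial t eps))).
      - apply Rmult_le_compat; auto using Rabs_pos; lra.
      - right. field. lra. }
    lra.
Qed.

Lemma exists_dominant (t0 : asym_term) (ts : list asym_term) :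
  exists t, List.In t (t0 :: ts) /\
    forall t', List.In t' (t0 :: ts) -> smaller t' t \/ (expo t' = expo t /\ logp t' = logp t).
Proof.
  revert t0. induction ts as [|t1 ts IH]; intros t0.
  - exists t0. split; [now left|]. intros t' [<-|[]]. now right.
  - destruct (IH t1) as [t [Hin Hmax]].
    assert (D : smaller t0 t \/ (expo t0 = expo t /\ logp t0 = logp t) \/ smaller t t0).
    { unfold smaller. destruct (Rtotal_order (expo t0) (expo t)) as [H|[H|H]]; [auto| |auto].
      destruct (Nat.lt_trichotomy (logp t0) (logp t)) as [K|[K|K]]; auto. }
    destruct D as [D|[D|D]].
    + exists t. split; [now right|]. intros t' [<-|H]; auto.
    + exists t. split; [now right|]. intros t' [<-|H]; auto.
    + exists t0. split; [now left|]. intros t' [<-|H]; [now right|].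
      left. destruct (Hmax t' H) as [S|[E1 E2]].
      * unfold smaller in *. destruct S as [S|[S1 S2]], D as [D|[D1 D2]]; [left; lra|left; lra|left; lra|].
        right. split; [lra|lia].
      * unfold smaller in *. destruct D as [D|[D1 D2]]; [left; lra|right; split; [lra|lia]].
Qed.

(** A list may repeat a monomial, with coefficients that cancel, so that only the total coefficient
    of a key is meaningful. *)
Definition same_key (t t' : asym_term) : bool :=
  if Req_EM_T (expo t') (expo t) then Nat.eqb (logp t') (logp t) else false.

Lemma terms_val_filter (p : asym_term -> bool) (ts : list asym_term) (eps : R) :
  terms_val ts eps = (terms_val (List.filter p ts) eps + terms_val (List.filter (fun t => negb (p t)) ts) eps)%C.
Proof.
  induction ts as [|t ts IH].
  - change (terms_val nil eps) with (RtoC 0). simpl. change (terms_val nil eps) with (RtoC 0). ring.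
  - rewrite terms_val_cons, IH. cbn [List.filter]. destruct (p t); cbn [negb]; rewrite terms_val_cons; ring.
Qed.

Lemma terms_val_same_key (t : asym_term) (ts : list asym_term) :
  exists c, forall eps, terms_val (List.filter (same_key t) ts) eps = (c * RtoC (monomial t eps))%C.
Proof.
  induction ts as [|t' ts [c IH]].
  - exists 0. intros eps. simpl. change (terms_val nil eps) with (RtoC 0). ring.
  - cbn [List.filter]. destruct (same_key t t') eqn:E; [|now exists c].
    exists (coef t' + c)%C. intros eps. rewrite terms_val_cons, IH, term_val_monomial.
    unfold same_key in E. destruct (Req_EM_T (expo t') (expo t)) as [E1|]; [|easy].
    apply Nat.eqb_eq in E. unfold monomial. rewrite E1, E. ring.
Qed.

Lemma filter_negb_length (p : asym_term -> bool) (t : asym_term) (ts : list asym_term) :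
  List.In t ts -> p t = true -> (length (List.filter (fun t => negb (p t)) ts) < length ts)%nat.
Proof.
  intros Hin Hp. induction ts as [|t' ts IH]; [easy|]. simpl.
  assert (L : (length (List.filter (fun t => negb (p t)) ts) <= length ts)%nat)
    by apply List.filter_length_le.
  destruct Hin as [->|Hin]; [rewrite Hp; simpl; lia|].
  specialize (IH Hin). destruct (negb (p t')); simpl; lia.
Qed.

Lemma ln_small (X d : R) : 0 < d -> exists eps, 0 < eps < d /\ ln eps <= - X.
Proof.
  intros Hd. exists (Rmin (d / 2) (exp (- X))).
  assert (P := exp_pos (- X)).
  assert (M : 0 < Rmin (d / 2) (exp (- X))) by (apply Rmin_glb_lt; lra).
  split; [split; auto; pose proof (Rmin_l (d / 2) (exp (- X))); lra|].
  rewrite <- (ln_exp (- X)) at 2. apply ln_le; auto. apply Rmin_r.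
Qed.

(* A sum of divergent terms with a finite limit: the total coefficient of its
   dominant monomial vanishes, so those terms can be dropped. *)
Lemma divergent_terms_limit (ts : list asym_term) (v : C) :
  List.Forall divergent_term ts -> tends0 (terms_val ts) v -> v = 0.
Proof.
  remember (length ts) as n eqn:Hn. revert ts Hn.
  induction n as [n IH] using (well_founded_induction Wf_nat.lt_wf). intros ts Hn Hdiv Hlim.
  destruct ts as [|t0 ts'].
  { apply Cmod_eq_0. apply Rle_antisym; [|apply Cmod_ge_0]. apply le_epsilon. intros e He.
    destruct (Hlim e He) as [d [Hd H]]. specialize (H (d / 2) ltac:(lra)).
    change (terms_val nil (d / 2)) with (RtoC 0) in H.
    rewrite Cmod_sub_sym in H. replace (v - 0)%C with v in H by ring. lra. }
  set (ts := t0 :: ts') in *.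
  destruct (exists_dominant t0 ts') as [t [Hin Hmax]]. fold ts in Hin, Hmax.
  set (ts2 := List.filter (fun u => negb (same_key t u)) ts).
  destruct (terms_val_same_key t ts) as [c Hc].
  assert (Ht : same_key t t = true).
  { unfold same_key. destruct (Req_EM_T (expo t) (expo t)); [apply Nat.eqb_refl|easy]. }
  assert (Split : forall eps, terms_val ts eps = (c * RtoC (monomial t eps) + terms_val ts2 eps)%C).
  { intros eps. rewrite (terms_val_filter (same_key t)), Hc. reflexivity. }
  assert (Hsm : List.Forall (fun t' => smaller t' t) ts2).
  { apply List.Forall_forall. intros t' Ht'. apply List.filter_In in Ht'. destruct Ht' as [H1 H2].
    destruct (Hmax t' H1) as [S|[E1 E2]]; auto. exfalso.
    unfold same_key in H2. destruct (Req_EM_T (expo t') (expo t)); [|easy].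
    rewrite E2, Nat.eqb_refl in H2. easy. }
  (* The constant 1 as a monomial: being divergent means dominating it, so the dominant monomial
     outgrows any bounded quantity. *)
  assert (Hone : smaller (AsymTerm 0 0 0) t).
  { rewrite List.Forall_forall in Hdiv. destruct (Hdiv t Hin) as [H|[H1 H2]]; unfold smaller; simpl; [auto|].
    right. auto. }
  assert (Hc0 : c = 0).
  { apply Cmod_eq_0. apply Rle_antisym; [|apply Cmod_ge_0]. apply le_epsilon. intros e He.
    pose proof (Cmod_ge_0 v) as Pv.
    (* The dominant term is at most [1 + |v|] plus the smaller terms. Both are measured in units of
       [e' phi], with weights [|v| + 1] and 1. *)
    set (e' := e / (Cmod v + 2)).
    assert (He' : 0 < e') by (apply Rdiv_lt_0_compat; lra).
    destruct (terms_dominated t ts2 e' Hsm He') as [X1 H1].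
    destruct (smaller_dominated _ _ e' Hone He') as [X2 H2].
    destruct (Hlim 1 Rlt_0_1) as [d [Hd H3]].
    destruct (ln_small (Rmax (Rmax X1 X2) 0) d Hd) as [eps [Heps Hln]].
    pose proof (Rmax_l (Rmax X1 X2) 0). pose proof (Rmax_r (Rmax X1 X2) 0).
    pose proof (Rmax_l X1 X2). pose proof (Rmax_r X1 X2).
    specialize (H1 eps ltac:(lra) ltac:(lra)). destruct (H2 eps ltac:(lra) ltac:(lra)) as [Hge Hpos].
    specialize (H3 eps Heps). rewrite Split in H3.
    assert (M1 : monomial (AsymTerm 0 0 0) eps = 1).
    { unfold monomial. simpl. rewrite Ropp_0, Rpower_O by lra. ring. }
    rewrite M1, Rabs_R1 in Hge. set (phi := Rabs (monomial t eps)) in *.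
    assert (B : Cmod c * phi <= (Cmod v + 2) * (e' * phi)).
    { unfold phi. rewrite <- Cmod_R, <- Cmod_mult, Cmod_R. fold phi.
      replace (c * RtoC (monomial t eps))%C
        with ((c * RtoC (monomial t eps) + terms_val ts2 eps - v) - (terms_val ts2 eps - v))%C by ring.
      eapply Rle_trans; [apply Cmod_sub_le|].
      pose proof (Cmod_sub_le (terms_val ts2 eps) v).
      assert ((Cmod v + 1) * 1 <= (Cmod v + 1) * (e' * phi)) by (apply Rmult_le_compat_l; lra). lra. }
    assert (E : (Cmod v + 2) * (e' * phi) = e * phi) by (unfold e'; field; lra).
    rewrite E in B. apply Rmult_le_reg_r in B; auto. lra. }
  apply (IH (length ts2)) with (ts := ts2); auto.
  - rewrite Hn. now apply (filter_negb_length (same_key t) t).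
  - apply List.Forall_forall. intros t' Ht'. apply List.filter_In in Ht'.
    rewrite List.Forall_forall in Hdiv. now apply Hdiv.
  - intros e He. destruct (Hlim e He) as [d [Hd H]]. exists d. split; auto. intros x Hx.
    specialize (H x Hx). rewrite Split, Hc0 in H.
    replace (0 * RtoC (monomial t x) + terms_val ts2 x - v)%C with (terms_val ts2 x - v)%C in H by ring. exact H.
Qed.

(** * The Dirichlet integral *)

(** Both [psi + phi] and [psi - phi] are nondecreasing, by the mean value theorem. *)
Lemma is_derive_dominated (phi dphi psi dpsi : R -> R) (a b : R) : a <= b ->
  (forall t, a <= t <= b -> is_derive phi t (dphi t)) ->
  (forall t, a <= t <= b -> is_derive psi t (dpsi t)) ->
  (forall t, a <= t <= b -> Rabs (dphi t) <= dpsi t) ->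
  Rabs (phi b - phi a) <= psi b - psi a.
Proof.
  intros Hab Hphi Hpsi Hle.
  assert (K : forall s, (s = 1 \/ s = -1) -> 0 <= (psi b + s * phi b) - (psi a + s * phi a)).
  { intros s Hs.
    assert (D : forall t, a <= t <= b -> is_derive (fun t => psi t + s * phi t) t (dpsi t + s * dphi t)).
    { intros t Ht. apply (is_derive_plus (V := R_NormedModule)); [now apply Hpsi|].
      apply (is_derive_scal phi t s (dphi t)). now apply Hphi. }
    destruct (MVT_gen (fun t => psi t + s * phi t) a b (fun t => dpsi t + s * dphi t)) as [c [Hc E]].
    - intros t Ht. apply D. rewrite Rmin_left, Rmax_right in Ht by auto. lra.
    - intros t Ht. apply continuity_pt_filterlim.
      rewrite Rmin_left, Rmax_right in Ht by auto.
      exact (ex_derive_continuous (V := R_NormedModule) (fun t => psi t + s * phi t) t (ex_intro _ _ (D t Ht))).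
    - rewrite Rmin_left, Rmax_right in Hc by auto. rewrite E.
      apply Rmult_le_pos; [|lra]. specialize (Hle c Hc).
      pose proof (Rle_abs (dphi c)). pose proof (Rle_abs (- dphi c)). rewrite Rabs_Ropp in *.
      destruct Hs; subst; lra. }
  pose proof (K 1 (or_introl eq_refl)). pose proof (K (-1) (or_intror eq_refl)).
  apply Rabs_le. lra.
Qed.

(** Taken from the slope of [e^(iz)] at 0, so that continuity at 0 comes from [slope_gcont]. *)
Definition sinc (x : R) : R := snd (slope (fun z => cexp (Ci * z)%C) 0 (x, 0)).

Lemma sinc_spec (x : R) : x * sinc x = sin x.
Proof.
  pose proof (slope_spec (fun z => cexp (Ci * z)%C) 0 (x, 0)) as H.
  apply (f_equal snd) in H. unfold sinc.
  set (q := slope (fun z => cexp (Ci * z)%C) 0 (x, 0)) in *.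
  unfold cexp in H. simpl in H.
  replace (0 * x - 1 * 0) with 0 in H by ring. replace (0 * 0 + 1 * x) with x in H by ring.
  replace (0 * 0 - 1 * 0) with 0 in H by ring. replace (0 * 0 + 1 * 0) with 0 in H by ring.
  rewrite exp_0, sin_0 in H. rewrite Rmult_1_l in H. rewrite H. ring.
Qed.

Lemma sinc_continuous (x : R) : continuous sinc x.
Proof.
  assert (Hq : gcont (slope (fun z => cexp (Ci * z)%C) 0)).
  { apply slope_gcont. intros z. apply (holo_comp (fun z => Ci * z)%C cexp); [|apply cexp_holo].
    apply holo_mult; [apply holo_const|apply holo_id]. }
  pose proof (gcont_horizontal _ 0 x Hq) as H.
  intros P [e HP]. destruct (rcont_elim _ _ H e (cond_pos e)) as [d [Hd Hs]].
  exists (mkposreal d Hd). intros s Hst. apply HP. specialize (Hs s Hst). simpl in Hs.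
  eapply Rle_lt_trans; [|exact Hs].
  exact (snd_le_Cmod (slope (fun z => cexp (Ci * z)%C) 0 (s, 0%R) - slope (fun z => cexp (Ci * z)%C) 0 (x, 0%R))%C).
Qed.

Lemma sin_abs_le (x : R) : 0 <= x -> Rabs (sin x) <= x.
Proof.
  intros Hx.
  replace (sin x) with (sin x - sin 0) by (rewrite sin_0; ring).
  replace x with (x - 0) at 2 by ring.
  apply (is_derive_dominated sin cos (fun t => t) (fun _ => 1) 0 x Hx).
  - intros t _. apply is_derive_sin.
  - intros t _. apply (is_derive_id (K := R_AbsRing)).
  - intros t _. apply Rabs_le, COS_bound.
Qed.

Lemma sinc_abs_le (x : R) : 0 < x -> Rabs (sinc x) <= 1.
Proof.
  intros Hx. apply Rmult_le_reg_l with x; auto.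
  rewrite <- (Rabs_pos_eq x) at 1 by lra. rewrite <- Rabs_mult, sinc_spec, Rmult_1_r.
  apply sin_abs_le. lra.
Qed.

Definition Si (x : R) : R := RInt sinc 0 x.

Lemma sinc_ex_RInt (a b : R) : ex_RInt sinc a b.
Proof. apply (ex_RInt_continuous (V := R_CompleteNormedModule)). intros; apply sinc_continuous. Qed.

Lemma Si_derive (x : R) : is_derive Si x (sinc x).
Proof.
  apply (is_derive_RInt (V := R_NormedModule) sinc Si 0 x); [|apply sinc_continuous].
  apply filter_forall. intros y. apply (RInt_correct (V := R_CompleteNormedModule)), sinc_ex_RInt.
Qed.

Section Dirichlet.
Variable X : R.
Hypothesis X_gt0 : 0 < X.

(** Exponential damping turns the [t]-derivative of the integral over [[0, X]] into an elementary
    one. *)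
Let f (t x : R) : R := exp (- (t * x)) * sinc x.
Let J (t : R) : R := RInt (f t) 0 X.

Lemma damped_continuous (t x : R) : continuous (f t) x.
Proof.
  apply (continuous_mult (K := R_AbsRing)); [|apply sinc_continuous].
  apply (ex_derive_continuous (V := R_NormedModule)). auto_derive. auto.
Qed.

Lemma damped_derive (t x : R) : is_derive (fun u => f u x) t (- (exp (- (t * x)) * sin x)).
Proof.
  unfold f. rewrite <- (sinc_spec x). auto_derive; auto. ring.
Qed.

Lemma J_derive (t : R) :
  is_derive J t ((exp (- (t * X)) * (t * sin X + cos X) - 1) / (1 + t ^ 2)).
Proof.
  assert (E : RInt (fun x => Derive (fun u => f u x) t) 0 X =
    (exp (- (t * X)) * (t * sin X + cos X) - 1) / (1 + t ^ 2)).
  { assert (Ht : 1 + t ^ 2 <> 0) by (pose proof (pow2_ge_0 t); lra).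
    rewrite (RInt_ext _ (fun x => - (exp (- (t * x)) * sin x))).
    2:{ intros x _. apply is_derive_unique, damped_derive. }
    apply is_RInt_unique.
    replace ((exp (- (t * X)) * (t * sin X + cos X) - 1) / (1 + t ^ 2))
      with (minus ((fun x => exp (- (t * x)) * (t * sin x + cos x) / (1 + t ^ 2)) X)
                  ((fun x => exp (- (t * x)) * (t * sin x + cos x) / (1 + t ^ 2)) 0)).
    2:{ unfold minus, plus, opp. simpl. rewrite sin_0, cos_0, Rmult_0_r, Ropp_0, exp_0. field.
        replace (t * t) with (t ^ 2) by ring. exact Ht. }
    apply (is_RInt_derive (V := R_CompleteNormedModule)
      (fun x => exp (- (t * x)) * (t * sin x + cos x) / (1 + t ^ 2))).
    - intros x _. auto_derive; [auto|]. field. intro Hz. apply Ht. rewrite <- Hz. ring.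
    - intros x _. apply (ex_derive_continuous (V := R_NormedModule)). auto_derive. auto. }
  rewrite <- E. apply (is_derive_RInt_param f 0 X t).
  - apply filter_forall. intros u x _. eexists. apply damped_derive.
  - intros x _. apply (continuity_2d_pt_ext (fun u v => - (exp (- (u * v)) * sin v))).
    { intros u v. symmetry. apply is_derive_unique, damped_derive. }
    apply continuity_2d_pt_opp, continuity_2d_pt_mult.
    + apply (continuity_1d_2d_pt_comp exp (fun u v => - (u * v))).
      * apply derivable_continuous_pt, derivable_pt_exp.
      * apply continuity_2d_pt_opp, continuity_2d_pt_mult;
          [apply continuity_2d_pt_id1|apply continuity_2d_pt_id2].
    + apply (continuity_1d_2d_pt_comp sin (fun u v => v)).
      * apply continuity_sin.
      * apply continuity_2d_pt_id2.
  - apply filter_forall. intros u. apply (ex_RInt_continuous (V := R_CompleteNormedModule)).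
    intros; apply damped_continuous.
Qed.

Lemma J_small (T : R) : 0 < T -> Rabs (J T) <= / T.
Proof.
  intros HT.
  eapply Rle_trans.
  - apply (norm_RInt_le (V := R_NormedModule) (f T) (fun x => exp (- (T * x))) 0 X _
      (- exp (- (T * X)) / T - - exp (- (T * 0)) / T)); [lra| | |].
    + intros x Hx. unfold f. change (Rabs (exp (- (T * x)) * sinc x) <= exp (- (T * x))).
      rewrite Rabs_mult, (Rabs_pos_eq (exp _)) by (left; apply exp_pos).
      destruct (Req_dec x 0) as [->|N].
      (* The bound at 0 is inherited by continuity from the positive axis. *)
      * assert (B : Rabs (sinc 0) <= 1).
        { apply Rnot_lt_le. intros Hlt.
          destruct (sinc_continuous 0 (fun y => Rabs y > 1)) as [d Hd].
          - assert (Hp : 0 < Rabs (sinc 0) - 1) by lra.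
            exists (mkposreal _ Hp). intros y Hy. simpl in Hy.
            change (Rabs (y - sinc 0) < Rabs (sinc 0) - 1) in Hy.
            pose proof (Rabs_triang_inv (sinc 0) y). rewrite Rabs_minus_sym in Hy. lra.
          - assert (Hd2 := cond_pos d). specialize (Hd (d / 2)).
            assert (H1 : Rabs (sinc (d / 2)) > 1).
            { apply Hd. change (Rabs (d / 2 - 0) < d). rewrite Rminus_0_r, Rabs_pos_eq; lra. }
            pose proof (sinc_abs_le (d / 2) ltac:(lra)). lra. }
        rewrite <- (Rmult_1_r (exp _)) at 2. apply Rmult_le_compat_l; [left; apply exp_pos|auto].
      * rewrite <- (Rmult_1_r (exp _)) at 2. apply Rmult_le_compat_l; [left; apply exp_pos|].
        apply sinc_abs_le. lra.
    + apply (RInt_correct (V := R_CompleteNormedModule)).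
      apply (ex_RInt_continuous (V := R_CompleteNormedModule)). intros; apply damped_continuous.
    + apply (is_RInt_derive (V := R_CompleteNormedModule) (fun x => - exp (- (T * x)) / T)).
      * intros x _. auto_derive; [lra|]. field. lra.
      * intros x _. apply (ex_derive_continuous (V := R_NormedModule)). auto_derive. auto.
  - rewrite Rmult_0_r, Ropp_0, exp_0. pose proof (exp_pos (- (T * X))).
    assert (0 < exp (- (T * X)) / T) by (now apply Rdiv_lt_0_compat). unfold Rdiv in *. lra.
Qed.

Lemma atan_le_id (y : R) : 0 <= y -> Rabs (atan y) <= y.
Proof.
  intros Hy. replace (atan y) with (atan y - atan 0) by (rewrite atan_0; ring).
  replace y with (y - 0) at 2 by ring.
  apply (is_derive_dominated atan (fun t => / (1 + t²)) (fun t => t) (fun _ => 1) 0 y Hy).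
  - intros t _. apply is_derive_atan.
  - intros t _. apply (is_derive_id (K := R_AbsRing)).
  - intros t _. pose proof (Rle_0_sqr t). rewrite Rabs_pos_eq.
    + rewrite <- Rinv_1. apply Rinv_le_contravar; lra.
    + left. apply Rinv_0_lt_compat. lra.
Qed.

(** The derivative of [J + atan] is only the boundary contribution at [X], at most [2 e^(-tX)] in
    absolute value. Integrated over [t >= 0] it costs [2 / X], while [J + atan] goes from [Si X] to
    [PI / 2]. *)
Lemma Si_dirichlet : Rabs (Si X - PI / 2) <= 2 / X.
Proof.
  assert (JSi : J 0 = Si X).
  { unfold J, Si. apply RInt_ext. intros x _. unfold f. rewrite Rmult_0_l, Ropp_0, exp_0. apply Rmult_1_l. }
  apply le_epsilon. intros e He.
  (* Both [|J T|] and [PI / 2 - atan T] are at most [1 / T = e / 2]. *)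
  set (T := 2 / e). assert (HT : 0 < T) by (apply Rdiv_lt_0_compat; lra).
  assert (B : Rabs ((J T + atan T) - (J 0 + atan 0)) <= - (2 / X) * exp (- (T * X)) - - (2 / X) * exp (- (0 * X))).
  { apply (is_derive_dominated (fun t => J t + atan t)
      (fun t => exp (- (t * X)) * (t * sin X + cos X) / (1 + t ^ 2))
      (fun t => - (2 / X) * exp (- (t * X))) (fun t => 2 * exp (- (t * X))) 0 T); [lra| | |].
    - intros t _. replace (exp (- (t * X)) * (t * sin X + cos X) / (1 + t ^ 2))
        with (plus ((exp (- (t * X)) * (t * sin X + cos X) - 1) / (1 + t ^ 2)) (/ (1 + t²))).
      + apply (is_derive_plus (V := R_NormedModule)); [apply J_derive|apply is_derive_atan].
      + unfold plus, Rsqr. simpl. field. pose proof (pow2_ge_0 t). simpl in *. nra.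
    - intros t _. auto_derive; auto. field. lra.
    - intros t Ht. pose proof (exp_pos (- (t * X))) as Pe.
      assert (Ht2 : 0 < 1 + t ^ 2) by (pose proof (pow2_ge_0 t); lra).
      unfold Rdiv. rewrite !Rabs_mult, (Rabs_pos_eq (exp _)) by lra.
      rewrite (Rabs_pos_eq (/ _)) by (left; now apply Rinv_0_lt_compat).
      replace (2 * exp (- (t * X))) with (exp (- (t * X)) * (2 * (1 + t ^ 2)) * / (1 + t ^ 2)) by (field; lra).
      apply Rmult_le_compat_r; [left; now apply Rinv_0_lt_compat|].
      apply Rmult_le_compat_l; [lra|].
      pose proof (COS_bound X). pose proof (SIN_bound X).
      apply Rabs_le. nra. }
  rewrite JSi, atan_0, Rmult_0_l, Ropp_0, exp_0 in B.
  pose proof (J_small T HT) as HJ.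
  assert (Ha : Rabs (PI / 2 - atan T) <= / T).
  { rewrite <- atan_inv by auto. apply atan_le_id. left. now apply Rinv_0_lt_compat. }
  assert (HiT : / T = e / 2) by (unfold T; field; lra). rewrite HiT in *.
  assert (0 < 2 / X * exp (- (T * X))).
  { apply Rmult_lt_0_compat; [now apply Rdiv_lt_0_compat; lra|apply exp_pos]. }
  apply Rabs_le_between in B. apply Rabs_le_between in HJ. apply Rabs_le_between in Ha.
  apply Rabs_le. lra.
Qed.

End Dirichlet.

(** * Integrals of powers of the sine over powers of the variable *)

(** The bound is excluded and the sum may be empty, whereas [sum_n] and [csum] include their last
    index. *)
Fixpoint rsum (u : nat -> R) (n : nat) : R :=
  match n with 0%nat => 0 | S n => rsum u n + u n end.

Lemma rsum_ext (u v : nat -> R) (n : nat) : (forall k, (k < n)%nat -> u k = v k) -> rsum u n = rsum v n.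
Proof.
  induction n as [|n IH]; intros H; [reflexivity|]. simpl. rewrite IH, H by (intros; try apply H; lia). reflexivity.
Qed.

Lemma rsum_scal (c : R) (u : nat -> R) (n : nat) : rsum (fun k => c * u k) n = c * rsum u n.
Proof. induction n as [|n IH]; simpl; [ring|]. rewrite IH. ring. Qed.

Lemma rsum_head (u : nat -> R) (n : nat) : rsum u (S n) = u 0%nat + rsum (fun k => u (S k)) n.
Proof. induction n as [|n IH]; [simpl; ring|]. change (rsum u (S n) + u (S n) = u 0%nat + (rsum (fun k => u (S k)) n + u (S n))). rewrite IH. ring. Qed.

Lemma rsum_split_rev (F : nat -> R) (n j : nat) :
  rsum F (n + j) = rsum F n + rsum (fun i => F (n + j - 1 - i)%nat) j.
Proof.
  induction j as [|j IH]; [rewrite Nat.add_0_r; simpl; ring|].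
  rewrite rsum_head. replace (n + S j)%nat with (S (n + j)) by lia.
  simpl rsum at 1. rewrite IH.
  replace (S (n + j) - 1 - 0)%nat with (n + j)%nat by lia.
  rewrite (rsum_ext (fun k => F (S (n + j) - 1 - S k)%nat) (fun i => F (n + j - 1 - i)%nat))
    by (intros; f_equal; lia). ring.
Qed.

Lemma rsum_symmetric (F : nat -> R) (m : nat) : (forall k, (k < m)%nat -> F (2 * m - k)%nat = F k) ->
  rsum F (S (2 * m)) = 2 * rsum F m + F m.
Proof.
  intros H. replace (S (2 * m)) with (S m + m)%nat by lia. rewrite rsum_split_rev.
  rewrite (rsum_ext (fun i => F (S m + m - 1 - i)%nat) F).
  - simpl. ring.
  - intros k Hk. rewrite <- (H k Hk). f_equal. lia.
Qed.

Definition rlim (A : R -> R) (l : R) : Prop :=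
  forall eta, 0 < eta -> exists X, forall x, X <= x -> Rabs (A x - l) <= eta.
Definition rlim0 (A : R -> R) (l : R) : Prop :=
  forall eta, 0 < eta -> exists d, 0 < d /\ forall x, 0 < x < d -> Rabs (A x - l) <= eta.

Lemma Rabs_lin (a b x y e : R) : Rabs x <= e -> Rabs y <= e ->
  Rabs (a * x + b * y) <= (Rabs a + Rabs b) * e.
Proof.
  intros Hx Hy. eapply Rle_trans; [apply Rabs_triang|]. rewrite !Rabs_mult, Rmult_plus_distr_r.
  apply Rplus_le_compat; apply Rmult_le_compat_l; auto using Rabs_pos.
Qed.

Lemma rlim_lin (A B : R -> R) (l k a b : R) : rlim A l -> rlim B k ->
  rlim (fun x => a * A x + b * B x) (a * l + b * k).
Proof.
  intros HA HB eta He. set (K := Rabs a + Rabs b + 1).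
  assert (HK : 0 < K) by (pose proof (Rabs_pos a); pose proof (Rabs_pos b); unfold K; lra).
  destruct (HA (eta / K)) as [X HX]; [now apply Rdiv_lt_0_compat|].
  destruct (HB (eta / K)) as [Y HY]; [now apply Rdiv_lt_0_compat|].
  exists (Rmax X Y). intros x Hx.
  replace (a * A x + b * B x - (a * l + b * k)) with (a * (A x - l) + b * (B x - k)) by ring.
  eapply Rle_trans; [apply Rabs_lin|].
  - apply HX. eapply Rle_trans; [apply Rmax_l|exact Hx].
  - apply HY. eapply Rle_trans; [apply Rmax_r|exact Hx].
  - apply Rle_trans with (K * (eta / K)); [|right; field; lra].
    apply Rmult_le_compat_r; [left; now apply Rdiv_lt_0_compat|unfold K; lra].
Qed.

Lemma rlim0_lin (A B : R -> R) (l k a b : R) : rlim0 A l -> rlim0 B k ->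
  rlim0 (fun x => a * A x + b * B x) (a * l + b * k).
Proof.
  intros HA HB eta He. set (K := Rabs a + Rabs b + 1).
  assert (HK : 0 < K) by (pose proof (Rabs_pos a); pose proof (Rabs_pos b); unfold K; lra).
  destruct (HA (eta / K)) as [X [X0 HX]]; [now apply Rdiv_lt_0_compat|].
  destruct (HB (eta / K)) as [Y [Y0 HY]]; [now apply Rdiv_lt_0_compat|].
  exists (Rmin X Y). split; [now apply Rmin_glb_lt|]. intros x Hx.
  pose proof (Rmin_l X Y). pose proof (Rmin_r X Y).
  replace (a * A x + b * B x - (a * l + b * k)) with (a * (A x - l) + b * (B x - k)) by ring.
  eapply Rle_trans; [apply Rabs_lin|].
  - apply HX. lra.
  - apply HY. lra.
  - apply Rle_trans with (K * (eta / K)); [|right; field; lra].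
    apply Rmult_le_compat_r; [left; now apply Rdiv_lt_0_compat|unfold K; lra].
Qed.

(* The integral of [h x / x ^ q] over the half line converges, with value [l]. *)
Definition moment (h : R -> R) (q : nat) (l : R) : Prop :=
  exists A, (forall x, 0 < x -> is_derive A x (h x / x ^ q)) /\ rlim0 A 0 /\ rlim A l.

Lemma moment_ext (h k : R -> R) (q : nat) (l l' : R) :
  (forall x, 0 < x -> h x = k x) -> l = l' -> moment h q l -> moment k q l'.
Proof. intros E <- (A & HA & H). exists A. split; auto. intros x Hx. rewrite <- E by auto. auto. Qed.

Lemma moment_lin (h k : R -> R) (q : nat) (l r a b : R) : moment h q l -> moment k q r ->
  moment (fun x => a * h x + b * k x) q (a * l + b * r).
Proof.
  intros (A & HA & A0 & AI) (B & HB & B0 & BI). exists (fun x => a * A x + b * B x).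
  split; [|split].
  - intros x Hx. replace ((a * h x + b * k x) / x ^ q) with (plus (a * (h x / x ^ q)) (b * (k x / x ^ q)))
      by (unfold plus; simpl; field; apply pow_nonzero; lra).
    apply (is_derive_plus (V := R_NormedModule)).
    + apply (is_derive_scal A x a). auto.
    + apply (is_derive_scal B x b). auto.
  - replace 0 with (a * 0 + b * 0) by ring. now apply rlim0_lin.
  - now apply rlim_lin.
Qed.

Lemma moment_zero (q : nat) : moment (fun _ => 0) q 0.
Proof.
  exists (fun _ => 0). split; [|split].
  - intros x Hx. replace (0 / x ^ q) with 0 by (field; apply pow_nonzero; lra). apply (is_derive_const (K := R_AbsRing) (V := R_NormedModule)).
  - intros e He. exists 1. split; [lra|]. intros. rewrite Rminus_0_r, Rabs_R0. lra.
  - intros e He. exists 1. intros. rewrite Rminus_0_r, Rabs_R0. lra.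
Qed.

Lemma moment_rsum (h : nat -> R -> R) (c l : nat -> R) (q n : nat) :
  (forall k, (k < n)%nat -> moment (h k) q (l k)) ->
  moment (fun x => rsum (fun k => c k * h k x) n) q (rsum (fun k => c k * l k) n).
Proof.
  induction n as [|n IH]; intros H; simpl; [apply moment_zero|].
  apply (moment_ext (fun x => 1 * rsum (fun k => c k * h k x) n + c n * h n x) _ q (1 * rsum (fun k => c k * l k) n + c n * l n)).
  - intros; ring.
  - ring.
  - apply moment_lin; [apply IH; intros; apply H; lia|apply H; lia].
Qed.

(** The substitution gains [w^(q+2)] from the power and loses one factor to [dx]. The case [w = 0]
    is that of the middle node and is where [h 0 = 0] enters. *)
Lemma moment_scale (h : R -> R) (q : nat) (l w : R) : 0 <= w -> h 0 = 0 -> moment h (S (S q)) l ->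
  moment (fun x => h (w * x)) (S (S q)) (w ^ S q * l).
Proof.
  intros [Hw| <-] H0 (A & HA & A0 & AI).
  - exists (fun x => w ^ S q * A (w * x)). 
    assert (P : 0 < w ^ S q) by (now apply pow_lt).
    split; [|split].
    + intros x Hx. assert (Hwx : 0 < w * x) by (now apply Rmult_lt_0_compat).
      replace (h (w * x) / x ^ S (S q)) with (w ^ S q * (w * (h (w * x) / (w * x) ^ S (S q)))).
      * apply (is_derive_scal (fun x => A (w * x)) x (w ^ S q)).
        apply (is_derive_comp A (fun x => w * x) x _ w); [now apply HA|].
        auto_derive; auto. ring.
      * rewrite Rpow_mult_distr. simpl. field. repeat split; try lra; apply pow_nonzero; lra.
    + intros e He. destruct (A0 (e / w ^ S q)) as [d [Hd H]]; [now apply Rdiv_lt_0_compat|].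
      exists (d / w). split; [now apply Rdiv_lt_0_compat|]. intros x Hx.
      assert (Hwx : 0 < w * x < d).
      { split; [now apply Rmult_lt_0_compat|]. apply Rmult_lt_reg_r with (/ w); [now apply Rinv_0_lt_compat|].
        replace (w * x * / w) with x by (field; lra). apply Hx. }
      specialize (H _ Hwx). replace (w ^ S q * A (w * x) - 0) with (w ^ S q * (A (w * x) - 0)) by ring.
      rewrite Rabs_mult, Rabs_pos_eq by lra.
      apply Rle_trans with (w ^ S q * (e / w ^ S q)); [apply Rmult_le_compat_l; lra|right; field; lra].
    + intros e He. destruct (AI (e / w ^ S q)) as [X H]; [now apply Rdiv_lt_0_compat|].
      exists (X / w). intros x Hx.
      assert (Hwx : X <= w * x).
      { apply Rmult_le_reg_r with (/ w); [now apply Rinv_0_lt_compat|].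
        replace (w * x * / w) with x by (field; lra). apply Hx. }
      specialize (H _ Hwx). replace (w ^ S q * A (w * x) - w ^ S q * l) with (w ^ S q * (A (w * x) - l)) by ring.
      rewrite Rabs_mult, Rabs_pos_eq by lra.
      apply Rle_trans with (w ^ S q * (e / w ^ S q)); [apply Rmult_le_compat_l; lra|right; field; lra].
  - apply (moment_ext (fun _ => 0) _ (S (S q)) 0).
    + intros x _. now rewrite Rmult_0_l.
    + simpl. ring.
    + apply moment_zero.
Qed.

(* Integration by parts. *)
Lemma moment_step (h h1 : R -> R) (q : nat) (l K : R) :
  (forall x, is_derive h x (h1 x)) -> moment h1 (S q) l -> 0 < K ->
  (forall x, 0 <= x -> Rabs (h x) <= K * x ^ S (S q)) ->
  (forall x, 0 <= x -> Rabs (h x) <= K * x ^ q) ->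
  moment h (S (S q)) (l / INR (S q)).
Proof.
  intros Hh (A & HA & A0 & AI) HK Hs Hl.
  assert (Hq : 0 < INR (S q)) by (apply lt_0_INR; lia).
  (* The two bounds on the boundary term make it vanish at 0 and at infinity respectively. *)
  assert (Bq : forall x, 0 < x -> Rabs (h x / x ^ S q) <= K * x /\ Rabs (h x / x ^ S q) <= K / x).
  { intros x Hx. assert (P : 0 < x ^ S q) by (now apply pow_lt).
    unfold Rdiv. rewrite Rabs_mult, (Rabs_pos_eq (/ _)) by (left; now apply Rinv_0_lt_compat).
    split.
    - replace (K * x) with (K * x ^ S (S q) * / x ^ S q) by (simpl; field; repeat split; try apply pow_nonzero; lra).
      apply Rmult_le_compat_r; [left; now apply Rinv_0_lt_compat|apply Hs; lra].
    - replace (K * / x) with (K * x ^ q * / x ^ S q) by (simpl; field; repeat split; try apply pow_nonzero; lra).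
      apply Rmult_le_compat_r; [left; now apply Rinv_0_lt_compat|apply Hl; lra]. }
  exists (fun x => / INR (S q) * A x + - / INR (S q) * (h x / x ^ S q)).
  split; [|split].
  - intros x Hx. 
    assert (Hx' : x ^ q <> 0) by (apply pow_nonzero; lra).
    replace (h x / x ^ S (S q)) with (plus (/ INR (S q) * (h1 x / x ^ S q))
      (- / INR (S q) * ((h1 x * x ^ S q - h x * (INR (S q) * x ^ q)) / (x ^ S q) ^ 2))).
    + apply (is_derive_plus (V := R_NormedModule)).
      * apply (is_derive_scal A x (/ INR (S q))). auto.
      * apply (is_derive_scal (fun x => h x / x ^ S q) x (- / INR (S q))).
        apply is_derive_div; [apply Hh| |apply pow_nonzero; lra].
        replace (INR (S q) * x ^ q) with (INR (S q) * 1 * x ^ pred (S q)) by (simpl pred; ring).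
        apply (is_derive_pow (fun x => x) (S q) x 1). apply (is_derive_id (K := R_AbsRing)).
    + unfold plus. generalize dependent (INR (S q)). intros. simpl. field. repeat split; lra.
  - replace 0 with (/ INR (S q) * 0 + - / INR (S q) * 0) by ring. apply rlim0_lin; auto.
    intros e He. exists (e / K). split; [now apply Rdiv_lt_0_compat|]. intros x Hx. rewrite Rminus_0_r.
    eapply Rle_trans; [exact (proj1 (Bq x (proj1 Hx)))|].
    apply Rle_trans with (K * (e / K)); [apply Rmult_le_compat_l; lra|right; field; lra].
  - replace (l / INR (S q)) with (/ INR (S q) * l + - / INR (S q) * 0) by (field; lra). apply rlim_lin; auto.
    intros e He. exists (K / e). intros x Hx. rewrite Rminus_0_r.
    assert (0 < K / e) by (now apply Rdiv_lt_0_compat).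
    eapply Rle_trans; [exact (proj2 (Bq x ltac:(lra)))|].
    apply Rmult_le_reg_r with x; [lra|]. replace (K / x * x) with K by (field; lra).
    apply Rle_trans with (e * (K / e)); [right; field; lra|apply Rmult_le_compat_l; lra].
Qed.

Lemma moment_sin : moment sin 1 (PI / 2).
Proof.
  exists Si. split; [|split].
  - intros x Hx. replace (sin x / x ^ 1) with (sinc x); [apply Si_derive|].
    rewrite <- sinc_spec. field. lra.
  - intros e He. assert (HC : continuous Si 0) by (apply (ex_derive_continuous (V := R_NormedModule)); eexists; apply Si_derive).
    destruct (HC (ball (Si 0) (mkposreal e He))) as [d Hd]; [now exists (mkposreal e He)|].
    exists d. split; [apply cond_pos|]. intros x Hx.
    assert (B : Rabs (Si x - Si 0) < e).
    { apply Hd. change (Rabs (x - 0) < d). rewrite Rminus_0_r, Rabs_pos_eq; lra. }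
    replace (Si 0) with 0 in B; [lra|]. unfold Si. symmetry. apply (RInt_point (V := R_CompleteNormedModule)).
  - intros e He. exists (2 / e). intros x Hx. assert (0 < 2 / e) by (apply Rdiv_lt_0_compat; lra).
    eapply Rle_trans; [apply Si_dirichlet; lra|].
    apply Rmult_le_reg_r with x; [lra|]. replace (2 / x * x) with 2 by (field; lra).
    apply Rle_trans with (e * (2 / e)); [right; field; lra|apply Rmult_le_compat_l; lra].
Qed.

(** * Taylor remainders of cosine and sine, and their moments *)

Definition cos_pol (n : nat) (u : R) : R := rsum (fun i => (-1) ^ i * u ^ (2 * i) / INR (fact (2 * i))) n.
Definition sin_pol (n : nat) (u : R) : R := rsum (fun i => (-1) ^ i * u ^ (2 * i + 1) / INR (fact (2 * i + 1))) n.

(** Terms of degree up to [2p] are removed. The remainder is then of order [x^(2p+2)] at 0 and at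
    most of order [x^(2p)] at infinity, so that its quotient by [x^(2p+2)] is integrable at both
    ends. *)
Definition cos_rem (p : nat) (u : R) : R := cos u - cos_pol (S p) u.
Definition sin_rem (p : nat) (u : R) : R := sin u - sin_pol (S p) u.

Lemma pow_term_derive (c : R) (k : nat) (u : R) :
  is_derive (fun u => c * u ^ S k / INR (fact (S k))) u (c * u ^ k / INR (fact k)).
Proof.
  assert (F : INR (fact k) <> 0) by apply INR_fact_neq_0.
  assert (G : INR (S k) <> 0) by (apply not_0_INR; lia).
  apply (is_derive_ext (fun u => c / INR (fact (S k)) * u ^ S k)).
  { intros t. match goal with |- ?a = ?b => change (@eq R a b) end. unfold Rdiv. ring. }
  replace (c * u ^ k / INR (fact k)) with (c / INR (fact (S k)) * (INR (S k) * 1 * u ^ pred (S k))).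
  - apply (is_derive_scal (fun u => u ^ S k) u). apply (is_derive_pow (fun x => x) (S k) u 1).
    apply (is_derive_id (K := R_AbsRing)).
  - rewrite fact_simpl, mult_INR. simpl pred. field. auto.
Qed.

Lemma sin_pol_derive (n : nat) (u : R) : is_derive (sin_pol n) u (cos_pol n u).
Proof.
  unfold sin_pol, cos_pol. induction n as [|n IH]; cbn [rsum].
  - apply (is_derive_const (K := R_AbsRing) (V := R_NormedModule)).
  - apply (is_derive_plus (V := R_NormedModule)); [exact IH|].
    replace (2 * n + 1)%nat with (S (2 * n)) by lia. apply pow_term_derive.
Qed.

Lemma cos_pol_derive (n : nat) (u : R) : is_derive (cos_pol (S n)) u (- sin_pol n u).
Proof.
  unfold sin_pol. induction n as [|n IH].
  - apply (is_derive_ext (fun _ => 1)); [intros t; match goal with |- ?a = ?b => change (@eq R a b) end; unfold cos_pol; simpl; field|].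
    replace (- rsum _ 0) with 0 by (simpl; ring). apply (is_derive_const (K := R_AbsRing) (V := R_NormedModule)).
  - apply (is_derive_ext (fun u => cos_pol (S n) u + (-1) ^ S n * u ^ S (2 * n + 1) / INR (fact (S (2 * n + 1))))).
    { intros t. unfold cos_pol. replace (S (2 * n + 1)) with (2 * S n)%nat by lia. reflexivity. }
    cbn [rsum]. rewrite Ropp_plus_distr.
    apply (is_derive_plus (V := R_NormedModule)); [exact IH|].
    replace (- ((-1) ^ n * u ^ (2 * n + 1) / INR (fact (2 * n + 1))))
      with ((-1) ^ S n * u ^ (2 * n + 1) / INR (fact (2 * n + 1))).
    + apply pow_term_derive.
    + simpl pow at 1. field. apply INR_fact_neq_0.
Qed.

Lemma sin_rem_derive (p : nat) (u : R) : is_derive (sin_rem p) u (cos_rem p u).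
Proof. apply (is_derive_minus (V := R_NormedModule)); [apply is_derive_sin|apply sin_pol_derive]. Qed.

Lemma cos_rem_derive_0 (u : R) : is_derive (cos_rem 0) u (- sin u).
Proof.
  replace (- sin u) with (minus (- sin u) (- sin_pol 0 u)) by (unfold minus, plus, opp, sin_pol; simpl; ring).
  apply (is_derive_minus (V := R_NormedModule)); [apply is_derive_cos|apply cos_pol_derive].
Qed.

Lemma cos_rem_derive_S (p : nat) (u : R) : is_derive (cos_rem (S p)) u (- sin_rem p u).
Proof.
  replace (- sin_rem p u) with (minus (- sin u) (- sin_pol (S p) u)) by (unfold minus, plus, opp, sin_rem; simpl; ring).
  apply (is_derive_minus (V := R_NormedModule)); [apply is_derive_cos|apply cos_pol_derive].
Qed.

Lemma cos_rem_0 (p : nat) : cos_rem p 0 = 0.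
Proof.
  unfold cos_rem, cos_pol. rewrite rsum_head, cos_0.
  rewrite (rsum_ext _ (fun _ => 0 * 0)).
  - rewrite rsum_scal. simpl. field.
  - intros k _. replace (2 * S k)%nat with (S (S (2 * k))) by lia. simpl pow. unfold Rdiv. ring.
Qed.

Lemma sin_rem_0 (p : nat) : sin_rem p 0 = 0.
Proof.
  unfold sin_rem, sin_pol. rewrite sin_0, (rsum_ext _ (fun _ => 0 * 0)).
  - rewrite rsum_scal. ring.
  - intros k _. replace (2 * k + 1)%nat with (S (2 * k)) by lia. simpl pow. unfold Rdiv. ring.
Qed.

Lemma primitive_pow_bound (h h1 : R -> R) (n : nat) (K : R) : 0 <= K ->
  (forall x, is_derive h x (h1 x)) -> h 0 = 0 ->
  (forall x, 0 <= x -> Rabs (h1 x) <= K * x ^ n) -> forall x, 0 <= x -> Rabs (h x) <= K * x ^ S n.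
Proof.
  intros HK Hh H0 Hb x Hx.
  replace (h x) with (h x - h 0) by (rewrite H0; ring).
  replace (K * x ^ S n) with (K * x ^ S n - K * 0 ^ S n) by (simpl; ring).
  apply (is_derive_dominated h h1 (fun x => K * x ^ S n) (fun x => K * (INR (S n) * 1 * x ^ pred (S n))) 0 x Hx).
  - intros; apply Hh.
  - intros t _. apply (is_derive_scal (fun x => x ^ S n) t K). apply (is_derive_pow (fun x => x) (S n) t 1).
    apply (is_derive_id (K := R_AbsRing)).
  - intros t Ht. eapply Rle_trans; [apply Hb; lra|]. apply Rmult_le_compat_l; auto. simpl pred.
    rewrite Rmult_1_r. rewrite <- (Rmult_1_l (t ^ n)) at 1. apply Rmult_le_compat_r; [apply pow_le; lra|].
    rewrite S_INR. pose proof (pos_INR n). lra.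
Qed.

(** Each remainder is, up to sign, the primitive vanishing at 0 of the previous one, starting from
    [|sin x| <= x] and [|cos x - 1| <= 2]. The higher powers serve near 0, the lower ones at
    infinity. *)
Lemma rem_bounds (p : nat) :
  (forall x, 0 <= x -> Rabs (cos_rem p x) <= 1 * x ^ (2 * p + 2)) /\
  (forall x, 0 <= x -> Rabs (cos_rem p x) <= 2 * x ^ (2 * p)) /\
  (forall x, 0 <= x -> Rabs (sin_rem p x) <= 1 * x ^ (2 * p + 3)) /\
  (forall x, 0 <= x -> Rabs (sin_rem p x) <= 2 * x ^ (2 * p + 1)).
Proof.
  assert (W : (forall x, 0 <= x -> Rabs (cos_rem p x) <= 1 * x ^ (2 * p + 2)) /\
    (forall x, 0 <= x -> Rabs (cos_rem p x) <= 2 * x ^ (2 * p)) ->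
    (forall x, 0 <= x -> Rabs (sin_rem p x) <= 1 * x ^ (2 * p + 3)) /\
    (forall x, 0 <= x -> Rabs (sin_rem p x) <= 2 * x ^ (2 * p + 1))).
  { intros [H1 H2]. split.
    - replace (2 * p + 3)%nat with (S (2 * p + 2)) by lia.
      apply (primitive_pow_bound (sin_rem p) (cos_rem p)); auto using sin_rem_derive, sin_rem_0; lra.
    - replace (2 * p + 1)%nat with (S (2 * p)) by lia.
      apply (primitive_pow_bound (sin_rem p) (cos_rem p)); auto using sin_rem_derive, sin_rem_0; lra. }
  assert (V : (forall x, 0 <= x -> Rabs (cos_rem p x) <= 1 * x ^ (2 * p + 2)) /\
    (forall x, 0 <= x -> Rabs (cos_rem p x) <= 2 * x ^ (2 * p))); [|destruct V, W; auto].
  clear W. induction p as [|p [IH1 IH2]].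
  - split.
    + apply (primitive_pow_bound (cos_rem 0) (fun u => - sin u) 1 1); auto using cos_rem_derive_0, cos_rem_0; [lra|].
      intros x Hx. rewrite Rabs_Ropp. simpl. pose proof (sin_abs_le x Hx). lra.
    + intros x _. unfold cos_rem, cos_pol. simpl. pose proof (COS_bound x).
      replace (cos x - (0 + 1 * 1 / 1)) with (cos x - 1) by field. apply Rabs_le. lra.
  - assert (S1 : forall x, 0 <= x -> Rabs (sin_rem p x) <= 1 * x ^ S (2 * p + 2))
      by (apply (primitive_pow_bound (sin_rem p) (cos_rem p)); auto using sin_rem_derive, sin_rem_0; lra).
    assert (S2 : forall x, 0 <= x -> Rabs (sin_rem p x) <= 2 * x ^ S (2 * p))
      by (apply (primitive_pow_bound (sin_rem p) (cos_rem p)); auto using sin_rem_derive, sin_rem_0; lra).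
    split.
    + replace (2 * S p + 2)%nat with (S (S (2 * p + 2))) by lia.
      apply (primitive_pow_bound (cos_rem (S p)) (fun u => - sin_rem p u)); auto using cos_rem_derive_S, cos_rem_0; [lra|].
      intros x Hx. rewrite Rabs_Ropp. auto.
    + replace (2 * S p)%nat with (S (S (2 * p))) by lia.
      apply (primitive_pow_bound (cos_rem (S p)) (fun u => - sin_rem p u)); auto using cos_rem_derive_S, cos_rem_0; [lra|].
      intros x Hx. rewrite Rabs_Ropp. auto.
Qed.

Lemma le_double_of_le (a b : R) : a <= 1 * b -> 0 <= b -> a <= 2 * b.
Proof. lra. Qed.

Lemma moment_opp (h : R -> R) (q : nat) (l : R) : moment h q l -> moment (fun x => - h x) q (- l).
Proof.
  intros H. apply (moment_ext (fun x => (-1) * h x + 0 * h x) _ q ((-1) * l + 0 * l)); [intros; ring|ring|].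
  now apply moment_lin.
Qed.

(** Two integrations by parts lead from [p] to [p + 1]; their divisors [2p + 2] and [2p + 3] build
    the factorial, and [PI / 2] is the Dirichlet integral. *)
Lemma moment_cos_rem (p : nat) :
  moment (cos_rem p) (S (S (2 * p))) ((-1) ^ S p * PI / (2 * INR (fact (2 * p + 1)))).
Proof.
  induction p as [|p IH].
  - destruct (rem_bounds 0) as (B1 & B2 & _).
    apply (moment_ext (cos_rem 0) _ _ (- (PI / 2) / INR 1)); [auto|simpl; field|].
    apply (moment_step (cos_rem 0) (fun u => - sin u) 0 (- (PI / 2)) 2); [apply cos_rem_derive_0|apply moment_opp, moment_sin|lra| |exact B2].
    intros x Hx. apply le_double_of_le; [now apply B1|apply pow_le; auto].
  - destruct (rem_bounds p) as (_ & _ & B3 & B4).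
    destruct (rem_bounds (S p)) as (B1 & B2 & _).
    assert (M : moment (sin_rem p) (S (S (S (2 * p)))) ((-1) ^ S p * PI / (2 * INR (fact (2 * p + 1))) / INR (S (S (2 * p))))).
    { apply (moment_step (sin_rem p) (cos_rem p) (S (2 * p)) _ 2); [apply sin_rem_derive|exact IH|lra| |].
      - intros x Hx. apply le_double_of_le; [|apply pow_le; auto].
        replace (S (S (S (2 * p)))) with (2 * p + 3)%nat by lia. now apply B3.
      - intros x Hx. replace (S (2 * p)) with (2 * p + 1)%nat by lia. now apply B4. }
    replace (S (S (2 * S p))) with (S (S (S (S (2 * p))))) by lia.
    apply (moment_ext (cos_rem (S p)) _ _
      (- ((-1) ^ S p * PI / (2 * INR (fact (2 * p + 1))) / INR (S (S (2 * p)))) / INR (S (S (S (2 * p)))))); [auto| |].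
    + replace (2 * S p + 1)%nat with (S (S (2 * p + 1))) by lia. rewrite !fact_simpl, !mult_INR.
      replace (S (S (2 * p))) with (S (2 * p + 1)) by lia.
      change ((-1) ^ S (S p)) with ((-1) * (-1) ^ S p).
      field. repeat split; try apply INR_fact_neq_0; apply not_0_INR; lia.
    + apply (moment_step (cos_rem (S p)) (fun u => - sin_rem p u) (S (S (2 * p))) _ 2); [apply cos_rem_derive_S|now apply moment_opp|lra| |].
      * intros x Hx. apply le_double_of_le; [|apply pow_le; auto].
        replace (S (S (S (S (2 * p))))) with (2 * S p + 2)%nat by lia. now apply B1.
      * intros x Hx. replace (S (S (2 * p))) with (2 * S p)%nat by lia. now apply B2.
Qed.

(** * Central differences *)

(** The step is 2, so that at 0 the nodes [n - 2k] are integers and those of order [2m] are even. *)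
Fixpoint central_diff (n : nat) (phi : R -> R) (t : R) : R :=
  match n with 0%nat => phi t | S n => central_diff n phi (t + 1) - central_diff n phi (t - 1) end.

Notation binom := Binomial.C.

Lemma binom_0 (n : nat) : binom n 0 = 1.
Proof. unfold binom. rewrite Nat.sub_0_r. simpl. field. apply INR_fact_neq_0. Qed.

Lemma binom_n (n : nat) : binom n n = 1.
Proof. unfold binom. rewrite Nat.sub_diag. simpl. field. apply INR_fact_neq_0. Qed.

Lemma central_diff_rsum (n : nat) (phi : R -> R) (t : R) :
  central_diff n phi t = rsum (fun k => (-1) ^ k * binom n k * phi (t + INR n - 2 * INR k)) (S n).
Proof.
  revert t. induction n as [|n IH]; intros t.
  - simpl. rewrite binom_0. replace (t + 0 - 2 * 0) with t by ring. ring.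
  - change (central_diff n phi (t + 1) - central_diff n phi (t - 1) =
      rsum (fun k => (-1) ^ k * binom (S n) k * phi (t + INR (S n) - 2 * INR k)) (S (S n))).
    rewrite !IH.
    rewrite (rsum_head (fun k => (-1) ^ k * binom n k * phi (t + 1 + INR n - 2 * INR k))).
    rewrite (rsum_head (fun k => (-1) ^ k * binom (S n) k * phi (t + INR (S n) - 2 * INR k))).
    change (rsum (fun k => (-1) ^ k * binom n k * phi (t - 1 + INR n - 2 * INR k)) (S n)) with
      (rsum (fun k => (-1) ^ k * binom n k * phi (t - 1 + INR n - 2 * INR k)) n
       + (-1) ^ n * binom n n * phi (t - 1 + INR n - 2 * INR n)).
    change (rsum (fun k => (-1) ^ S k * binom (S n) (S k) * phi (t + INR (S n) - 2 * INR (S k))) (S n)) with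
      (rsum (fun k => (-1) ^ S k * binom (S n) (S k) * phi (t + INR (S n) - 2 * INR (S k))) n
       + (-1) ^ S n * binom (S n) (S n) * phi (t + INR (S n) - 2 * INR (S n))).
    rewrite (rsum_ext (fun k => (-1) ^ S k * binom (S n) (S k) * phi (t + INR (S n) - 2 * INR (S k)))
      (fun k => (-1) ^ S k * binom n (S k) * phi (t + 1 + INR n - 2 * INR (S k))
        + (-1) * ((-1) ^ k * binom n k * phi (t - 1 + INR n - 2 * INR k)))).
    + assert (Hadd : forall u v N, rsum (fun k => u k + (-1) * v k) N = rsum u N - rsum v N).
      { intros u v N. induction N as [|N IHN]; simpl; [ring|]. rewrite IHN. ring. }
      rewrite Hadd, !binom_0, !binom_n.
      replace (t + 1 + INR n - 2 * INR 0) with (t + INR (S n) - 2 * INR 0) by (rewrite S_INR; ring).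
      replace (t - 1 + INR n - 2 * INR n) with (t + INR (S n) - 2 * INR (S n)) by (rewrite S_INR; ring).
      simpl pow. ring.
    + intros k Hk. rewrite <- pascal by auto.
      replace (t + INR (S n) - 2 * INR (S k)) with (t + 1 + INR n - 2 * INR (S k)) by (rewrite (S_INR n); ring).
      replace (t - 1 + INR n - 2 * INR k) with (t + 1 + INR n - 2 * INR (S k)) by (rewrite (S_INR k); ring).
      simpl pow. ring.
Qed.

Lemma central_diff_ext (n : nat) (phi psi : R -> R) (t : R) : (forall s, phi s = psi s) -> central_diff n phi t = central_diff n psi t.
Proof. intros E. revert t. induction n as [|n IH]; intros t; simpl; [apply E|]. now rewrite !IH. Qed.

Lemma central_diff_lin (n : nat) (phi psi : R -> R) (c t : R) :
  central_diff n (fun s => phi s - c * psi s) t = central_diff n phi t - c * central_diff n psi t.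
Proof. revert t. induction n as [|n IH]; intros t; simpl; [reflexivity|]. rewrite !IH. ring. Qed.

Lemma central_diff_derive (n : nat) (phi dphi : R -> R) (t : R) :
  (forall s, is_derive phi s (dphi s)) -> is_derive (central_diff n phi) t (central_diff n dphi t).
Proof.
  intros H. revert t. induction n as [|n IH]; intros t; [apply H|].
  apply (is_derive_minus (V := R_NormedModule) (fun t => central_diff n phi (t + 1)) (fun t => central_diff n phi (t - 1)) t
    (central_diff n dphi (t + 1)) (central_diff n dphi (t - 1))).
  - rewrite <- (Rmult_1_l (central_diff n dphi (t + 1))).
    apply (is_derive_comp (central_diff n phi) (fun t => t + 1) t _ 1); [apply IH|]. auto_derive; auto.
  - rewrite <- (Rmult_1_l (central_diff n dphi (t - 1))).
    apply (is_derive_comp (central_diff n phi) (fun t => t - 1) t _ 1); [apply IH|]. auto_derive; auto.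
Qed.

Lemma is_derive_zero_const (h : R -> R) : (forall x, is_derive h x 0) -> forall x y, h x = h y.
Proof.
  assert (W : forall h x y, x <= y -> (forall x, is_derive h x 0) -> h x = h y).
  { clear h. intros h x y Hxy H.
    assert (B : Rabs (h y - h x) <= 0 - 0).
    { apply (is_derive_dominated h (fun _ => 0) (fun _ => 0) (fun _ => 0) x y Hxy); auto.
      - intros t _. apply (is_derive_const (K := R_AbsRing) (V := R_NormedModule)).
      - intros t _. rewrite Rabs_R0. lra. }
    assert (E : h y - h x = 0).
    { destruct (Req_dec (h y - h x) 0) as [E|N]; auto. apply Rabs_pos_lt in N. lra. }
    lra. }
  intros H x y. destruct (Rle_dec x y); [now apply W|symmetry; apply W; auto; lra].
Qed.

(** Induction on the degree: the difference of [x^(i+1)] has derivative [i + 1] times the difference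
    of [x^i]. One order lower that is already constant, so one more difference annihilates it. *)
Lemma central_diff_pow_const (i n : nat) (s t : R) : (i <= n)%nat -> central_diff n (fun x => x ^ i) s = central_diff n (fun x => x ^ i) t.
Proof.
  revert n s t. induction i as [|i IH]; intros n s t Hn.
  - clear Hn. revert s t. simpl pow. induction n as [|n IHn]; intros s t; [reflexivity|].
    simpl. rewrite (IHn (s + 1) (t + 1)), (IHn (s - 1) (t - 1)). reflexivity.
  - apply (is_derive_zero_const (central_diff n (fun x => x ^ S i))). intros x.
    (* The derivative is written as [phi - c psi] with [phi = 0], the form of [central_diff_lin]. *)
    replace 0 with (central_diff n (fun x => 0 - - INR (S i) * x ^ i) x).
    + apply central_diff_derive. intros y. replace (0 - - INR (S i) * y ^ i) with (INR (S i) * 1 * y ^ pred (S i)) by (simpl pred; ring).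
      apply (is_derive_pow (fun x => x) (S i) y 1). apply (is_derive_id (K := R_AbsRing)).
    + rewrite (central_diff_lin n (fun _ => 0) (fun x => x ^ i) (- INR (S i))).
      assert (Z : forall n t, central_diff n (fun _ => 0) t = 0).
      { clear. induction n as [|n IHn]; intros t; simpl; [reflexivity|]. rewrite !IHn. ring. }
      rewrite Z. destruct n as [|n]; [lia|]. simpl central_diff. rewrite (IH n (x + 1) (x - 1)) by lia. ring.
Qed.

Lemma central_diff_pow_zero (i n : nat) (t : R) : (i < n)%nat -> central_diff n (fun x => x ^ i) t = 0.
Proof.
  intros H. destruct n as [|n]; [lia|]. simpl. rewrite (central_diff_pow_const i n (t + 1) (t - 1)) by lia. ring.
Qed.

(** A double difference multiplies [cos (x u)] by [2 cos (2 u) - 2 = - 4 sin^2 u]. *)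
Lemma central_diff_cos (m : nat) (u t : R) : central_diff (2 * m) (fun x => cos (x * u)) t = (- 4 * sin u ^ 2) ^ m * cos (t * u).
Proof.
  revert t. induction m as [|m IH]; intros t; [simpl; ring|].
  replace (2 * S m)%nat with (S (S (2 * m))) by lia.
  change (central_diff (2 * m) (fun x => cos (x * u)) (t + 1 + 1) - central_diff (2 * m) (fun x => cos (x * u)) (t + 1 - 1)
    - (central_diff (2 * m) (fun x => cos (x * u)) (t - 1 + 1) - central_diff (2 * m) (fun x => cos (x * u)) (t - 1 - 1))
    = (- 4 * sin u ^ 2) ^ S m * cos (t * u)).
  rewrite !IH.
  replace (t + 1 - 1) with t by ring. replace (t - 1 + 1) with t by ring.
  replace ((t + 1 + 1) * u) with (t * u + 2 * u) by ring. replace ((t - 1 - 1) * u) with (t * u - 2 * u) by ring.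
  rewrite cos_plus, cos_minus, cos_2a_sin. simpl pow. ring.
Qed.

Lemma central_diff_cos_pol (N n : nat) (u t : R) : (2 * n <= N)%nat -> central_diff N (fun x => cos_pol n (x * u)) t = 0.
Proof.
  intros H. induction n as [|n IH].
  - unfold cos_pol. simpl rsum.
    assert (Z : forall n t, central_diff n (fun _ => 0) t = 0).
    { clear. induction n as [|n IHn]; intros t; simpl; [reflexivity|]. rewrite !IHn. ring. }
    apply Z.
  - rewrite (central_diff_ext N _ (fun x => cos_pol n (x * u) - - ((-1) ^ n * u ^ (2 * n) / INR (fact (2 * n))) * x ^ (2 * n))).
    + rewrite (central_diff_lin N (fun x => cos_pol n (x * u))), IH, central_diff_pow_zero by lia. ring.
    + intros s. unfold cos_pol. cbn [rsum]. rewrite Rpow_mult_distr. unfold Rdiv. ring.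
Qed.

Lemma cos_pol_even (n : nat) (u : R) : cos_pol n (- u) = cos_pol n u.
Proof.
  unfold cos_pol. apply rsum_ext. intros k _. rewrite !pow_mult. replace ((- u) ^ 2) with (u ^ 2) by ring. reflexivity.
Qed.

(** * Even powers of the sine as combinations of cosines *)

Definition node (m k : nat) : R := INR (2 * m) - 2 * INR k.

(** The coefficients of the central difference at 0, divided by [(-4)^m] so that the cosines
    [cos (node u)] combine to [sin u ^ (2m)]. *)
Definition weight (m k : nat) : R := (-1) ^ m / 4 ^ m * ((-1) ^ k * binom (2 * m) k).

(** Absolute values are taken because the scaling of moments asks for nonnegative frequencies. *)
Lemma weighted_even (m : nat) (phi : R -> R) : (forall t, phi (- t) = phi t) ->
  rsum (fun k => weight m k * phi (Rabs (node m k))) (S (2 * m)) = (-1) ^ m / 4 ^ m * central_diff (2 * m) phi 0.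
Proof.
  intros He. rewrite central_diff_rsum, <- rsum_scal. apply rsum_ext. intros k _.
  replace (phi (Rabs (node m k))) with (phi (node m k)).
  - unfold weight, node. rewrite Rplus_0_l. ring.
  - unfold Rabs. destruct (Rcase_abs (node m k)); auto.
Qed.

Lemma sin_pow_normalised (m : nat) (u : R) :
  (-1) ^ m / 4 ^ m * ((- 4 * sin u ^ 2) ^ m * cos (0 * u)) = sin u ^ (2 * m).
Proof.
  rewrite Rmult_0_l, cos_0. replace (- 4 * sin u ^ 2) with ((-1) * (4 * sin u ^ 2)) by ring.
  rewrite !Rpow_mult_distr, <- pow_mult.
  replace ((-1) ^ m / 4 ^ m * ((-1) ^ m * (4 ^ m * sin u ^ (2 * m)) * 1))
    with (((-1) ^ m * (-1) ^ m) * sin u ^ (2 * m)) by (field; apply pow_nonzero; lra).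
  rewrite <- Rpow_mult_distr. replace (-1 * -1) with 1 by ring. rewrite pow1. ring.
Qed.

Lemma weighted_cos (m : nat) (u : R) :
  rsum (fun k => weight m k * cos (Rabs (node m k) * u)) (S (2 * m)) = sin u ^ (2 * m).
Proof.
  rewrite (weighted_even m (fun t => cos (t * u))), central_diff_cos; [apply sin_pow_normalised|].
  intros t. rewrite <- cos_neg. f_equal. ring.
Qed.

Lemma weighted_cos_rem (m p : nat) (u : R) : (p < m)%nat ->
  rsum (fun k => weight m k * cos_rem p (Rabs (node m k) * u)) (S (2 * m)) = sin u ^ (2 * m).
Proof.
  intros Hp. rewrite (weighted_even m (fun t => cos_rem p (t * u))).
  - rewrite (central_diff_ext _ _ (fun t => cos (t * u) - 1 * cos_pol (S p) (t * u))) by (intros; unfold cos_rem; ring).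
    rewrite (central_diff_lin (2 * m) (fun t => cos (t * u)) (fun t => cos_pol (S p) (t * u)) 1), central_diff_cos, central_diff_cos_pol by lia.
    rewrite Rmult_0_r, Rminus_0_r. apply sin_pow_normalised.
  - intros t. replace (- t * u) with (- (t * u)) by ring. unfold cos_rem. now rewrite cos_neg, cos_pol_even.
Qed.

(** Arranged so that multiplication by the Taylor coefficient of degree [2m - 2l - 2] yields the
    term of index [l] in the theorem. *)
Definition sin_moment_value (m l : nat) (lambda : R) : R :=
  - (PI * (-1) ^ m * INR (fact (2 * m)) / 2 ^ (2 * m)) *
  ((-1) ^ l * 2 ^ (2 * l + 1) / INR (fact (2 * l + 1)) * lambda ^ (2 * l + 1) *
   rsum (fun k => (-1) ^ k * INR (m - k) ^ (2 * l + 1) / (INR (fact k) * INR (fact (2 * m - k)))) m).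

Lemma moment_sin_pow (m l : nat) (lambda : R) : 0 < lambda -> (l < m)%nat ->
  moment (fun x => sin (lambda * x) ^ (2 * m)) (S (S (2 * l))) (sin_moment_value m l lambda).
Proof.
  intros Hl Hlm.
  set (c := (-1) ^ S l * PI / (2 * INR (fact (2 * l + 1)))).
  apply (moment_ext (fun x => rsum (fun k => weight m k * cos_rem l (Rabs (node m k) * lambda * x)) (S (2 * m))) _ _
    (rsum (fun k => weight m k * ((Rabs (node m k) * lambda) ^ S (2 * l) * c)) (S (2 * m)))).
  - intros x _. rewrite <- (weighted_cos_rem m l (lambda * x)) by auto.
    apply rsum_ext. intros k _. now rewrite Rmult_assoc.
  - set (F := fun k => (-1) ^ k * binom (2 * m) k * Rabs (node m k) ^ S (2 * l)).
    rewrite (rsum_ext _ (fun k => (-1) ^ m / 4 ^ m * lambda ^ S (2 * l) * c * F k)).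
    2:{ intros k _. unfold weight, F. rewrite Rpow_mult_distr. ring. }
    (* The indices [k] and [2m - k] agree, which doubles the sum over [k < m], and the middle index
       contributes zero. For [k < m] the node is [2 (m - k)], the origin of
       [2^(2l+1) (m - k)^(2l+1)]. *)
    rewrite rsum_scal, rsum_symmetric.
    + replace (F m) with 0.
      2:{ unfold F, node. rewrite mult_INR. change (INR 2) with 2.
          replace (2 * INR m - 2 * INR m) with 0 by ring. rewrite Rabs_R0. simpl pow. ring. }
      rewrite (rsum_ext F (fun k => INR (fact (2 * m)) * 2 ^ S (2 * l) *
        ((-1) ^ k * INR (m - k) ^ (2 * l + 1) / (INR (fact k) * INR (fact (2 * m - k)))))).
      * rewrite rsum_scal. unfold sin_moment_value, c.
        replace (4 ^ m) with (2 ^ (2 * m)) by (rewrite pow_mult; f_equal; ring).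
        replace (2 * l + 1)%nat with (S (2 * l)) by lia.
        simpl ((-1) ^ S l). field. split; [apply INR_fact_neq_0|apply pow_nonzero; lra].
      * intros k Hk. unfold F, node, binom. rewrite Rabs_pos_eq.
        -- rewrite minus_INR by lia. rewrite mult_INR. change (INR 2) with 2.
           replace (2 * INR m - 2 * INR k) with (2 * (INR m - INR k)) by ring.
           rewrite Rpow_mult_distr. replace (2 * l + 1)%nat with (S (2 * l)) by lia.
           field. split; apply INR_fact_neq_0.
        -- rewrite mult_INR. change (INR 2) with 2. apply lt_INR in Hk. lra.
    + intros k Hk. unfold F. 
      replace ((-1) ^ (2 * m - k)) with ((-1) ^ k).
      2:{ replace ((-1) ^ k) with ((-1) ^ k * 1) by ring. rewrite <- (pow_1_even (m - k)), <- pow_add. f_equal. lia. }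
      f_equal; [f_equal|].
      * unfold binom. replace (2 * m - (2 * m - k))%nat with k by lia. rewrite (Rmult_comm (INR (fact k))). reflexivity.
      * f_equal. unfold node. rewrite minus_INR by lia. rewrite <- Rabs_Ropp. f_equal. rewrite mult_INR. simpl (INR 2). ring.
  - apply (moment_rsum (fun k x => cos_rem l (Rabs (node m k) * lambda * x))). intros k _.
    apply moment_scale; [apply Rmult_le_pos; [apply Rabs_pos|lra]|apply cos_rem_0|apply moment_cos_rem].
Qed.

Lemma weight_middle (m : nat) : weight m m = INR (fact (2 * m)) / (2 ^ (2 * m) * INR (fact m) ^ 2).
Proof.
  unfold weight, binom. replace (2 * m - m)%nat with m by lia.
  replace (4 ^ m) with (2 ^ (2 * m)) by (rewrite pow_mult; f_equal; ring).
  replace ((-1) ^ m / 2 ^ (2 * m) * ((-1) ^ m * (INR (fact (2 * m)) / (INR (fact m) * INR (fact m)))))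
    with ((-1) ^ m * (-1) ^ m * (INR (fact (2 * m)) / (2 ^ (2 * m) * INR (fact m) ^ 2))).
  - rewrite <- Rpow_mult_distr. replace (-1 * -1) with 1 by ring. rewrite pow1. ring.
  - field. split; [apply INR_fact_neq_0|apply pow_nonzero; lra].
Qed.

(** * Integration of the expansion *)

Lemma rderiv_intro (f : R -> C) (t : R) (l : C) :
  (forall eps, 0 < eps -> exists del, 0 < del /\ forall s, Rabs (s - t) < del ->
     Cmod (f s - f t - RtoC (s - t) * l) <= eps * Rabs (s - t)) -> rderiv f t l.
Proof.
  intros H. split; [apply is_linear_scal_l|].
  intros x Hx. apply (is_filter_lim_locally_unique (V := R_NormedModule)) in Hx. subst x.
  intros [eps He]. destruct (H eps He) as [d [Hd Hs]].
  exists (mkposreal d Hd). intros s Hst. specialize (Hs s Hst). simpl.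
  change (norm (minus s t)) with (Rabs (s - t)).
  match goal with |- norm ?u <= _ => replace u with (f s - f t - RtoC (s - t) * l)%C end.
  - rewrite norm_Cmod. exact Hs.
  - change (minus s t) with (s - t).
    apply C_ext; simpl; unfold plus, opp, scal; simpl; unfold mult; simpl; ring.
Qed.

Lemma rderiv_elim (f : R -> C) (t : R) (l : C) : rderiv f t l ->
  forall eps, 0 < eps -> exists del, 0 < del /\ forall s, Rabs (s - t) < del ->
     Cmod (f s - f t - RtoC (s - t) * l) <= eps * Rabs (s - t).
Proof.
  intros [_ H] eps He. destruct (H t (fun P HP => HP) (mkposreal eps He)) as [d Hd].
  exists d. split; [apply cond_pos|]. intros s Hst. specialize (Hd s Hst). simpl in Hd.
  change (norm (minus s t)) with (Rabs (s - t)) in Hd.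
  match type of Hd with norm ?u <= _ => replace u with (f s - f t - RtoC (s - t) * l)%C in Hd end.
  - rewrite norm_Cmod in Hd. exact Hd.
  - change (minus s t) with (s - t).
    apply C_ext; simpl; unfold plus, opp, scal; simpl; unfold mult; simpl; ring.
Qed.

Lemma rderiv_plus (f g : R -> C) (t : R) (l k : C) : rderiv f t l -> rderiv g t k ->
  rderiv (fun s => f s + g s)%C t (l + k)%C.
Proof. intros Hf Hg. exact (is_derive_plus (V := C_R_NormedModule) f g t l k Hf Hg). Qed.

Lemma rderiv_scal (c : C) (f : R -> C) (t : R) (l : C) : rderiv f t l ->
  rderiv (fun s => c * f s)%C t (c * l)%C.
Proof.
  intros Hf. apply rderiv_intro. intros eps He. pose proof (Cmod_ge_0 c) as Pc.
  destruct (rderiv_elim f t l Hf (eps / (Cmod c + 1))) as [d [Hd H]]; [apply Rdiv_lt_0_compat; lra|].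
  exists d. split; auto. intros s Hs. specialize (H s Hs).
  replace (c * f s - c * f t - RtoC (s - t) * (c * l))%C with (c * (f s - f t - RtoC (s - t) * l))%C by ring.
  rewrite Cmod_mult.
  apply Rle_trans with ((Cmod c + 1) * (eps / (Cmod c + 1) * Rabs (s - t))).
  - apply Rmult_le_compat; auto using Cmod_ge_0. lra.
  - right. field. lra.
Qed.

Lemma rderiv_RtoC (f : R -> R) (t l : R) : is_derive f t l -> rderiv (fun s => RtoC (f s)) t (RtoC l).
Proof.
  intros [_ H]. apply rderiv_intro. intros eps He.
  destruct (H t (fun P HP => HP) (mkposreal eps He)) as [d Hd].
  exists d. split; [apply cond_pos|]. intros s Hst. specialize (Hd s Hst). simpl in Hd.
  rewrite <- RtoC_mult, <- !RtoC_minus, Cmod_R. exact Hd.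
Qed.

Lemma tends_ext (u v : R -> C) (L : C) (X : R) : (forall x, X < x -> u x = v x) -> tends u L -> tends v L.
Proof.
  intros E H e He. destruct (H e He) as [Y HY]. exists (Rmax (X + 1) Y). intros x Hx.
  pose proof (Rmax_l (X + 1) Y). pose proof (Rmax_r (X + 1) Y). rewrite <- E by lra. apply HY. lra.
Qed.

Lemma tends_plus (u v : R -> C) (L K : C) : tends u L -> tends v K -> tends (fun x => u x + v x)%C (L + K).
Proof.
  intros Hu Hv e He. destruct (Hu (e / 2)) as [X HX]; [lra|]. destruct (Hv (e / 2)) as [Y HY]; [lra|].
  exists (Rmax X Y). intros x Hx. pose proof (Rmax_l X Y). pose proof (Rmax_r X Y).
  specialize (HX x ltac:(lra)). specialize (HY x ltac:(lra)).
  replace (u x + v x - (L + K))%C with ((u x - L) + (v x - K))%C by ring.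
  eapply Rle_trans; [apply Cmod_triangle|]. lra.
Qed.

Lemma tends_scal (c : C) (u : R -> C) (L : C) : tends u L -> tends (fun x => c * u x)%C (c * L).
Proof.
  intros Hu e He. pose proof (Cmod_ge_0 c) as Pc.
  destruct (Hu (e / (Cmod c + 1))) as [X HX]; [apply Rdiv_lt_0_compat; lra|].
  exists X. intros x Hx. specialize (HX x Hx).
  replace (c * u x - c * L)%C with (c * (u x - L))%C by ring. rewrite Cmod_mult.
  apply Rle_trans with ((Cmod c + 1) * (e / (Cmod c + 1))); [|right; field; lra].
  apply Rmult_le_compat; auto using Cmod_ge_0. lra.
Qed.

Lemma tends0_plus (u v : R -> C) (L K : C) : tends0 u L -> tends0 v K -> tends0 (fun x => u x + v x)%C (L + K).
Proof.
  intros Hu Hv e He. destruct (Hu (e / 2)) as [X [HX0 HX]]; [lra|]. destruct (Hv (e / 2)) as [Y [HY0 HY]]; [lra|].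
  exists (Rmin X Y). split; [now apply Rmin_glb_lt|]. intros x Hx. pose proof (Rmin_l X Y). pose proof (Rmin_r X Y).
  specialize (HX x ltac:(lra)). specialize (HY x ltac:(lra)).
  replace (u x + v x - (L + K))%C with ((u x - L) + (v x - K))%C by ring.
  eapply Rle_trans; [apply Cmod_triangle|]. lra.
Qed.

Lemma tends0_scal (c : C) (u : R -> C) (L : C) : tends0 u L -> tends0 (fun x => c * u x)%C (c * L).
Proof.
  intros Hu e He. pose proof (Cmod_ge_0 c) as Pc.
  destruct (Hu (e / (Cmod c + 1))) as [X [HX0 HX]]; [apply Rdiv_lt_0_compat; lra|].
  exists X. split; auto. intros x Hx. specialize (HX x Hx).
  replace (c * u x - c * L)%C with (c * (u x - L))%C by ring. rewrite Cmod_mult.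
  apply Rle_trans with ((Cmod c + 1) * (e / (Cmod c + 1))); [|right; field; lra].
  apply Rmult_le_compat; auto using Cmod_ge_0. lra.
Qed.

Lemma tends0_const (c : C) : tends0 (fun _ => c) c.
Proof.
  intros e He. exists 1. split; [lra|]. intros x _. replace (c - c)%C with (RtoC 0) by ring. rewrite Cmod_0. lra.
Qed.

Lemma tends0_rcont (u : R -> C) : rcont u 0 -> tends0 u (u 0).
Proof.
  intros H e He. destruct (rcont_elim u 0 H e He) as [d [Hd Hs]]. exists d. split; auto.
  intros x Hx. left. apply Hs. rewrite Rminus_0_r, Rabs_pos_eq; lra.
Qed.

Lemma rcont_rderiv (u : R -> C) (t : R) (l : C) : rderiv u t l -> rcont u t.
Proof. intros H. apply (ex_derive_continuous (V := C_R_NormedModule)). exists l. exact H. Qed.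

(** The possibly conditional integral of [h] over the half line, encoded by a primitive vanishing at
    [0+] and tending to [l]; linear combinations are then immediate. *)
Definition Cmoment (h : R -> C) (l : C) : Prop :=
  exists D, (forall x, 0 < x -> rderiv D x (h x)) /\ tends0 D 0 /\ tends D l.

Lemma Cmoment_ext (h k : R -> C) (l l' : C) : (forall x, 0 < x -> h x = k x) -> l = l' -> Cmoment h l -> Cmoment k l'.
Proof. intros E <- (D & HD & H). exists D. split; auto. intros x Hx. rewrite <- E by auto. auto. Qed.

Lemma Cmoment_plus (h k : R -> C) (l r : C) : Cmoment h l -> Cmoment k r -> Cmoment (fun x => h x + k x)%C (l + r).
Proof.
  intros (A & HA & A0 & AI) (B & HB & B0 & BI). exists (fun x => A x + B x)%C. split; [|split].
  - intros x Hx. apply rderiv_plus; auto.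
  - replace (RtoC 0) with (0 + 0)%C by ring. now apply tends0_plus.
  - now apply tends_plus.
Qed.

Lemma Cmoment_scal (c : C) (h : R -> C) (l : C) : Cmoment h l -> Cmoment (fun x => c * h x)%C (c * l).
Proof.
  intros (A & HA & A0 & AI). exists (fun x => c * A x)%C. split; [|split].
  - intros x Hx. apply rderiv_scal; auto.
  - replace (RtoC 0) with (c * 0)%C by ring. now apply tends0_scal.
  - now apply tends_scal.
Qed.

Lemma Cmoment_csum (h : nat -> R -> C) (c l : nat -> C) (n : nat) :
  (forall k, (k <= n)%nat -> Cmoment (h k) (l k)) ->
  Cmoment (fun x => csum (fun k => c k * h k x)%C n) (csum (fun k => c k * l k)%C n).
Proof.
  induction n as [|n IH]; intros H.
  - apply (Cmoment_ext (fun x => c 0%nat * h 0%nat x)%C _ (c 0%nat * l 0%nat)%C).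
    + intros x _. now rewrite csum_O.
    + now rewrite csum_O.
    + apply Cmoment_scal, H. lia.
  - apply (Cmoment_ext (fun x => csum (fun k => c k * h k x)%C n + c (S n) * h (S n) x)%C _
      (csum (fun k => c k * l k)%C n + c (S n) * l (S n))%C).
    + intros x _. now rewrite csum_S.
    + now rewrite csum_S.
    + apply Cmoment_plus; [apply IH; intros; apply H; lia|apply Cmoment_scal, H; lia].
Qed.

Lemma Cmoment_of_moment (h : R -> R) (q : nat) (l : R) : moment h q l ->
  Cmoment (fun x => RtoC (h x / x ^ q)) (RtoC l).
Proof.
  intros (A & HA & A0 & AI). exists (fun x => RtoC (A x)). split; [|split].
  - intros x Hx. apply rderiv_RtoC. auto.
  - intros e He. destruct (A0 e He) as [d [Hd H]]. exists d. split; auto. intros x Hx.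
    rewrite <- RtoC_minus, Cmod_R. auto.
  - intros e He. destruct (AI e He) as [X H]. exists X. intros x Hx.
    rewrite <- RtoC_minus, Cmod_R. auto.
Qed.

Lemma integral_0_infty_of_Cmoment (h : R -> C) (l : C) : (forall x, 0 < x -> rcont h x) ->
  Cmoment h l -> is_integral_0_infty h l.
Proof.
  intros Hc (D & HD & D0 & DI). replace l with (l - 0)%C by ring.
  now apply (integral_0_infty_of_primitive h D).
Qed.

Lemma csum_RtoC (u : nat -> R) (n : nat) : csum (fun k => RtoC (u k)) n = RtoC (rsum u (S n)).
Proof.
  induction n as [|n IH]; [rewrite csum_O; simpl; now rewrite Rplus_0_l|].
  rewrite csum_S, IH, <- RtoC_plus. reflexivity.
Qed.

Lemma csum_single (u : nat -> C) (n m : nat) : (m <= n)%nat -> (forall k, (k <= n)%nat -> k <> m -> u k = 0) ->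
  csum u n = u m.
Proof.
  induction n as [|n IH]; intros Hm H.
  - rewrite csum_O. f_equal. lia.
  - rewrite csum_S. destruct (Nat.eq_dec m (S n)) as [->|N].
    + rewrite (csum_ext u (fun _ => 0 * 0)%C).
      * rewrite csum_scal. ring.
      * intros k Hk. rewrite H by lia. ring.
    + rewrite IH, (H (S n)) by (try lia; intros; apply H; lia). ring.
Qed.

Lemma csum_head (u : nat -> C) (n : nat) : csum u (S n) = (u 0%nat + csum (fun k => u (S k)) n)%C.
Proof.
  induction n as [|n IH]; [rewrite csum_S, !csum_O; reflexivity|].
  rewrite csum_S, IH, (csum_S (fun k => u (S k))). ring.
Qed.

Lemma csum_rev (u : nat -> C) (n : nat) : csum (fun j => u (n - j)%nat) n = csum u n.
Proof.
  induction n as [|n IH]; [reflexivity|].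
  rewrite csum_head, csum_S, Cplus_comm. f_equal. rewrite <- IH.
  apply csum_ext. intros k Hk. f_equal.
Qed.

Lemma sum_n_rsum (u : nat -> R) (n : nat) : sum_n u n = rsum u (S n).
Proof.
  induction n as [|n IH]; [rewrite sum_O; simpl; ring|].
  rewrite sum_Sn, IH. reflexivity.
Qed.

(** * The polar part at zero and its divergent terms *)

(** For [j <= n], [x^(2j) / x^(2n+2)] is [1 / x^(polar_expo + 1)], whose primitive has exponent
    [polar_expo]. That exponent is odd, hence positive, and no logarithm occurs. *)
Definition polar_expo (n j : nat) : nat := S (2 * (n - j)).

(** The integral from [x] to infinity of the negative powers of index up to [k]; the bound [k] is
    kept apart from [n] for inductions. *)
Definition polar_part (c : nat -> C) (n k : nat) (x : R) : C :=
  csum (fun j => c j * RtoC (/ (INR (polar_expo n j) * x ^ polar_expo n j)))%C k.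

Definition polar_term (c : nat -> C) (n j : nat) : asym_term :=
  AsymTerm (c j * RtoC (/ INR (polar_expo n j)))%C (INR (polar_expo n j)) 0.

Fixpoint polar_terms (c : nat -> C) (n k : nat) : list asym_term :=
  match k with
  | 0%nat => polar_term c n 0 :: nil
  | S k' => polar_term c n (S k') :: polar_terms c n k'
  end.

Lemma polar_expo_pos (n j : nat) : 0 < INR (polar_expo n j).
Proof. apply lt_0_INR. unfold polar_expo. lia. Qed.

Lemma polar_terms_divergent (c : nat -> C) (n k : nat) : List.Forall divergent_term (polar_terms c n k).
Proof.
  induction k as [|k IH]; constructor; auto; left; apply polar_expo_pos.
Qed.

Lemma polar_term_val (c : nat -> C) (n j : nat) (x : R) : 0 < x ->
  term_val (polar_term c n j) x = (c j * RtoC (/ (INR (polar_expo n j) * x ^ polar_expo n j)))%C.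
Proof.
  intros Hx. unfold term_val. cbn [coef expo logp polar_term].
  rewrite Rpower_Ropp, Rpower_pow by auto.
  rewrite <- Cmult_assoc, <- RtoC_mult. f_equal. f_equal. simpl pow at 2.
  rewrite Rmult_1_r, Rinv_mult. reflexivity.
Qed.

Lemma polar_terms_val (c : nat -> C) (n k : nat) (x : R) : 0 < x ->
  terms_val (polar_terms c n k) x = polar_part c n k x.
Proof.
  intros Hx. induction k as [|k IH].
  - simpl polar_terms. rewrite terms_val_cons, polar_term_val by auto.
    change (terms_val nil x) with (RtoC 0). unfold polar_part. rewrite csum_O. ring.
  - simpl polar_terms. rewrite terms_val_cons, polar_term_val, IH by auto.
    unfold polar_part. rewrite csum_S. ring.
Qed.

Lemma polar_part_tends (c : nat -> C) (n k : nat) : tends (polar_part c n k) 0.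
Proof.
  assert (W : forall j, tends (fun x => c j * RtoC (/ (INR (polar_expo n j) * x ^ polar_expo n j)))%C 0).
  { intros j. replace (RtoC 0) with (c j * 0)%C by ring. apply tends_scal.
    intros e He. exists (Rmax 1 (/ e)). intros x Hx.
    pose proof (Rmax_l 1 (/ e)). pose proof (Rmax_r 1 (/ e)).
    rewrite <- RtoC_minus, Cmod_R, Rminus_0_r.
    assert (P1 : 1 <= INR (polar_expo n j)) by (apply (le_INR 1); unfold polar_expo; lia).
    assert (P2 : x <= x ^ polar_expo n j).
    { unfold polar_expo. simpl. rewrite <- (Rmult_1_r x) at 1. apply Rmult_le_compat_l; [lra|].
      apply pow_R1_Rle. lra. }
    assert (P3 : x <= INR (polar_expo n j) * x ^ polar_expo n j).
    { rewrite <- (Rmult_1_l x) at 1. apply Rmult_le_compat; lra. }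
    rewrite Rabs_pos_eq by (left; apply Rinv_0_lt_compat; lra).
    rewrite <- (Rinv_inv e). apply Rinv_le_contravar; [now apply Rinv_0_lt_compat|lra]. }
  unfold polar_part. induction k as [|k IH].
  - apply (tends_ext (fun x => c 0%nat * RtoC (/ (INR (polar_expo n 0) * x ^ polar_expo n 0)))%C _ _ 0).
    + intros x _. now rewrite csum_O.
    + apply W.
  - replace (RtoC 0) with (0 + 0)%C by ring.
    apply (tends_ext (fun x => polar_part c n k x + c (S k) * RtoC (/ (INR (polar_expo n (S k)) * x ^ polar_expo n (S k))))%C _ _ 0).
    + intros x _. unfold polar_part. now rewrite csum_S.
    + now apply tends_plus.
Qed.

Lemma polar_part_rderiv (c : nat -> C) (n k : nat) (x : R) : 0 < x ->
  rderiv (polar_part c n k) x (- csum (fun j => c j * RtoC (/ x ^ S (polar_expo n j))) k)%C.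
Proof.
  intros Hx.
  assert (W : forall j, rderiv (fun x => c j * RtoC (/ (INR (polar_expo n j) * x ^ polar_expo n j)))%C x
    (c j * RtoC (- / x ^ S (polar_expo n j)))%C).
  { intros j. apply rderiv_scal, rderiv_RtoC. set (p := polar_expo n j).
    assert (Hp : INR p <> 0) by (apply Rgt_not_eq, polar_expo_pos).
    assert (Hxp : x ^ p <> 0) by (apply pow_nonzero; lra).
    replace (- / x ^ S p) with (- (INR p * (INR p * 1 * x ^ pred p)) / (INR p * x ^ p) ^ 2).
    - apply (is_derive_inv (fun x => INR p * x ^ p) x (INR p * (INR p * 1 * x ^ pred p))); [|apply Rmult_integral_contrapositive; auto].
      apply (is_derive_scal (fun x => x ^ p) x (INR p)).
      apply (is_derive_pow (fun x => x) p x 1). apply (is_derive_id (K := R_AbsRing)).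
    - revert Hp Hxp. unfold p, polar_expo. generalize (INR (S (2 * (n - j)))). generalize (2 * (n - j))%nat.
      intros q r Hr Hxp. simpl pred. simpl pow in *. field. repeat split; auto; try lra.
      intro E. apply Hxp. rewrite E. ring. }
  induction k as [|k IH].
  - apply (rderiv_ext (fun x => c 0%nat * RtoC (/ (INR (polar_expo n 0) * x ^ polar_expo n 0)))%C).
    + intros s. unfold polar_part. now rewrite csum_O.
    + eapply eq_rect; [apply W|]. rewrite csum_O, RtoC_opp. ring.
  - apply (rderiv_ext (fun x => polar_part c n k x + c (S k) * RtoC (/ (INR (polar_expo n (S k)) * x ^ polar_expo n (S k))))%C).
    + intros s. unfold polar_part. now rewrite csum_S.
    + eapply eq_rect; [apply rderiv_plus; [apply IH|apply W]|]. rewrite csum_S, RtoC_opp. ring.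
Qed.

Definition neg_term (t : asym_term) : asym_term := AsymTerm (- coef t)%C (expo t) (logp t).

Lemma neg_terms_val (ts : list asym_term) (x : R) : terms_val (List.map neg_term ts) x = (- terms_val ts x)%C.
Proof.
  induction ts as [|t ts IH].
  - simpl. change (terms_val nil x) with (RtoC 0). ring.
  - cbn [List.map]. rewrite !terms_val_cons, IH. unfold term_val. cbn [coef expo logp neg_term]. ring.
Qed.

Lemma neg_terms_divergent (ts : list asym_term) :
  List.Forall divergent_term ts -> List.Forall divergent_term (List.map neg_term ts).
Proof. intros H. induction H as [|t ts Ht _ IH]; constructor; auto. Qed.

(** * Identification of the finite part and evaluation of the integral *)

Section Assembly.
Variables (f g G : C -> C) (A s lambda : R) (n : nat) (L : C).
Let m := S n.
Let c := taylor_coef f.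
Hypotheses (f_holo : forall z, holo f z) (g_holo : forall z, holo g z)
  (g_even : forall z, g (- z)%C = g z)
  (f_taylor : forall z, f z = (csum (fun j => c j * z ^ (2 * j))%C n + z ^ (2 * S n) * g z)%C)
  (A_ge0 : 0 <= A) (s_gt0 : 0 < s) (s_lt : s < 2 * lambda)
  (g_growth : forall z, Cmod (g z) <= A * exp (s * Cmod z))
  (G_deriv : forall z, cderiv G z (g z)) (G_0 : G 0 = 0).

Let F (x : R) : C := (f (RtoC x) / RtoC (x ^ (2 * m)))%C.
(** A primitive of [F] on the positive axis; the polar part is subtracted because it is a tail
    integral. It has the same limit at infinity as [G]. *)
Let U (x : R) : C := (G (x, 0%R) + - (1) * polar_part c n n x)%C.

Lemma RtoC_pow_nz (x : R) (k : nat) : 0 < x -> RtoC (x ^ k) <> 0%C.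
Proof. intros Hx. apply RtoC_nz, pow_nonzero. lra. Qed.

Lemma laurent_expansion (x : R) : 0 < x ->
  F x = (g (RtoC x) + csum (fun j => c j * RtoC (/ x ^ S (polar_expo n j))) n)%C.
Proof.
  intros Hx. unfold F, m. rewrite f_taylor.
  replace (csum (fun j => c j * RtoC x ^ (2 * j))%C n)
    with (RtoC (x ^ (2 * S n)) * csum (fun j => c j * RtoC (/ x ^ S (polar_expo n j))) n)%C.
  - rewrite <- RtoC_pow. field. now apply RtoC_pow_nz.
  - rewrite <- csum_scal. apply csum_ext. intros j Hj.
    rewrite <- RtoC_pow. rewrite Cmult_assoc, (Cmult_comm (RtoC (x ^ _))), <- Cmult_assoc, <- RtoC_mult.
    f_equal. f_equal.
    replace (2 * S n)%nat with (2 * j + S (polar_expo n j))%nat by (unfold polar_expo; lia).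
    rewrite pow_add. field. repeat split; apply pow_nonzero; lra.
Qed.

Lemma U_rderiv (x : R) : 0 < x -> rderiv U x (F x).
Proof.
  intros Hx. rewrite laurent_expansion by auto. unfold U.
  eapply eq_rect; [apply rderiv_plus; [apply rderiv_horizontal, G_deriv|apply rderiv_scal, polar_part_rderiv; auto]|].
  change ((x, 0) : C) with (RtoC x). ring.
Qed.

Lemma rcont_quotient (h : R -> C) (k : nat) (x : R) : 0 < x -> rcont h x ->
  rcont (fun x => h x / RtoC (x ^ k))%C x.
Proof.
  intros Hx Hh.
  assert (R1 : rcont (fun x => / RtoC (x ^ k))%C x).
  { apply (rcont_ccont Cinv (fun x => RtoC (x ^ k))).
    - apply rcont_RtoC. apply (ex_derive_continuous (V := R_NormedModule)). auto_derive. auto.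
    - apply ccont_Cinv. now apply RtoC_pow_nz. }
  exact (rcont_mult h _ x Hh R1).
Qed.

Lemma f_rcont (x : R) : rcont (fun x => f (RtoC x)) x.
Proof. apply (gcont_horizontal f 0 x). intros z. now apply holo_ccont. Qed.

Lemma F_rcont (x : R) : 0 < x -> rcont F x.
Proof. intros Hx. apply (rcont_quotient (fun x => f (RtoC x)) (2 * m) x Hx), f_rcont. Qed.

Lemma G_tends_of_U : tends U L -> tends (fun x => G (x, 0)) L.
Proof.
  intros H. replace L with (L + 0)%C by ring.
  apply (tends_ext (fun x => U x + polar_part c n n x)%C _ _ 0).
  - intros x _. unfold U. ring.
  - apply tends_plus; [exact H|apply polar_part_tends].
Qed.

Lemma G_tends0 : tends0 (fun x => G (x, 0)) 0.
Proof.
  rewrite <- G_0. apply (tends0_rcont (fun x => G (x, 0))).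
  apply gcont_horizontal. intros z. eapply cderiv_ccont. apply G_deriv.
Qed.

(** The tail integral [L - U eps] is the polar part plus [L - G eps], and [G] vanishes at 0. *)
Lemma finite_part_exists : tends U L -> is_finite_part F L.
Proof.
  intros HU. exists (polar_terms c n n), (fun x => L + - (1) * G (x, 0%R))%C. split; [|split].
  - apply polar_terms_divergent.
  - intros eps He. rewrite polar_terms_val by auto.
    replace (polar_part c n n eps + (L + - (1) * G (eps, 0%R)))%C with (L - U eps)%C by (unfold U; ring).
    apply (tail_integral_of_primitive F U U_rderiv F_rcont eps L He HU).
  - apply filterlim_tends0.
    assert (T : tends0 (fun x => L + - (1) * G (x, 0%R))%C (L + - (1) * 0)%C)
      by (apply tends0_plus; [apply tends0_const|apply tends0_scal, G_tends0]).
    replace (L + - (1) * 0)%C with L in T by ring. exact T.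
Qed.

(** Subtracting the polar decomposition from any other leaves a list of divergent terms that tends
    to [L - FP]; such a limit can only be zero. *)
Lemma finite_part_unique (FP : C) : tends U L -> is_finite_part F FP -> FP = L.
Proof.
  intros HU (ts & Ce & Hdiv & Htail & HCe). apply filterlim_tends0 in HCe.
  assert (Z : (L - FP)%C = 0%C).
  { apply (divergent_terms_limit (ts ++ List.map neg_term (polar_terms c n n))).
    - apply List.Forall_app. split; [exact Hdiv|apply neg_terms_divergent, polar_terms_divergent].
    - assert (T : tends0 (fun x => (L + - (1) * G (x, 0%R)) + - (1) * Ce x)%C ((L + - (1) * 0) + - (1) * FP)%C).
      { apply tends0_plus; [apply tends0_plus; [apply tends0_const|apply tends0_scal, G_tends0]|apply tends0_scal, HCe]. }
      intros e He. destruct (T e He) as [d [Hd H]]. exists d. split; auto. intros x Hx.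
      specialize (H x Hx). rewrite terms_val_app, neg_terms_val, polar_terms_val by lra.
      assert (E := tail_integral_value F U U_rderiv F_rcont x _ L (proj1 Hx) HU (Htail x (proj1 Hx))).
      replace (terms_val ts x) with (terms_val ts x + Ce x - Ce x)%C by ring. rewrite E. unfold U.
      replace (L - (G (x, 0%R) + - (1) * polar_part c n n x) - Ce x + - polar_part c n n x - (L - FP))%C
        with (L + - (1) * G (x, 0%R) + - (1) * Ce x - (L + - (1) * 0 + - (1) * FP))%C by ring.
      exact H. }
  replace FP with (L - (L - FP))%C by ring. rewrite Z. ring.
Qed.

Hypothesis G_tends : tends (fun x => G (x, 0)) L.

(** At the middle node the frequency is zero and the integral is that of [g]. The other nodes are
    nonzero even integers, so their frequencies are at least [2 lambda > s] and the cosine transform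
    vanishes. *)
Lemma cosine_Cmoment (k : nat) :
  Cmoment (fun x => g (RtoC x) * RtoC (cos (Rabs (node m k) * (lambda * x))))%C
    (if Nat.eq_dec k m then L else 0).
Proof.
  destruct (Nat.eq_dec k m) as [->|N].
  - exists (fun x => G (x, 0)). split; [|split; [apply G_tends0|exact G_tends]].
    intros x Hx. unfold node. rewrite mult_INR. change (INR 2) with 2.
    replace (2 * INR m - 2 * INR m) with 0 by ring. rewrite Rabs_R0, Rmult_0_l, cos_0, Cmult_1_r.
    apply rderiv_horizontal, G_deriv.
  - assert (Hnode : 2 <= Rabs (node m k)).
    { unfold node. rewrite mult_INR. change (INR 2) with 2.
      destruct (Nat.lt_total k m) as [H|[H|H]]; [|easy|].
      - apply le_INR in H. rewrite S_INR in H. rewrite Rabs_pos_eq; lra.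
      - apply le_INR in H. rewrite S_INR in H. rewrite Rabs_left; lra. }
    destruct (fourier_cosine_vanishes g G A s (Rabs (node m k) * lambda) L g_holo g_even A_ge0 s_gt0)
      as (D & D0 & HD & DI); auto.
    { apply Rlt_le_trans with (2 * lambda); [lra|]. apply Rmult_le_compat_r; lra. }
    exists D. split; [|split; auto].
    + intros x _. rewrite <- Rmult_assoc. apply HD.
    + rewrite <- D0. apply tends0_rcont. eapply rcont_rderiv. apply HD.
Qed.

Lemma integrand_expansion (x : R) : 0 < x ->
  (f (RtoC x) * RtoC (sin (lambda * x) ^ (2 * m)) / RtoC (x ^ (2 * m)))%C =
  (csum (fun k => RtoC (weight m k) * (g (RtoC x) * RtoC (cos (Rabs (node m k) * (lambda * x)))))%C (2 * m)
   + csum (fun j => c j * RtoC (sin (lambda * x) ^ (2 * m) / x ^ S (polar_expo n j)))%C n)%C.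
Proof.
  intros Hx. set (S0 := sin (lambda * x) ^ (2 * m)).
  replace (f (RtoC x) * RtoC S0 / RtoC (x ^ (2 * m)))%C with (RtoC S0 * F x)%C
    by (unfold F; field; now apply RtoC_pow_nz).
  rewrite laurent_expansion, Cmult_plus_distr_l by auto. f_equal.
  - rewrite (csum_ext _ (fun k => g (RtoC x) * RtoC (weight m k * cos (Rabs (node m k) * (lambda * x))))%C)
      by (intros; rewrite RtoC_mult; ring).
    rewrite csum_scal, csum_RtoC, weighted_cos. unfold S0. ring.
  - rewrite <- csum_scal. apply csum_ext. intros j _. unfold Rdiv. rewrite RtoC_mult. ring.
Qed.

(** The Taylor index [j] and the index [l] of the theorem are related by [j = n - l], since
    [2m - 2l - 2 = 2 (n - l)]. *)
Lemma Clm_moment (l : nat) : (l <= n)%nat ->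
  (c (n - l)%nat * RtoC (sin_moment_value m l lambda))%C =
  (- RtoC (PI * (-1) ^ m * INR (fact (2 * m)) / 2 ^ (2 * m)) * (Clm f l m * RtoC (lambda ^ (2 * l + 1))))%C.
Proof.
  intros Hl. unfold c, taylor_coef, Clm, sin_moment_value.
  replace (m - 1)%nat with n by (unfold m; lia). rewrite sum_n_rsum. fold m.
  replace (2 * m - 2 * l - 2)%nat with (2 * (n - l))%nat by (unfold m; lia).
  set (K := PI * (-1) ^ m * INR (fact (2 * m)) / 2 ^ (2 * m)).
  set (R0 := rsum _ m).
  set (a := (-1) ^ l * 2 ^ (2 * l + 1)). set (b := INR (fact (2 * l + 1))). set (d := INR (fact (2 * (n - l)))).
  assert (Hb : b <> 0) by apply INR_fact_neq_0. assert (Hd : d <> 0) by apply INR_fact_neq_0.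
  rewrite !RtoC_mult, !RtoC_opp, !RtoC_div, !RtoC_mult
    by (auto; apply Rmult_integral_contrapositive; auto).
  field. split; now apply RtoC_nz.
Qed.

Lemma sine_power_integral :
  is_integral_0_infty
    (fun x => (f (RtoC x) * RtoC (sin (lambda * x) ^ (2 * m)) / RtoC (x ^ (2 * m)))%C)
    (RtoC (INR (fact (2 * m)) / (2 ^ (2 * m) * INR (fact m) ^ 2)) * L
     - RtoC (PI * (-1) ^ m * INR (fact (2 * m)) / 2 ^ (2 * m))
       * csum (fun l => (Clm f l m * RtoC (lambda ^ (2 * l + 1)))%C) (m - 1))%C.
Proof.
  apply integral_0_infty_of_Cmoment.
  - intros x Hx. apply (rcont_quotient (fun x => f (RtoC x) * RtoC (sin (lambda * x) ^ (2 * m)))%C); auto.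
    apply rcont_mult; [apply f_rcont|]. apply rcont_RtoC.
    apply (ex_derive_continuous (V := R_NormedModule)). auto_derive. auto.
  - eapply Cmoment_ext; [intros x Hx; symmetry; apply integrand_expansion, Hx| |].
    2:{ apply Cmoment_plus.
        - apply (Cmoment_csum (fun k x => g (RtoC x) * RtoC (cos (Rabs (node m k) * (lambda * x))))%C
            (fun k => RtoC (weight m k)) (fun k => if Nat.eq_dec k m then L else RtoC 0)).
          intros k _. apply cosine_Cmoment.
        - apply (Cmoment_csum (fun j x => RtoC (sin (lambda * x) ^ (2 * m) / x ^ S (polar_expo n j)))
            c (fun j => RtoC (sin_moment_value m (n - j) lambda))).
          intros j Hj. unfold polar_expo. apply Cmoment_of_moment. apply moment_sin_pow; [lra|unfold m; lia]. }
    (* Of the cosine terms only the middle one survives, with its central binomial weight. *)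
    rewrite (csum_single _ (2 * m) m); [|lia|intros k _ Hk; destruct (Nat.eq_dec k m); [easy|ring]].
    destruct (Nat.eq_dec m m) as [_|]; [|easy]. rewrite weight_middle. unfold Cminus. f_equal.
    (* The Taylor terms are summed over [j = n - l], in the opposite order to the theorem. *)
    rewrite <- csum_rev.
    rewrite (csum_ext _ (fun l => - RtoC (PI * (-1) ^ m * INR (fact (2 * m)) / 2 ^ (2 * m))
      * (Clm f l m * RtoC (lambda ^ (2 * l + 1))))%C).
    + rewrite csum_scal. replace (m - 1)%nat with n by (unfold m; lia). ring.
    + intros l Hl. rewrite <- Clm_moment by auto. replace (n - (n - l))%nat with l by lia. reflexivity.
Qed.

End Assembly.

Theorem theorem1 (f : C -> C) (tau : R) (tau_gt0 : 0 < tau)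
  (f_entire : entire f) (f_type : exponential_type f tau)
  (f_even : forall z : C, f (- z)%C = f z)
  (m : nat) (m_gt0 : (0 < m)%nat)
  (lambda : R) (lambda_gt : tau / 2 < lambda)
  (tail_cv : forall eps : R, 0 < eps ->
     exists v : C,
       is_tail_integral (fun x => (f (RtoC x) / RtoC (x ^ (2 * m)))%C) eps v) :
  (exists FP : C,
     is_finite_part (fun x => (f (RtoC x) / RtoC (x ^ (2 * m)))%C) FP) /\
  (forall FP : C,
     is_finite_part (fun x => (f (RtoC x) / RtoC (x ^ (2 * m)))%C) FP ->
     is_integral_0_infty
       (fun x => (f (RtoC x) * RtoC (sin (lambda * x) ^ (2 * m))
                  / RtoC (x ^ (2 * m)))%C)
       (RtoC (INR (fact (2 * m)) / (2 ^ (2 * m) * INR (fact m) ^ 2)) * FP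
        - RtoC (PI * (-1) ^ m * INR (fact (2 * m)) / 2 ^ (2 * m))
          * sum_n (G := C_AbelianMonoid)
              (fun l => (Clm f l m * RtoC (lambda ^ (2 * l + 1)))%C)
              (m - 1))%C).
Proof.
  destruct m as [|n]; [lia|]. clear m_gt0.
  assert (f_holo : forall z, holo f z) by (now apply entire_holo).
  destruct (even_taylor f n f_holo f_even) as (g & g_holo & g_even & f_taylor).
  (* The midpoint of [tau] and [2 lambda]: above the type, so that [g] grows at most at this rate,
     and below every nonzero frequency. *)
  set (s := (tau + 2 * lambda) / 2).
  destruct (even_taylor_growth f g (taylor_coef f) n tau s g_holo f_type) as (A & A_ge0 & g_growth);
    [auto|unfold s; lra|auto|].
  destruct (exists_primitive g g_holo) as [G0 G0_deriv].
  set (G := fun z => (G0 z - G0 0)%C).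
  assert (G_deriv : forall z, cderiv G z (g z)).
  { intros z. eapply cderiv_eq; [apply cderiv_minus; [apply G0_deriv|apply cderiv_const]|]. ring. }
  assert (G_0 : G 0 = 0) by (unfold G; ring).
  (* The tail from 1 determines the limit at infinity of the primitive [U], and with it [L]. *)
  destruct (tail_cv 1 Rlt_0_1) as [v Hv].
  set (U := fun x => (G (x, 0%R) + - (1) * polar_part (taylor_coef f) n n x)%C).
  assert (HU := tail_integral_tends _ U (U_rderiv f g G n f_taylor G_deriv) (F_rcont f n f_holo) 1 v Rlt_0_1 Hv).
  set (L := (v + U 1)%C) in *. split.
  - exists L. exact (finite_part_exists f g G n L f_holo f_taylor G_deriv G_0 HU).
  - intros FP HFP. rewrite (finite_part_unique f g G n L f_holo f_taylor G_deriv G_0 FP HU HFP).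
    apply (sine_power_integral f g G A s lambda n L); auto; try (unfold s; lra).
    exact (G_tends_of_U f G n L HU).
Qed.
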